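(* Let $U\subset\mathbb{C}^N$ be a domain and $V=\{x''=0\}\subset U$ a linear complex submanifold of codimension $n$, bounded and simply connected with smooth boundary. Let $T$ be a positive closed $(p,p)$-current on $U$. Suppose that for every $i=\max\{n-p,0\},\dots,\min\{N-p,n\}$ the family $\big(T\wedge\mathcal T_{\lambda^{-1}}^i\wedge\pi_V^*\omega_V^{N-p-i}\big)_{1\ll|\lambda|}$ has locally uniformly bounded mass in $U$. Then tangent currents of $T$ along $V$ exist.
   Context: Conventions: $dd^c=\frac i\pi\partial\bar\partial$. Coordinates on $U\subset\mathbb{C}^N$ are $x=(x',x'')$ with $x'\in\mathbb{C}^{N-n}$, $x''\in\mathbb{C}^n$ ($1\le n\le N$). $E=V\times\mathbb{C}^n$ is the normal bundle of $V$, $\pi_V:E\to V$ the projection; $U$ is regarded as an open subset of $E$. $\omega_V=dd^c|x'|^2$. For $\theta\in\mathbb{C}^*$, $u_\theta^{\mathcal T}:=\frac12\log(|x''|^2+|\theta|^2)$ and $\mathcal T_\theta^i:=(dd^cu_\theta^{\mathcal T})^i$ (so $\mathcal T_\theta^0=1$). For $\lambda\in\mathbb{C}^*$, $A_\lambda:E\to E$ is $(x',x'')\mapsto(x',\lambda x'')$. A tangent current of $T$ along $V$ is a positive closed current $T_\infty$ on $E$ with $T_\infty=\lim_j(A_{\lambda_j})_*(\mathbf 1_UT)$ on $E$ for some sequence $\lambda_j\to\infty$ in $\mathbb{C}^*$. *)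

(* Defs.v *)
From HB Require Import structures.
From mathcomp Require Import all_boot all_order all_algebra.
From mathcomp Require Import all_classical all_reals all_analysis.
From mathcomp Require Import complex.
Set Implicit Arguments.
Unset Strict Implicit.
Unset Printing Implicit Defensive.
Import Order.TTheory GRing.Theory Num.Theory numFieldNormedType.Exports.
Local Open Scope classical_set_scope.
Local Open Scope ring_scope.
Local Open Scope complex_scope.

(* The norm topology on R[i], which the library declares only on R[i]^o. *)
HB.instance Definition _ (R : realType) := NormedModule.copy R[i] R[i]^o.

(* The modulus as an element of R: in MathComp `|x| : R[i]. *)
Definition cabs (R : realType) (x : R[i]) : R := complex.Re `|x|.

Definition norm2 (R : realType) (N : nat) (x : 'rV[R[i]]_N) : R :=
  \sum_(j < N) cabs (x 0 j) ^+ 2.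

Section Smooth.
Context {R : realType} {N : nat}.
Local Notation Cn := 'rV[R[i]]_N.
Implicit Types (f : Cn -> R[i]) (z v : Cn).

(* Derivatives along real lines t |-> z + t v, v being any vector of C^N. *)
Definition dir_derivable f z v : Prop :=
  derivable (fun t : R => complex.Re (f (z + t%:C *: v))) 0 1 /\
  derivable (fun t : R => complex.Im (f (z + t%:C *: v))) 0 1.

Definition dir_derive f v z : R[i] :=
  derive1 (fun t : R => complex.Re (f (z + t%:C *: v))) 0 +i*
  derive1 (fun t : R => complex.Im (f (z + t%:C *: v))) 0.

Fixpoint Ck_on (k : nat) (W : set Cn) f : Prop :=
  (forall z, W z -> {for z, continuous f}) /\
  if k is k'.+1 then
    forall v, (forall z, W z -> dir_derivable f z v) /\
              Ck_on k' W (dir_derive f v)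
  else True.

Definition smooth_on (W : set Cn) f : Prop := forall k, Ck_on k W f.

(* The real coordinate directions d/dx_j (false, j) and d/dy_j (true, j),
   where z_j = x_j + i y_j. *)
Definition coord_dir (s : bool * 'I_N) : Cn :=
  (if s.1 then 'i else 1) *: delta_mx 0 s.2.

Definition partial (s : seq (bool * 'I_N)) f : Cn -> R[i] :=
  foldr (fun a g => dir_derive g (coord_dir a)) f s.

(* Wirtinger derivatives d/dz_j and d/d(conj z_j). *)
Definition wirt (j : 'I_N) f : Cn -> R[i] := fun z =>
  2^-1 * (dir_derive f (coord_dir (false, j)) z
          - 'i * dir_derive f (coord_dir (true, j)) z).
Definition wirt_bar (j : 'I_N) f : Cn -> R[i] := fun z =>
  2^-1 * (dir_derive f (coord_dir (false, j)) z
          + 'i * dir_derive f (coord_dir (true, j)) z).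

End Smooth.

(* The complexified exterior algebra of C^N, on the 2N generators
   dz_1, ..., dz_N (indices lshift N j) and their conjugates (indices
   rshift N j).  a A is the coefficient of a on the product e_A of the
   generators in A, taken in increasing order of the indices. *)
Notation extalg R N := {ffun {set 'I_(N + N)} -> R[i]}.

Section Exterior.
Context {R : realType} {N : nat}.

Definition egen (k : 'I_(N + N)) : extalg R N :=
  [ffun A => (A == [set k]%SET)%:R].
Definition edz (j : 'I_N) : extalg R N := egen (lshift N j).
Definition edzb (j : 'I_N) : extalg R N := egen (rshift N j).

Definition eone : extalg R N := [ffun A => (A == finset.set0)%:R].

(* e_B /\ e_C = (-1)^(inversions B C) e_(B :|: C) for disjoint B and C. *)
Definition inversions (B C : {set 'I_(N + N)}) : nat :=
  #|[set x : 'I_(N + N) * 'I_(N + N) |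
      [&& x.1 \in B, x.2 \in C & (x.2 < x.1)%N]]%SET|.

Definition ewedge (a b : extalg R N) : extalg R N :=
  [ffun A => \sum_(B in powerset A)
     (-1) ^+ inversions B (A :\: B) * a B * b (A :\: B)].

Definition has_bidegree (p q : nat) (a : extalg R N) : Prop :=
  forall A : {set 'I_(N + N)}, a A != 0 ->
    #|[set j : 'I_N | lshift N j \in A]%SET| = p /\
    #|[set j : 'I_N | rshift N j \in A]%SET| = q.

(* i alpha /\ conj(alpha), for alpha = \sum_j alpha_j dz_j. *)
Definition epos1 (alpha : 'rV[R[i]]_N) : extalg R N :=
  'i *: ewedge (\sum_j alpha 0 j *: edz j) (\sum_j (alpha 0 j)^* *: edzb j).

Definition strongly_positive (q : nat) (a : extalg R N) : Prop :=
  exists (r : nat) (c : 'I_r -> R) (alpha : 'I_r -> 'I_q -> 'rV[R[i]]_N),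
    (forall s, 0 <= c s) /\
    a = \sum_(s < r) (c s)%:C *: \big[ewedge/eone]_(j < q) epos1 (alpha s j).

End Exterior.

Definition dform (R : realType) (N : nat) := 'rV[R[i]]_N -> extalg R N.

Section Forms.
Context {R : realType} {N : nat}.
Implicit Types (phi psi : dform R N) (U W : set 'rV[R[i]]_N).

Definition form0 (f : 'rV[R[i]]_N -> R[i]) : dform R N := fun z => f z *: eone.

Definition dwedge phi psi : dform R N := fun z => ewedge (phi z) (psi z).

Definition wedge_pow phi (k : nat) : dform R N :=
  iter k (dwedge phi) (form0 (fun=> 1)).

Definition del phi : dform R N := fun z =>
  \sum_(j < N) ewedge (edz j) [ffun A => wirt j (fun w => phi w A) z].
Definition delbar phi : dform R N := fun z =>
  \sum_(j < N) ewedge (edzb j) [ffun A => wirt_bar j (fun w => phi w A) z].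
Definition dext phi : dform R N := fun z => del phi z + delbar phi z.

Definition ddc (u : 'rV[R[i]]_N -> R) : dform R N := fun z =>
  ('i / (pi : R)%:C) *: del (delbar (form0 (fun z => (u z)%:C))) z.

Definition supported_in (K : set 'rV[R[i]]_N) phi : Prop :=
  forall z, ~ K z -> phi z = 0.

(* Smooth forms (not necessarily of pure degree) with compact support in U,
   extended by zero to C^N. *)
Definition test_form U phi : Prop :=
  (forall A, smooth_on setT (fun z => phi z A)) /\
  exists K, [/\ compact K, K `<=` U & supported_in K phi].

End Forms.

Definition pullback (R : realType) (M N : nat)
    (f : 'rV[R[i]]_M -> 'rV[R[i]]_N) (phi : dform R N) : dform R M :=
  let coord (k : 'I_(N + N)) (z : 'rV[R[i]]_M) : R[i] :=
    match fintype.split k with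
    | inl j => f z 0 j
    | inr j => (f z 0 j)^*
    end in
  fun z => \sum_(A : {set 'I_(N + N)})
    phi (f z) A *: \big[ewedge/eone]_(k in A) dext (form0 (coord k)) z.

Section Currents.
Context {R : realType} {N : nat}.
Implicit Types (T S : dform R N -> R[i]) (U W : set 'rV[R[i]]_N).

(* A current on U is a continuous linear functional on test forms on U; its
   values on other forms are meaningless.  Continuity is that of the LF
   topology: for each compact K, a bound by some C^k norm on K. *)
Definition current U T : Prop :=
  (forall (a : R[i]) phi psi, test_form U phi -> test_form U psi ->
     T (fun z => a *: phi z + psi z) = a * T phi + T psi) /\
  (forall K, compact K -> K `<=` U ->
     exists (C : R) (k : nat), forall (phi : dform R N) (B : R),
       test_form U phi -> supported_in K phi ->
       (forall A s z, (size s <= k)%N ->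
          cabs (partial s (fun w => phi w A) z) <= B) ->
       cabs (T phi) <= C * B).

(* A (p,p)-current vanishes on test forms of bidegree other than
   (N - p, N - p). *)
Definition pp_current (p : nat) U T : Prop :=
  current U T /\
  forall a b phi, (a, b) <> ((N - p)%N, (N - p)%N) ->
    test_form U phi -> (forall z, has_bidegree a b (phi z)) -> T phi = 0.

(* Positivity in the sense of Lelong (weak positivity): tested against strongly
   positive forms.  In R[i], 0 <= x means that x is real and nonnegative. *)
Definition positive_current (p : nat) U T : Prop :=
  forall phi, test_form U phi ->
    (forall z, strongly_positive (N - p) (phi z)) -> 0 <= T phi.

Definition closed_current U T : Prop :=
  forall phi, test_form U phi -> T (dext phi) = 0.

Definition positive_closed (p : nat) U T : Prop :=
  [/\ pp_current p U T, positive_current p U T & closed_current U T].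

Definition cwedge T (alpha : dform R N) : dform R N -> R[i] :=
  fun phi => T (dwedge alpha phi).

(* Mass on an open set W of a current of bidegree (N,N), that is, of a measure;
   test forms are then functions. *)
Definition mass W S : \bar R :=
  ereal_sup [set (cabs (S (form0 f)))%:E | f in
    [set f | test_form W (form0 f) /\ forall z, cabs (f z) <= 1]].

Definition loc_unif_bounded_mass (I : Type) (D : set I) U
    (S : I -> dform R N -> R[i]) : Prop :=
  forall x, U x -> exists W, [/\ open W, W x, W `<=` U &
    exists C : R, forall l, D l -> (mass W (S l) <= C%:E)%E].

End Currents.

Section Geometry.
Context {R : realType}.

Definition simply_connected (X : topologicalType) (A : set X) : Prop :=
  [/\ A !=set0,
      forall x y, A x -> A y -> exists g : R -> X,
        [/\ {within `[0, 1], continuous g}, g @` `[0, 1] `<=` A,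
            g 0 = x & g 1 = y] &
      forall g : R -> X, {within `[0, 1], continuous g} ->
        g @` `[0, 1] `<=` A -> g 0 = g 1 ->
        exists H : R * R -> X,
          [/\ {within `[0, 1] `*` `[0, 1], continuous H},
              H @` (`[0, 1] `*` `[0, 1]) `<=` A,
              forall t, t \in `[0, 1] -> H (0, t) = g t,
              forall t, t \in `[0, 1] -> H (1, t) = g 0 &
              forall s, s \in `[0, 1] -> H (s, 0) = g 0 /\ H (s, 1) = g 0]].

Definition smooth_boundary (m : nat) (V : set 'rV[R[i]]_m) : Prop :=
  forall a, closure V a -> ~ interior V a ->
    exists (W : set 'rV[R[i]]_m) (rho : 'rV[R[i]]_m -> R),
      [/\ open W, W a, smooth_on W (fun z => (rho z)%:C),
          forall z, W z -> (V z <-> rho z < 0) &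
          exists v, dir_derive (fun z => (rho z)%:C) v a != 0].

End Geometry.

(* C^(m + n) has coordinates x = (x', x'') = (lsubmx x, rsubmx x). *)
Section Tangent.
Context {R : realType} {m n : nat}.
Implicit Types (U : set 'rV[R[i]]_(m + n)) (T : dform R (m + n) -> R[i]).

(* V = U `&` {x'' = 0}, seen as a subset of C^m. *)
Definition zero_section U : set 'rV[R[i]]_m := [set x' | U (row_mx x' 0)].

Definition normal_bundle (V : set 'rV[R[i]]_m) : set 'rV[R[i]]_(m + n) :=
  [set x | V (lsubmx x)].

Definition omegaV : dform R m := ddc (@norm2 R m).

Definition uT (theta : R[i]) (x : 'rV[R[i]]_(m + n)) : R :=
  2^-1 * ln (norm2 (rsubmx x) + cabs theta ^+ 2).

Definition TT (theta : R[i]) (i : nat) : dform R (m + n) :=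
  wedge_pow (ddc (uT theta)) i.

Definition dilation (lambda : R[i]) (x : 'rV[R[i]]_(m + n)) :
  'rV[R[i]]_(m + n) := row_mx (lsubmx x) (lambda *: rsubmx x).

Definition pushforward (f : 'rV[R[i]]_(m + n) -> 'rV[R[i]]_(m + n)) T :
  dform R (m + n) -> R[i] := fun phi => T (pullback f phi).

(* For every test form phi on the normal bundle, the pullback of phi by the
   dilation is, for large lambda, a test form on U; there (indicator of U) T
   agrees with T, whether or not it is defined near the boundary of U. *)
Definition tangent_current (p : nat) U T (Tinf : dform R (m + n) -> R[i]) :
    Prop :=
  positive_closed p (normal_bundle (zero_section U)) Tinf /\
  exists lambda : nat -> R[i],
    [/\ forall j, lambda j != 0,
        cabs (lambda j) @[j --> \oo] --> +oo &
        forall phi, test_form (normal_bundle (zero_section U)) phi ->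
          (\forall j \near \oo,
             test_form U (pullback (dilation (lambda j)) phi)) /\
          (pushforward (dilation (lambda j)) T phi @[j --> \oo] --> Tinf phi)].

End Tangent.

(* Main.v *)
(* Only positive real lambda are used.  Let A be the dilation of E by lambda and
   T_1 = dd^c u_1.  As A^* T_1 is the form attached to 1/lambda and
   A^* pi_V^* omega_V = pi_V^* omega_V, the mass hypotheses bound, locally on E
   and uniformly for large lambda, the trace measure of A_* T with respect to
   (T_1 + pi_V^* omega_V)^(N-p); the powers outside the given range of i vanish
   for degree reasons.  By Lagrange's identity T_1 + pi_V^* omega_V dominates a
   multiple of the Euclidean Kaehler form where |x''| is bounded, hence it
   dominates every form i alpha /\ conj(alpha); as products of such forms span
   all (N-p,N-p)-forms, A_* T is bounded on test forms supported in a fixed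
   compact set by the sup norm of their coefficients.  The limit of A_* T along
   an ultrafilter finer than lambda -> +oo is then a positive closed current.
   Test forms are separable for the sup norm, with supports kept in a compact
   neighbourhood, so a sequence lambda_j converging to the same limit on a
   countable dense family converges on all test forms. *)

(* A current is here only a functional on smooth test forms, and no measure is extracted from T:
   every estimate compares two test forms in the cone of strongly positive ones. Positivity of T is
   given on that cone alone, so domination must be proved inside it, for products of N - p factors;
   this is why Lagrange's identity is written as a sum of terms i alpha /\ conj(alpha). Pulled-back
   test forms have supports collapsing onto the zero section, so a mass bound near a point of V
   serves at every point of the fibre above it. Thresholds for lambda must depend only on the
   compact support, not on the form. The ultrafilter defines the limit on all test forms at once,
   and linearity, positivity and closedness pass to it directly. It does not provide the sequence
   that the definition asks for; this is recovered afterwards. As the estimate has order zero, no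
   smooth dense family has to be built: countably many rational codes describe test forms up to a
   small sup-norm error, and one test form is picked for each code that admits one. *)
Require Import Defs.
From HB Require Import structures.
From mathcomp Require Import all_boot all_order all_algebra.
From mathcomp Require Import reals.
From mathcomp Require Import complex.
From mathcomp Require Import ring lra.
Set Implicit Arguments.
Unset Strict Implicit.
Unset Printing Implicit Defensive.
Import Order.TTheory GRing.Theory Num.Theory.
Local Open Scope complex_scope.
Local Open Scope ring_scope.

(** * The exterior algebra *)

Section ExteriorRing.
Context {R : realType} {N : nat}.
Implicit Types (a b c : extalg R N) (A B C : {set 'I_(N + N)}).

Definition ebas A : extalg R N := [ffun B => (B == A)%:R].

Lemma ebas_expand a : a = \sum_A a A *: ebas A.
Proof.
apply/ffunP => B; rewrite sum_ffunE (bigD1 B)//= big1 => [|C CB].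
  by rewrite addr0 !ffunE eqxx /GRing.scale/= mulr1.
by rewrite !ffunE eq_sym (negPf CB) /GRing.scale/= mulr0.
Qed.

Lemma ewedgeDl a b c : ewedge (a + b) c = ewedge a c + ewedge b c.
Proof.
apply/ffunP => A; rewrite !ffunE -big_split/=; apply: eq_bigr => B _.
by rewrite !ffunE mulrDr mulrDl.
Qed.

Lemma ewedgeDr a b c : ewedge c (a + b) = ewedge c a + ewedge c b.
Proof.
apply/ffunP => A; rewrite !ffunE -big_split/=; apply: eq_bigr => B _.
by rewrite !ffunE mulrDr.
Qed.

Lemma ewedgeZl (k : R[i]) a b : ewedge (k *: a) b = k *: ewedge a b.
Proof.
apply/ffunP => A; rewrite !ffunE /GRing.scale/= big_distrr;
  apply: eq_bigr => B _.
by rewrite !ffunE /GRing.scale/=; ring.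
Qed.

Lemma ewedgeZr (k : R[i]) a b : ewedge a (k *: b) = k *: ewedge a b.
Proof.
apply/ffunP => A; rewrite !ffunE /GRing.scale/= big_distrr;
  apply: eq_bigr => B _.
by rewrite !ffunE /GRing.scale/=; ring.
Qed.

Lemma ewedge_suml (I : Type) (r : seq I) (P : pred I) F b :
  ewedge (\sum_(i <- r | P i) F i) b = \sum_(i <- r | P i) ewedge (F i) b.
Proof.
apply: (big_morph (ewedge^~ b)) => [x y|]; first exact: ewedgeDl.
by rewrite -[0 in LHS](scale0r 0) ewedgeZl scale0r.
Qed.

Lemma ewedge_sumr (I : Type) (r : seq I) (P : pred I) F b :
  ewedge b (\sum_(i <- r | P i) F i) = \sum_(i <- r | P i) ewedge b (F i).
Proof.
apply: (big_morph (ewedge b)) => [x y|]; first exact: ewedgeDr.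
by rewrite -[0 in LHS](scale0r 0) ewedgeZr scale0r.
Qed.

(** In the sum defining the coefficient on [D], only the splitting of [D] into [A] and [B] can
    contribute, and it is available exactly when [A] and [B] are disjoint with union [D]. *)
Lemma ebas_wedge A B : ewedge (ebas A) (ebas B) =
  ([disjoint A & B]%:R * (-1) ^+ inversions A B) *: ebas (A :|: B).
Proof.
apply/ffunP => D; rewrite !ffunE /GRing.scale/=.
have [dAB|ndAB] := boolP [disjoint A & B].
  rewrite mul1r; case: (eqVneq D (A :|: B)) => [->|DAB].
    rewrite (bigD1 A) ?powersetE ?subsetUl//= big1 ?addr0.
      have -> : (A :|: B) :\: A = B.
        by rewrite setDUl setDv set0U; apply/setDidPl; rewrite disjoint_sym.
      by rewrite !ffunE !eqxx !mulr1.
    by move=> C /andP[_ CA]; rewrite !ffunE (negPf CA) mulr0 mul0r.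
  rewrite mulr0 big1// => C; rewrite powersetE => CD; rewrite !ffunE.
  have [CA|] := eqVneq C A; last by rewrite mulr0 mul0r.
  have [DCB|] := eqVneq (D :\: C) B; last by rewrite mulr0.
  by case/eqP: DAB; apply/setP => x; rewrite -CA -DCB !inE;
    have := subsetP CD x; case: (x \in C) => //= ->.
rewrite !mul0r big1// => C; rewrite powersetE => CD; rewrite !ffunE.
have [CA|] := eqVneq C A; last by rewrite mulr0 mul0r.
have [DCB|] := eqVneq (D :\: C) B; last by rewrite mulr0.
case/negP: ndAB; rewrite -CA -DCB -setI_eq0; apply/eqP/setP => x.
by rewrite !inE; case: (x \in C).
Qed.

Lemma inversionsUl A B C : [disjoint A & B] ->
  inversions (A :|: B) C = (inversions A C + inversions B C)%N.
Proof.
move=> dAB; rewrite /inversions -cardsUI.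
set I := (_ :&: _ : {set _ * _}); have -> : I = set0.
  apply/setP => x; rewrite !inE.
  by have := @disjointFr _ _ _ x.1 dAB; case: (x.1 \in A) => // ->;
    rewrite ?andbF.
rewrite cards0 addn0; apply: eq_card => x; rewrite !inE.
by case: (x.1 \in A) => /=; case: (x.1 \in B); rewrite ?orbb ?orbF.
Qed.

Lemma inversionsUr A B C : [disjoint A & B] ->
  inversions C (A :|: B) = (inversions C A + inversions C B)%N.
Proof.
move=> dAB; rewrite /inversions -cardsUI.
set I := (_ :&: _ : {set _ * _}); have -> : I = set0.
  apply/setP => x; rewrite !inE.
  have := @disjointFr _ _ _ x.2 dAB; case: (x.2 \in A) => [->//|_];
    rewrite ?andbF//.
rewrite cards0 addn0; apply: eq_card => x; rewrite !inE.
by case: (x.1 \in C) => //=; case: (x.2 \in A) => /=; case: (x.2 \in B);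
  rewrite ?orbT ?orbF ?orbb.
Qed.

(** Both sides vanish unless the three sets are pairwise disjoint. Then both exponents are the sum
    of the inversions of the three pairs, since inversions are additive in each argument. *)
Lemma ebas_wedgeA A B C : ewedge (ebas A) (ewedge (ebas B) (ebas C)) =
  ewedge (ewedge (ebas A) (ebas B)) (ebas C).
Proof.
rewrite !ebas_wedge ewedgeZl ewedgeZr !ebas_wedge !scalerA setUA;
  congr (_ *: _).
have dU : [disjoint A & B :|: C] = [disjoint A & B] && [disjoint A & C].
  by rewrite -!setI_eq0 setIUr setU_eq0.
have dU' : [disjoint A :|: B & C] = [disjoint A & C] && [disjoint B & C].
  by rewrite -!setI_eq0 setIUl setU_eq0.
rewrite dU dU'.
have [dAB|] := boolP [disjoint A & B]; last by rewrite /= !mul0r mulr0.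
have [dAC|] := boolP [disjoint A & C]; last by rewrite /= !mul0r !mulr0.
have [dBC|] := boolP [disjoint B & C]; last by rewrite /= !mul0r !mulr0.
by rewrite /= !mul1r inversionsUl// inversionsUr// -!exprD; congr (_ ^+ _);
  ring.
Qed.

Lemma ebas_ind (P : extalg R N -> Prop) :
  (forall k a b, P a -> P b -> P (k *: a + b)) -> (forall A, P (ebas A)) ->
  forall a, P a.
Proof.
move=> PD Pb a.
have P0 : P 0 by rewrite -(addNr (ebas finset.set0)) -scaleN1r; apply: PD.
rewrite (ebas_expand a); elim: (index_enum _) => [|A s IHs];
  first by rewrite big_nil.
by rewrite big_cons; apply: PD.
Qed.

Lemma ewedgeA : associative (@ewedge R N).
Proof.
move=> a b c.
elim/ebas_ind: a => [k a a' IHa IHa'|A].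
  by rewrite !ewedgeDl !ewedgeZl IHa IHa'.
elim/ebas_ind: b => [k b b' IHb IHb'|B].
  by rewrite !ewedgeDl !ewedgeDr !ewedgeDl !ewedgeZl !ewedgeZr !ewedgeZl IHb
    IHb'.
elim/ebas_ind: c => [k c c' IHc IHc'|C].
  by rewrite !ewedgeDr !ewedgeZr IHc IHc'.
exact: ebas_wedgeA.
Qed.

Lemma ebas0 : ebas finset.set0 = eone. Proof. by []. Qed.
Lemma ebas1 k : ebas [set k]%SET = egen k. Proof. by []. Qed.

Lemma inversions0l A : inversions finset.set0 A = 0%N.
Proof. by apply/eqP; rewrite cards_eq0; apply/eqP/setP => x; rewrite !inE. Qed.
Lemma inversions0r A : inversions A finset.set0 = 0%N.
Proof. by apply/eqP; rewrite cards_eq0; apply/eqP/setP => x;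
  rewrite !inE andbF. Qed.

Lemma ewedge1l : left_id (@eone R N) (@ewedge R N).
Proof.
move=> a; rewrite {1}(ebas_expand a) ewedge_sumr [RHS]ebas_expand.
apply: eq_bigr => A _;
  rewrite ewedgeZr -ebas0 ebas_wedge -setI_eq0 set0I eqxx inversions0l.
by rewrite mul1r scale1r set0U.
Qed.

Lemma ewedge1r : right_id (@eone R N) (@ewedge R N).
Proof.
move=> a; rewrite {1}(ebas_expand a) ewedge_suml [RHS]ebas_expand.
apply: eq_bigr => A _; rewrite ewedgeZl -ebas0 ebas_wedge -setI_eq0 setI0 eqxx.
by rewrite inversions0r mul1r scale1r setU0.
Qed.

Lemma eone_neq0 : (@eone R N) != 0.
Proof. by apply/eqP => /ffunP/(_ finset.set0); rewrite !ffunE eqxx => /eqP;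
  rewrite oner_eq0. Qed.

End ExteriorRing.

(* An alias, so that the wedge product can be declared as a ring structure. *)
Definition ealg (R : realType) (N : nat) : Type := extalg R N.

Section EalgInstance.
Context (R : realType) (N : nat).
HB.instance Definition _ := GRing.Lmodule.copy (ealg R N) (extalg R N).
HB.instance Definition _ := GRing.Zmodule_isNzRing.Build (ealg R N)
  (@ewedgeA R N) (@ewedge1l R N) (@ewedge1r R N)
  (fun a b c => @ewedgeDl R N a b c) (fun a b c => @ewedgeDr R N b c a)
  (@eone_neq0 R N).
HB.instance Definition _ := GRing.Lmodule_isLalgebra.Build R[i] (ealg R N)
  (fun k (a b : ealg R N) => esym (@ewedgeZl R N k a b)).
HB.instance Definition _ := GRing.Lalgebra_isAlgebra.Build R[i] (ealg R N)
  (fun k (a b : ealg R N) => esym (@ewedgeZr R N k a b)).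
End EalgInstance.

(** The wedge product is not commutative, so the order of the factors matters: both sides run
    through [A] in the enumeration order of the index type. *)
Lemma big_enum_noncomm (T : Type) (idx : T) (op : T -> T -> T) (I : finType)
    (A : {set I}) (F : I -> T) :
  \big[op/idx]_(i in A) F i = \big[op/idx]_(i <- enum A) F i.
Proof. by rewrite -big_filter [index_enum _]unlock. Qed.

Section Generators.
Context {R : realType} {N : nat}.
Local Notation E := (ealg R N).
Local Notation gen k := (egen k : E).
Implicit Types (a b : E) (A B : {set 'I_(N + N)}) (k l : 'I_(N + N)).

Lemma ewedgeE a b : ewedge a b = a * b. Proof. by []. Qed.

Lemma eoneE : eone = 1 :> E. Proof. by []. Qed.

Lemma ebasM A B : (ebas A : E) * (ebas B : E) =
  ([disjoint A & B]%:R * (-1) ^+ inversions A B) *: (ebas (A :|: B) : E).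
Proof. exact: ebas_wedge. Qed.

Lemma inversions1 k A :
  inversions [set k] A = #|[set x in A | (x < k)%N]|.
Proof.
rewrite /inversions -[RHS](card_imset _ (inj_comp (fun x y (h : (k, x) = (k,
  y)) => congr1 snd h) (@inj_id _))).
apply: eq_card => -[x y]; rewrite !inE /=; apply/and3P/imsetP.
  by case=> /eqP -> yA yk; exists y => //; rewrite !inE yA.
by case=> z; rewrite !inE => /andP[zA zk] [-> ->].
Qed.

Lemma ebasU1 k A : {in A, forall l, (k < l)%N} ->
  gen k * (ebas A : E) = ebas (k |: A).
Proof.
move=> kA; rewrite -ebas1 ebasM inversions1.
have -> : [set x in A | (x < k)%N] = finset.set0.
  by apply/setP => x; rewrite !inE; apply/andP => -[/kA];
    rewrite ltnNge => /negP + /ltnW.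
rewrite disjoints1 cards0 mulr1.
have -> : k \notin A by apply/negP => /kA; rewrite ltnn.
by rewrite scale1r.
Qed.

Lemma prod_egen_sorted (s : seq 'I_(N + N)) : sorted (fun x y :
  'I_(N + N) => (x < y)%N) s ->
  \prod_(k <- s) gen k = ebas [set k in s].
Proof.
elim: s => [_|k s IHs /= kp].
  by rewrite big_nil -eoneE -ebas0; congr ebas; apply/setP => x; rewrite !inE.
rewrite big_cons IHs ?(path_sorted kp)// ebasU1.
  by congr ebas; apply/setP => x; rewrite !inE.
move=> l; rewrite inE => ls.
by have /allP/(_ _ ls) := order_path_min (fun x y z =>
  @ltn_trans (val x) (val y) (val z)) kp.
Qed.

Lemma enum_set_sorted A : sorted (fun x y : 'I_(N + N) => (x < y)%N) (enum A).
Proof.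
rewrite /enum_mem; apply: sorted_filter; first by move=> x y z;
  apply: ltn_trans.
by rewrite -enumT -(@sorted_map _ _ (@nat_of_ord (N +
  N)) ltn) val_enum_ord iota_ltn_sorted.
Qed.

(** The enumeration of a set of ordinals is increasing, so multiplying generators in that order
    produces no sign. A property stable under products then needs checking on generators only. *)
Lemma ebas_prod A : (ebas A : E) = \prod_(k in A) gen k.
Proof.
rewrite big_enum_noncomm prod_egen_sorted ?enum_set_sorted//.
by congr ebas; apply/setP => x; rewrite !inE mem_enum.
Qed.

Lemma egenC k l : gen k * gen l = - (gen l * gen k).
Proof.
rewrite -!ebas1 !ebasM !inversions1 !disjoints1 !inE.
have c1 (x y : 'I_(N + N)) :
  #|[set z in [set y] | (z < x)%N]| = (y < x)%N :> nat.
  case: (ltnP y x) => yx.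
    rewrite -[RHS](cards1 y); apply: eq_card => z; rewrite !inE.
    by case: eqP => // ->; rewrite yx.
  by apply/eqP; rewrite cards_eq0; apply/eqP/setP => z; rewrite !inE;
    case: eqP => //= ->; rewrite ltnNge yx.
rewrite !c1 -scaleNr [[set l] :|: _]finset.setUC; congr (_ *: _).
have [->|kl] := eqVneq k l; first by rewrite !mul0r oppr0.
rewrite !mul1r; have [lk|] := ltnP l k;
  first by rewrite ltnNge (ltnW lk) expr0 expr1.
rewrite leq_eqVlt; case: eqP => /= [/val_inj kl'|_ ->];
  first by rewrite kl' eqxx in kl.
by rewrite expr0 expr1 opprK.
Qed.

(** A generator changes sign twice when it crosses a product of two generators. Elements of degree
    two are therefore central, which later allows the binomial formula. *)
Lemma egen2_comm k l a : GRing.comm (gen k * gen l) a.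
Proof.
have cg x : GRing.comm (gen k * gen l) (gen x).
  rewrite /GRing.comm -(mulrA (gen k)) (egenC l x) mulrN (mulrA (gen k)) (egenC
    k x).
  by rewrite mulNr opprK (mulrA (gen x)).
move: a; apply: (@ebas_ind R N (fun a =>
  GRing.comm (gen k * gen l) (a : E))) => [c a b ca cb|A].
  by apply: (@commrD E) => //; rewrite /GRing.comm -scalerAl -scalerAr ca.
by rewrite ebas_prod; apply: commr_prod => j _; exact: cg.
Qed.

End Generators.

(** * Degree in a chosen set of generators *)

Section Grading.
Context {R : realType} {N : nat}.
Local Notation E := (ealg R N).
Implicit Types (a b : E) (G A : {set 'I_(N + N)}).

(** Only the generators in [G] are counted. With [G] the holomorphic fibre or base generators, this
    detects the powers that vanish for degree reasons. *)
Definition graded G d a := forall A, a A != 0 -> #|A :&: G| = d.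

Lemma graded0 G d : graded G d 0.
Proof. by move=> A; rewrite ffunE eqxx. Qed.

Lemma gradedD G d a b : graded G d a -> graded G d b -> graded G d (a + b).
Proof.
move=> ga gb A; rewrite ffunE; have [->|/ga//] := eqVneq (a A) 0.
by rewrite add0r => /gb.
Qed.

Lemma gradedZ G d k a : graded G d a -> graded G d (k *: a).
Proof.
move=> ga A; rewrite ffunE; have [->|/ga//] := eqVneq (a A) 0.
by rewrite scaler0 eqxx.
Qed.

Lemma graded_sum G d (I : Type) (r : seq I) (P : pred I) F :
  (forall i, P i -> graded G d (F i)) -> graded G d (\sum_(i <- r | P i) F i).
Proof.
move=> gF; apply: (big_ind (graded G d)) => // [|x y]; first exact: graded0.
exact: gradedD.
Qed.

Lemma graded_ebas G A : graded G #|A :&: G| (ebas A).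
Proof. by move=> B; rewrite ffunE; case: (eqVneq B A) => [->|];
  rewrite ?eqxx. Qed.

Lemma gradedM G d e a b : graded G d a -> graded G e b ->
  graded G (d + e) (a * b).
Proof.
move=> ga gb; rewrite (ebas_expand a) (ebas_expand b) mulr_suml.
apply: graded_sum => A _; rewrite mulr_sumr; apply: graded_sum => B _.
have [aA|aA] := eqVneq (a A) 0; first by rewrite aA scale0r mul0r;
  exact: graded0.
have [bB|bB] := eqVneq (b B) 0; first by rewrite bB scale0r mulr0;
  exact: graded0.
rewrite -scalerAl -scalerAr; apply/gradedZ/gradedZ; rewrite ebasM.
have [dAB|] := boolP [disjoint A & B]; last by rewrite mul0r scale0r => _;
  exact: graded0.
apply: gradedZ; rewrite -(ga _ aA) -(gb _ bB).
suff -> : (#|A :&: G| +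
  #|B :&: G| = #|(A :|: B) :&: G|)%N by exact: graded_ebas.
rewrite finset.setIUl cardsU [X in (_ - X)%N](_ : _ = 0)%N ?subn0//.
apply/eqP; rewrite cards_eq0; apply/eqP/setP => x; rewrite !inE.
by have := @disjointFr _ _ _ x dAB; case: (x \in A) => // ->; rewrite ?andbF.
Qed.

Lemma graded1 G : graded G 0 1.
Proof. by have := @graded_ebas G finset.set0; rewrite finset.set0I cards0. Qed.

Lemma gradedX G d a k : graded G d a -> graded G (d * k) (a ^+ k).
Proof.
move=> ga; elim: k => [|k IH]; first by rewrite muln0; exact: graded1.
by rewrite exprS mulnS; exact: gradedM.
Qed.

Lemma graded_vanish G d a : graded G d a -> (#|G| < d)%N -> a = 0.
Proof.
move=> ga Gd; apply/ffunP => A; rewrite ffunE; apply/eqP/negPn/negP => /ga Ad.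
by have := subset_leq_card (subsetIr A G); rewrite Ad leqNgt Gd.
Qed.

End Grading.

(** * Strongly positive forms *)

Lemma bilin_expand (K : comNzRingType) (A : algType K) (x y x' y' :
  K) (a b a' b' : A) :
  (x *: a + y *: b) * (x' *: a' + y' *: b') =
  (x * x') *: (a * a') + (x * y') *: (a * b') +
  (y * x') *: (b * a') + (y * y') *: (b * b').
Proof.
have Z (u v : K) (s t : A) : (u *: s) * (v *: t) = (u * v) *: (s * t).
  by rewrite -scalerAl -scalerAr scalerA.
by rewrite mulrDr !mulrDl !Z !addrA; congr (_ + _); rewrite -!addrA;
  congr (_ + _); rewrite addrC.
Qed.

(** In the application [d] is the conjugate of [c]. With G j k thought of as e_j tensor conj(e_k),
    the right side is half the sum over all pairs of d_j e_k - d_k e_j tensored with its conjugate;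
    every unordered pair occurs twice, hence [half]. *)
Lemma lagrange_identity (K : comNzRingType) (V : lmodType K) (I : finType)
    (half : K) (c d : I -> K) (G : I -> I -> V) : half + half = 1 ->
  (\sum_j c j * d j) *: (\sum_k G k k) - \sum_j \sum_k (c j * d k) *: G j k =
  \sum_j \sum_k half *: ((d j * c j) *: G k k + (d j * - c k) *: G k j +
    (- d k * c j) *: G j k + (- d k * - c k) *: G j j).
Proof.
move=> half2.
set S := _ *: _; set W := \sum_j _.
have S1 : \sum_j \sum_k (d j * c j) *: G k k = S.
  rewrite /S scaler_suml; apply: eq_bigr => j _; rewrite scaler_sumr.
  by apply: eq_bigr => k _; rewrite mulrC.
have S2 : \sum_j \sum_k (- d k * - c k) *: G j j = S.
  by rewrite exchange_big -S1; apply: eq_bigr => k _; apply: eq_bigr => j _;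
    rewrite mulrNN.
have W1 : \sum_j \sum_k (- d k * c j) *: G j k = - W.
  rewrite /W -sumrN; apply: eq_bigr => j _; rewrite -sumrN;
    apply: eq_bigr => k _.
  by rewrite mulNr scaleNr mulrC.
have W2 : \sum_j \sum_k (d j * - c k) *: G k j = - W.
  rewrite -W1 exchange_big; apply: eq_bigr => j _; apply: eq_bigr => k _.
  by rewrite mulrN mulNr.
have -> : \sum_j \sum_k half *: ((d j * c j) *: G k k + (d j * - c k) *: G k j +
    (- d k * c j) *: G j k + (- d k * - c k) *: G j j) = half *: (S - W - W +
      S).
  rewrite -{1}S1 -S2 -{1}W2 -{1}W1 -!big_split scaler_sumr;
    apply: eq_bigr => j _.
  by rewrite -!big_split scaler_sumr.
by rewrite addrAC -addrA scalerDr -scalerDl half2 scale1r.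
Qed.

Section Cones.
Context {R : realType} {N : nat}.
Local Notation E := (ealg R N).
Local Notation C := R[i].
Local Notation gen k := (egen k : E).
Implicit Types (a b : E) (q : nat) (c : 'rV[C]_N).

Definition eprod (s : seq 'rV[C]_N) : E := \prod_(al <- s) (epos1 al : E).

(* K is nonnegativity for strongly positive elements, and True for their
   complex span. *)
Definition cone (K : C -> Prop) q a := exists L : seq (C * seq 'rV[C]_N),
  (forall x, x \in L -> K x.1 /\ size x.2 = q) /\
  a = \sum_(x <- L) x.1 *: eprod x.2.

Section Closure.
Variable K : C -> Prop.

Lemma cone0 q : cone K q 0.
Proof. by exists [::]; split=> //; rewrite big_nil. Qed.

Lemma coneD q a b : cone K q a -> cone K q b -> cone K q (a + b).
Proof.
move=> [L [KL ->]] [M [KM ->]]; exists (L ++ M); rewrite big_cat; split=> // x.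
by rewrite mem_cat => /orP[/KL|/KM].
Qed.

Lemma cone_sum q (I : eqType) (r : seq I) F :
  (forall i, i \in r -> cone K q (F i)) -> cone K q (\sum_(i <- r) F i).
Proof.
elim: r => [|i r IH] h; first by rewrite big_nil; exact: cone0.
rewrite big_cons; apply: coneD; first by apply: h; rewrite mem_head.
by apply: IH => j jr; apply: h; rewrite inE jr orbT.
Qed.

Lemma cone_eprod q k s : K k -> size s = q -> cone K q (k *: eprod s).
Proof.
move=> Kk sq; exists [:: (k, s)]; rewrite big_seq1; split=> // x.
by rewrite inE => /eqP ->.
Qed.

Hypothesis KM : forall x y, K x -> K y -> K (x * y).

Lemma coneZ q k a : K k -> cone K q a -> cone K q (k *: a).
Proof.
move=> Kk [L [KL ->]]; rewrite scaler_sumr; apply: cone_sum => x /KL[Kx sx].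
by rewrite scalerA; apply: cone_eprod => //; exact: KM.
Qed.

Lemma coneM p q a b : cone K p a -> cone K q b -> cone K (p + q) (a * b).
Proof.
move=> [L [KL ->]] [M [KLM ->]]; rewrite mulr_suml;
  apply: cone_sum => x /KL[Kx sx].
rewrite mulr_sumr; apply: cone_sum => y /KLM[Ky sy].
rewrite -scalerAl -scalerAr scalerA /eprod -big_cat; apply: cone_eprod.
  exact: KM.
by rewrite size_cat sx sy.
Qed.

Lemma cone1 : K 1 -> cone K 0 1.
Proof.
by move=> K1; have := @cone_eprod 0 1 [::] K1 erefl;
  rewrite /eprod big_nil scale1r.
Qed.

End Closure.

Local Notation pos := (cone (fun x => 0 <= x)).
Local Notation span := (cone (fun=> True)).

(** Families indexed by ordinals become lists, so that sums and products of strongly positive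
    elements are concatenations. A nonnegative element of [R[i]] is real, which permits taking real
    parts of the coefficients. *)
Lemma strongly_positiveP q a : strongly_positive q a <-> pos q a.
Proof.
split=> [[r [c [alpha [c0 ->]]]]|[L [KL ->]]].
  apply: cone_sum => s _.
  have -> : \big[ewedge/eone]_(j < q) epos1 (alpha s j) =
      eprod [seq alpha s j | j <- index_enum 'I_q] by rewrite /eprod big_map.
  apply: cone_eprod; first by rewrite lecR.
  by rewrite size_map [index_enum _]unlock -enumT size_enum_ord.
pose x0 : C * seq 'rV[C]_N := (0, [::]).
exists (size L), (fun s => complex.Re (nth x0 L s).1).
exists (fun s j => nth 0 (nth x0 L s).2 j); split=> [s|].
  have /KL[] := mem_nth x0 (ltn_ord s).
  by rewrite lecE => /andP[].
rewrite (big_nth x0) big_mkord; apply: eq_bigr => s _.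
have /KL[x0s xq] := mem_nth x0 (ltn_ord s); congr (_ *: _).
  by case: (nth _ _ _).1 x0s => u v; rewrite lecE /= => /andP[/eqP -> _].
by rewrite /eprod (big_nth 0) xq big_mkord.
Qed.

Definition elin c : E := \sum_j c 0 j *: edz j.
Definition elinb c : E := \sum_j (c 0 j)^* *: edzb j.

Lemma epos1E c : epos1 c = 'i *: (elin c * elinb c).
Proof. by []. Qed.

Lemma elinD c d : elin (c + d) = elin c + elin d.
Proof. by rewrite -big_split; apply: eq_bigr => j _; rewrite mxE scalerDl. Qed.

Lemma elinZ (k : C) c : elin (k *: c) = k *: elin c.
Proof. by rewrite scaler_sumr; apply: eq_bigr => j _; rewrite mxE scalerA. Qed.

Lemma elinbD c d : elinb (c + d) = elinb c + elinb d.
Proof. by rewrite -big_split; apply: eq_bigr => j _;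
  rewrite mxE rmorphD scalerDl. Qed.

Lemma elinbZ (k : C) c : elinb (k *: c) = k^* *: elinb c.
Proof. by rewrite scaler_sumr; apply: eq_bigr => j _;
  rewrite mxE rmorphM scalerA. Qed.

Lemma elin_delta j : elin (delta_mx 0 j) = edz j.
Proof.
rewrite /elin (bigD1 j)//= big1 => [|k kj]; rewrite mxE eqxx.
  by rewrite eqxx scale1r addr0.
by rewrite (negPf kj) scale0r.
Qed.

Lemma elinb_delta j : elinb (delta_mx 0 j) = edzb j.
Proof.
rewrite /elinb (bigD1 j)//= big1 => [|k kj]; rewrite mxE eqxx.
  by rewrite eqxx rmorph1 scale1r addr0.
by rewrite (negPf kj) rmorph0 scale0r.
Qed.

Definition g2 j k : E := (edz j : E) * (edzb k : E).

Definition ebeta : E := \sum_j 'i *: g2 j j.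

Lemma epos1_pair (x y : C) j k :
  epos1 (x *: delta_mx 0 j + y *: delta_mx 0 k) =
  'i *: ((x * x^*) *: g2 j j + (x * y^*) *: g2 j k +
         (y * x^*) *: g2 k j + (y * y^*) *: g2 k k).
Proof.
rewrite epos1E elinD elinbD !elinZ !elinbZ !elin_delta !elinb_delta;
  congr (_ *: _).
exact: (@bilin_expand C E).
Qed.

Lemma epos1_delta j : epos1 (delta_mx 0 j) = 'i *: g2 j j.
Proof. by rewrite epos1E elin_delta elinb_delta. Qed.

Lemma pos1_epos1 c : pos 1%N (epos1 c).
Proof.
have := @cone_eprod (fun x => 0 <= x) 1 1 [:: c] ler01 erefl.
by rewrite scale1r /eprod big_seq1.
Qed.

Lemma pos1_ebeta : pos 1%N ebeta.
Proof. by apply: cone_sum => j _; rewrite -epos1_delta; exact: pos1_epos1. Qed.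

Lemma cabs_sqr (x : C) : (cabs x ^+ 2)%:C = x * x^*.
Proof.
rewrite /cabs; have -> : x * x^* = `|x| ^+ 2 by rewrite normCK.
have : 0 <= `|x| by [].
by case: `|x| => u v; rewrite lecE => /andP[/eqP /= -> _]; rewrite rmorphXn.
Qed.

Lemma norm2C c : (norm2 c)%:C = \sum_j c 0 j * (c 0 j)^*.
Proof. by rewrite rmorph_sum; apply: eq_bigr => j _; exact: cabs_sqr. Qed.

(** The difference is half the sum over [j] and [k] of i alpha /\ conj(alpha) with alpha = conj(c_j)
    dz_k - conj(c_k) dz_j. The Euclidean form thus dominates every [epos1 c], with an explicit
    constant. *)
Lemma lagrange c : pos 1%N ((norm2 c)%:C *: ebeta - epos1 c).
Proof.
pose al j k := (c 0 j)^* *: delta_mx 0 k + (- (c 0 k)^*) *: delta_mx 0 j :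
  'rV[C]_N.
suff -> : (norm2 c)%:C *: ebeta - epos1 c = \sum_j \sum_k 2^-1 *: epos1 (al j
  k).
  apply: cone_sum => j _; apply: cone_sum => k _.
  by apply: coneZ; [exact: mulr_ge0 | rewrite invr_ge0 ler0n | exact:
    pos1_epos1].
have -> : (norm2 c)%:C *: ebeta - epos1 c =
    (\sum_j c 0 j * (c 0 j)^*) *: (\sum_j 'i *: g2 j j) -
    \sum_j \sum_k (c 0 j * (c 0 k)^*) *: ('i *: g2 j k).
  rewrite norm2C; congr (_ - _).
  rewrite epos1E mulr_suml scaler_sumr; apply: eq_bigr => j _.
  rewrite mulr_sumr scaler_sumr; apply: eq_bigr => k _.
  have Z (A : algType C) (t u v : C) (a b : A) :
      t *: ((u *: a) * (v *: b)) = (u * v) *: (t *: (a * b)).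
    by rewrite -scalerAl -scalerAr !scalerA; congr (_ *: _); ring.
  exact: Z.
rewrite (@lagrange_identity C E _ 2^-1); last first.
  by have := @splitr C 1; rewrite !div1r => <-.
apply: eq_bigr => j _; apply: eq_bigr => k _; congr (_ *: _).
have Z (V : lmodType C) (t u1 u2 u3 u4 : C) (a1 a2 a3 a4 : V) :
   u1 *: (t *: a1) + u2 *: (t *: a2) + u3 *: (t *: a3) + u4 *: (t *: a4) =
   t *: (u1 *: a1 + u2 *: a2 + u3 *: a3 + u4 *: a4).
  by rewrite !scalerDr !scalerA !(mulrC t).
have cN (x : C) : (- x^*)^* = - x by rewrite -[in RHS](conjCK x) rmorphN.
by rewrite Z epos1_pair !cN !conjCK.
Qed.

Lemma eprod1 c : eprod [:: c] = epos1 c.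
Proof. exact: big_seq1. Qed.

Lemma epos1_polar (u : C) j k : epos1 (delta_mx 0 j + u *: delta_mx 0 k) =
  'i *: (1 *: g2 j j + u^* *: g2 j k + u *: g2 k j + (u * u^*) *: g2 k k).
Proof.
by rewrite -[delta_mx 0 j]scale1r epos1_pair rmorph1 !mul1r !mulr1.
Qed.

(* Polarization over the fourth roots of unity. *)
Lemma span_g2 j k : cone (fun=> True) 1 (g2 j k).
Proof.
(* The weight -i u / 4 cancels the factor i of [epos1]. Summed over the fourth roots of unity, u,
   u^2 and u |u|^2 give 0 while u conj(u) gives 4, so only the coefficient of [g2 j k] survives. *)
pose w u : C := - 'i / 4 * u.
pose F u : E := w u *: eprod [:: (delta_mx 0 j + u *: delta_mx 0 k : 'rV[C]_N)].
suff -> : g2 j k = (F 1 + F 'i) + (F (-1) + F (-'i)).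
  by do 2 apply: coneD; apply: cone_eprod.
have merge (V : lmodType C) (a b c d : V) (p q r s p' q' r' s' : C) :
    (p *: a + q *: b + r *: c + s *: d) + (p' *: a + q' *: b + r' *: c +
      s' *: d) =
    (p + p') *: a + (q + q') *: b + (r + r') *: c + (s + s') *: d.
  by rewrite !scalerDl addrACA [X in X + _]addrACA [X in X + _ + _]addrACA.
have distr (V : lmodType C) (a b c d : V) (x y p q r s : C) :
    x *: (y *: (p *: a + q *: b + r *: c + s *: d)) =
    (x * y * p) *: a + (x * y * q) *: b + (x * y * r) *: c + (x * y * s) *: d.
  by rewrite !scalerDr !scalerA.
have FE u : F u = (w u * 'i * 1) *: g2 j j + (w u * 'i * u^*) *: g2 j k +
    (w u * 'i * u) *: g2 k j + (w u * 'i * (u * u^*)) *: g2 k k.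
  by rewrite /F eprod1 epos1_polar distr.
have four : (4 : C) != 0 by rewrite pnatr_eq0.
have fin (V : lmodType C) (a b c d : V) (p q r s : C) :
    p = 0 -> q = 1 -> r = 0 -> s = 0 -> b = p *: a + q *: b + r *: c + s *: d.
  by move=> -> -> -> ->; rewrite !scale0r scale1r add0r !addr0.
have ii : 'i * 'i = -1 :> C by rewrite -expr2 sqrCi.
suff main (V : lmodType C) (a b c d : V) (f : C -> V) :
    (forall u, f u = (w u * 'i * 1) *: a + (w u * 'i * u^*) *: b +
      (w u * 'i * u) *: c + (w u * 'i * (u * u^*)) *: d) ->
    b = f 1 + f 'i + (f (-1) + f (-'i)) by exact: (main E _ _ _ _ F FE).
move=> fE; rewrite (fE 1) (fE 'i) (fE (-1)) (fE (- 'i)) !merge /w.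
have cN (u : C) : (- u)^* = - u^* by rewrite rmorphN.
rewrite !cN !conjC1 !conjCi; set t : C := 'i in ii *.
apply: fin.
- by field.
- transitivity (((t * t) * (t * t) - t * t) / 2); first by field.
  by rewrite ii; field.
- transitivity (- (t * t) * (1 + t * t) / 2);
  [by field | by rewrite ii subrr mulr0 mul0r].
- by field.
Qed.

Lemma cardsD1_eq (T : finType) (A : {set T}) x n : x \in A -> #|A| = n.+1 ->
  #|A :\ x| = n.
Proof. by move=> xA; rewrite (cardsD1 x) xA => -[]. Qed.

Definition holo : {set 'I_(N + N)} := [set lshift N j | j in 'I_N].
Definition antiholo : {set 'I_(N + N)} := [set rshift N j | j in 'I_N].

(** Induction on [q]: one dz_j and one conjugate generator are split off and contribute [g2 j k] up
    to sign. Coefficients in the span are arbitrary, so they absorb the signs. *)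
Lemma span_ebas q A : #|A :&: holo| = q -> #|A :&: antiholo| = q ->
  cone (fun=> True) q (ebas A).
Proof.
elim: q A => [|q IH] A.
  move=> /eqP; rewrite cards_eq0 => /eqP h /eqP; rewrite cards_eq0 => /eqP ah.
  suff -> : A = finset.set0 by rewrite ebas0 eoneE; exact: cone1.
  apply/setP => x; rewrite !inE; apply/negP => xA.
  case: (fintype.split_ordP x) => j xj.
    by move/setP/(_ x): h; rewrite !inE xA xj imset_f.
  by move/setP/(_ x): ah; rewrite !inE xA xj imset_f.
move=> hq aq.
have /card_gt0P[x] : (0 < #|A :&: holo|)%N by rewrite hq.
rewrite inE => /andP[xA /imsetP[j _ xj]].
have /card_gt0P[y] : (0 < #|A :&: antiholo|)%N by rewrite aq.
rewrite inE => /andP[yA /imsetP[k _ yk]].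
have yh : y \notin holo.
  apply/imsetP => -[l _]; rewrite yk => /eqP; rewrite -val_eqE /= => /eqP lk.
  by have := ltn_ord l; rewrite -lk ltnNge leq_addr.
have xh : x \notin antiholo.
  apply/imsetP => -[l _]; rewrite xj => /eqP; rewrite -val_eqE /= => /eqP lk.
  by have := ltn_ord j; rewrite lk ltnNge leq_addr.
have xH : x \in holo by rewrite xj imset_f.
have yH : y \in antiholo by rewrite yk imset_f.
pose A' := A :\ x :\ y.
have IHA : cone (fun=> True) q (ebas A').
  apply: IH.
    have -> : A' :&: holo = (A :&: holo) :\ x.
      apply/setP => z; rewrite !inE; have [->|_] := eqVneq z y;
        last by rewrite /= andbA.
      by rewrite (negPf yh) !andbF.
    by rewrite (cardsD1_eq _ hq)// inE xA.
  have -> : A' :&: antiholo = (A :&: antiholo) :\ y.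
    apply/setP => z; rewrite !inE; have [->|_] := eqVneq z x;
      last by rewrite /= andbA.
    by rewrite (negPf xh) !andbF.
  by rewrite (cardsD1_eq _ aq)// inE yA.
have yx : y != x by apply: contraNneq yh => ->.
have dj : [disjoint [set x; y] & A'].
  rewrite -setI_eq0; apply/eqP/setP => z; rewrite !inE.
  by case: (z == x) => //=; case: (z == y).
have xyA : [set x; y] :|: A' = A.
  apply/setP => z; rewrite !inE; have [->|_] := eqVneq z x; first by rewrite xA.
  by have [->|_] := eqVneq z y; rewrite ?yA.
have d1 : [disjoint [set x] & [set y]] by rewrite disjoints1 inE eq_sym.
have g2E : g2 j k = ((-1) ^+ inversions [set x] [set y]) *: (ebas [set x;
  y] : E).
  by rewrite /g2 /edz /edzb -xj -yk -!ebas1 ebasM d1 mul1r.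
have sgn2 n (V : lmodType C) (u v : V) : u = (-1) ^+ n *: v ->
  v = (-1) ^+ n *: u.
  by move=> ->; rewrite scalerA -exprD addnn -mul2n exprM sqrrN expr1n expr1n
    scale1r.
have -> : ebas A = (-1) ^+ inversions [set x; y] A' *:
    (((-1) ^+ inversions [set x] [set y] *: g2 j k) * (ebas A' : E)).
  rewrite -(sgn2 _ _ _ _ g2E); apply: sgn2.
  have := @ebasM R N [set x; y] A'.
  rewrite xyA.
  rewrite dj.
  rewrite mul1r.
  exact.
apply: coneZ => //; rewrite -[q.+1]add1n; apply: coneM => //.
by apply: coneZ => //; exact: span_g2.
Qed.

End Cones.

Section Domination.
Context {R : realType} {N : nat}.
Local Notation E := (ealg R N).
Local Notation C := R[i].
Local Notation pos := (cone (fun x => 0 <= x)).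

(** Induction through d e u v - u' v' = (d u)(e v - v') + (d u - u') v', where both summands are
    products of elements of the cone. *)
Lemma pos_eprod_le (w : E) (D : 'rV[C]_N -> C) (s : seq 'rV[C]_N) :
  pos 1%N w -> (forall al, 0 <= D al) ->
  (forall al, pos 1%N (D al *: w - epos1 al)) ->
  pos (size s) ((\prod_(al <- s) D al) *: w ^+ size s - eprod s).
Proof.
have KM (x y : C) : 0 <= x -> 0 <= y -> 0 <= x * y by exact: mulr_ge0.
move=> pw D0 Dw; elim: s => [|al s IH].
  by rewrite /eprod !big_nil expr0 scale1r subrr; exact: cone0.
have pes : pos (size s) (eprod s).
  by rewrite -[eprod s]scale1r; apply: cone_eprod => //; exact: ler01.
rewrite /eprod !big_cons -/(eprod s) /= exprS.
have tel (A : algType C) (d e : C) (u u' v v' : A) :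
    (d * e) *: (u * v) - u' * v' = (d *: u) * (e *: v - v') +
      (d *: u - u') * v'.
  by rewrite mulrBr mulrBl addrA subrK -scalerAl -scalerAr scalerA.
rewrite (tel E); rewrite -[(size s).+1]add1n; apply: coneD; apply: coneM => //.
- exact: coneZ.
- exact: Dw.
Qed.

End Domination.

(** * Algebra maps sending generators to multiples of generators *)

Section GeneratorMap.
Context {R : realType} {M N : nat}.
Local Notation C := R[i].
Variables (c : 'I_(M + M) -> C) (f : 'I_(M + M) -> 'I_(N + N)).
Hypothesis f_mono : forall x y, (f x < f y)%N = (x < y)%N.
Local Notation gen k := (egen k : ealg R N).

(** As [f] is strictly increasing, inversions are preserved and this map is multiplicative without
    signs. Pullbacks by diagonal linear maps and by coordinate projections are of this kind. *)
Definition gmap (a : ealg R M) : ealg R N :=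
  \sum_A a A *: \prod_(k in A) (c k *: gen (f k)).

Let f_inj : injective f.
Proof.
move=> x y fxy; apply: val_inj; apply/eqP;
  rewrite eqn_leq (leqNgt x) (leqNgt y).
by rewrite -f_mono -[(x < y)%N]f_mono fxy ltnn.
Qed.

Lemma gmapD a b : gmap (a + b) = gmap a + gmap b.
Proof. by rewrite -big_split; apply: eq_bigr => A _;
  rewrite ffunE scalerDl. Qed.

Lemma gmapZ (k : C) a : gmap (k *: a) = k *: gmap a.
Proof. by rewrite scaler_sumr; apply: eq_bigr => A _;
  rewrite ffunE scalerA. Qed.

Lemma gmap0 : gmap 0 = 0.
Proof. by rewrite -(scale0r 0) gmapZ scale0r. Qed.

Lemma gmap_sum (I : Type) (r : seq I) (P : pred I) F :
  gmap (\sum_(i <- r | P i) F i) = \sum_(i <- r | P i) gmap (F i).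
Proof. exact: (big_morph gmap gmapD gmap0). Qed.

Lemma gmap_ebas A : gmap (ebas A) = (\prod_(k in A) c k) *: (ebas (f @: A) :
  ealg R N).
Proof.
rewrite /gmap (bigD1 A)//= [X in _ + X]big1 => [|B BA]; last first.
  by rewrite ffunE (negPf BA) scale0r.
rewrite ffunE eqxx scale1r addr0 !big_enum_noncomm; set s := enum A.
have -> : ebas (f @: A) = \prod_(k <- s) gen (f k).
  rewrite -(big_map f predT (fun k => gen k)) prod_egen_sorted.
    congr ebas; apply/setP => x; rewrite !inE.
    by apply/imsetP/mapP => -[y yA ->]; exists y => //; move: yA;
      rewrite mem_enum.
  by rewrite sorted_map; apply: (sub_sorted _ (enum_set_sorted A)) => x y /=;
    rewrite f_mono.
elim: s => [|k s IHs]; first by rewrite !big_nil scale1r.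
by rewrite !big_cons IHs -scalerAl -scalerAr scalerA.
Qed.

Lemma gmap1 : gmap 1 = 1.
Proof.
rewrite -[1 in LHS]eoneE -ebas0 gmap_ebas finset.imset0 big1 => [|k];
  last by rewrite inE.
by rewrite scale1r.
Qed.

Lemma gmap_egen k : gmap (egen k) = c k *: gen (f k).
Proof. by rewrite -!ebas1 gmap_ebas big_set1 finset.imset_set1. Qed.

Lemma inversions_imset (A B : {set 'I_(M + M)}) :
  inversions (f @: A) (f @: B) = inversions A B.
Proof.
have fi : injective (fun x : 'I_(M + M) * 'I_(M + M) => (f x.1, f x.2)).
  by move=> [x y] [x' y'] /= [/f_inj -> /f_inj ->].
rewrite /inversions -[RHS](card_imset _ fi).
apply: eq_card => -[x y]; rewrite !inE /=; apply/and3P/imsetP.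
  move=> [/imsetP[x' x'A ->] /imsetP[y' y'B ->]]; rewrite f_mono => xy.
  by exists (x', y') => //; rewrite !inE x'A y'B.
move=> [[x' y']]; rewrite !inE /= => /and3P[x'A y'B xy] [-> ->].
by rewrite f_mono !imset_f.
Qed.

Lemma gmapM a b : gmap (a * b) = gmap a * gmap b.
Proof.
move: a; apply: (@ebas_ind R M (fun a : ealg R M =>
  gmap (a * b) = gmap a * gmap b)) => [k a a' IHa IHa'|A].
  by rewrite (_ : (k *: a + a' : ealg R M) * b = k *: ((a :
    ealg R M) * b) + (a' : ealg R M) * b);
    [rewrite !gmapD !gmapZ IHa IHa' mulrDl -scalerAl | rewrite mulrDl
      -scalerAl].
move: b; apply: (@ebas_ind R M (fun b : ealg R M =>
  gmap ((ebas A : ealg R M) * b) = gmap (ebas A) * gmap b)) =>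
  [k b b' IHb IHb'|B].
  by rewrite (_ : (ebas A : ealg R M) * (k *: b + b' :
    ealg R M) = k *: ((ebas A : ealg R M) * (b : ealg R M)) + (ebas A :
    ealg R M) * (b' : ealg R M));
    [rewrite !gmapD !gmapZ IHb IHb' mulrDr -scalerAr | rewrite mulrDr
      -scalerAr].
rewrite ebasM gmapZ !gmap_ebas -scalerAl -scalerAr scalerA ebasM !scalerA.
rewrite inversions_imset finset.imsetU; congr (_ *: _).
have [dAB|ndAB] := boolP [disjoint A & B].
  have -> : [disjoint f @: A & f @: B] by rewrite imset_disjoint//; exact: in2W.
  have -> : \prod_(k in A :|: B) c k = (\prod_(k in A) c k) * (\prod_(k in B) c
    k).
    by rewrite -bigU//; apply: eq_bigl => x; rewrite !inE.
  by rewrite !(@mul1r C); ring.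
rewrite !mul0r (_ : [disjoint f @: A & f @: B] = false) ?mul0r ?mulr0//.
apply: contraNF ndAB; rewrite -!setI_eq0 => /eqP d0; apply/eqP/setP => x.
rewrite !inE; apply/negP => /andP[xA xB]; move/setP/(_ (f x)): d0.
by rewrite !inE !imset_f.
Qed.

Lemma gmapX a k : gmap (a ^+ k) = gmap a ^+ k.
Proof. by elim: k => [|k IH]; rewrite ?expr0 ?gmap1// !exprS gmapM IH. Qed.

End GeneratorMap.

From mathcomp Require Import all_classical all_reals all_analysis.
From mathcomp Require Import zify.
Import numFieldNormedType.Exports.
Local Open Scope classical_set_scope.
Local Open Scope complex_scope.
Local Open Scope ring_scope.

(** * Smooth functions on C^N *)

Section Topology.
Context {R : realType}.
Local Notation C := R[i].

Lemma ReD (x y : C) : complex.Re (x + y) = complex.Re x + complex.Re y.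
Proof. by case: x y => ? ? []. Qed.
Lemma ImD (x y : C) : complex.Im (x + y) = complex.Im x + complex.Im y.
Proof. by case: x y => ? ? []. Qed.
Lemma ReM (x y : C) : complex.Re (x * y) =
  complex.Re x * complex.Re y - complex.Im x * complex.Im y.
Proof. by case: x y => ? ? []. Qed.
Lemma ImM (x y : C) : complex.Im (x * y) =
  complex.Re x * complex.Im y + complex.Im x * complex.Re y.
Proof. by case: x y => ? ? []. Qed.
Lemma Re_conj (x : C) : complex.Re x^* = complex.Re x.
Proof. by case: x. Qed.
Lemma Im_conj (x : C) : complex.Im x^* = - complex.Im x.
Proof. by case: x. Qed.
Lemma ReB (x y : C) : complex.Re (x - y) = complex.Re x - complex.Re y.
Proof. by case: x y => ? ? []. Qed.
Lemma ImB (x y : C) : complex.Im (x - y) = complex.Im x - complex.Im y.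
Proof. by case: x y => ? ? []. Qed.

Lemma cabsE (x : C) : cabs x = Num.sqrt (complex.Re x ^+ 2 + complex.Im x ^+ 2).
Proof. by case: x. Qed.

Lemma cabs_ge0 (x : C) : 0 <= cabs x.
Proof. by rewrite cabsE sqrtr_ge0. Qed.

Lemma normC_cabs (x : C) : `|x| = (cabs x)%:C.
Proof. by case: x. Qed.

Lemma Re_cabs (x : C) : `|complex.Re x| <= cabs x.
Proof. by rewrite cabsE -sqrtr_sqr ler_wsqrtr// lerDl sqr_ge0. Qed.

Lemma Im_cabs (x : C) : `|complex.Im x| <= cabs x.
Proof. by rewrite cabsE -sqrtr_sqr ler_wsqrtr// lerDr sqr_ge0. Qed.

Lemma cabsD (x y : C) : cabs (x + y) <= cabs x + cabs y.
Proof. by rewrite -lecR rmorphD /= -!normC_cabs ler_normD. Qed.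

Lemma cabsM (x y : C) : cabs (x * y) = cabs x * cabs y.
Proof. by apply: complexI; rewrite rmorphM /= -!normC_cabs normrM. Qed.

Lemma cabsN (x : C) : cabs (- x) = cabs x.
Proof. by rewrite /cabs normrN. Qed.

Lemma cabsR (x : R) : cabs x%:C = `|x|.
Proof. by rewrite cabsE /= expr0n addr0 sqrtr_sqr. Qed.

Lemma cabs0 : cabs (0 : C) = 0.
Proof. by rewrite /cabs normr0. Qed.

Lemma cabs_sum (I : Type) (r : seq I) (P : pred I) (F : I -> C) :
  cabs (\sum_(i <- r | P i) F i) <= \sum_(i <- r | P i) cabs (F i).
Proof.
elim/big_rec2: _ => [|i x y _ xy]; first by rewrite cabs0.
by rewrite (le_trans (cabsD _ _))// lerD2l.
Qed.

Lemma cabs_le_ReIm (x : C) : cabs x <= `|complex.Re x| + `|complex.Im x|.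
Proof.
case: x => a b; have -> : a +i* b = a%:C + 'i%R * b%:C.
  by apply/eqP; rewrite eq_complex /= !(mul0r, mulr0, mul1r, addr0, subr0,
    add0r) !eqxx.
rewrite (le_trans (cabsD _ _))// cabsM !cabsR /= !(mul0r, mulr0, mul1r, addr0,
  subr0, add0r).
by rewrite [cabs _]/cabs normCi /= mul1r.
Qed.

(** The balls of [R[i]^o] have their radii in [R[i]]; a positive element there is real, so real
    radii suffice. *)
Lemma nbhsCP (x : C) (A : set C) : nbhs x A <->
  exists2 e : R, 0 < e & forall y, cabs (y - x) < e -> A y.
Proof.
have -> : nbhs x A = nbhs (x : C^o) A by [].
split => [/nbhs_ballP[e e0 xe]|[e e0 xe]].
  have er : e = (complex.Re e)%:C.
    by move: e0; case: (e) => a b; rewrite /= ltcE /= => /andP[/eqP ->].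
  exists (complex.Re e); first by move: e0; case: (e) => a b;
    rewrite /= ltcE => /andP[].
  move=> y yx; apply: xe; rewrite /ball /= -normrN opprB er normC_cabs ltcR.
  exact: yx.
apply/nbhs_ballP; exists e%:C => /=; first by rewrite ltcR.
move=> y; rewrite /ball /= -normrN opprB normC_cabs ltcR; exact: xe.
Qed.

Lemma cvgCP (T : Type) (F : set_system T) {FF : Filter F} (f : T -> C) (l : C) :
  f @ F --> l <-> forall e : R, 0 < e -> \forall x \near F, cabs (f x - l) < e.
Proof.
split=> [fl e e0|fl A /nbhsCP[e e0 eA]].
  by apply: (fl [set y | cabs (y - l) < e]); apply/nbhsCP; exists e.
by apply: filterS (fl e e0) => x; exact: eA.
Qed.

Lemma cvgC_ReIm (T : Type) (F : set_system T) {FF : Filter F} (f : T ->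
  C) (l : C) :
  f @ F --> l <-> ((fun x => complex.Re (f x)) @ F --> complex.Re l) /\
                  ((fun x => complex.Im (f x)) @ F --> complex.Im l).
Proof.
split=> [/cvgCP fl|[/cvgrPdist_lt fl /cvgrPdist_lt gl]].
  split; apply/cvgrPdist_lt => e /fl; apply: filterS => x; rewrite distrC.
    by rewrite -ReB; apply: le_lt_trans; exact: Re_cabs.
  by rewrite -ImB; apply: le_lt_trans; exact: Im_cabs.
apply/cvgCP => e e0; have e20 : 0 < e / 2 by rewrite divr_gt0.
near=> x; rewrite (le_lt_trans (cabs_le_ReIm _))// ReB ImB.
rewrite (splitr e) ltrD//.
  by rewrite distrC; near: x; exact: fl.
by rewrite distrC; near: x; exact: gl.
Unshelve. all: by end_near. Qed.

Lemma contC (T : topologicalType) (f : T ->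
  C) (z : T) : {for z, continuous f} <->
  {for z, continuous (fun x => complex.Re (f x))} /\
  {for z, continuous (fun x => complex.Im (f x))}.
Proof. exact: cvgC_ReIm. Qed.

Context {N : nat}.
Local Notation Cn := 'rV[C]_N.

Lemma nbhs_rVP (z : Cn) (A : set Cn) : nbhs z A <->
  exists2 e : R, 0 < e & forall w : Cn, (forall j,
    cabs (w 0 j - z 0 j) < e) -> A w.
Proof.
split=> [[P zP PA]|[e e0 eA]].
  have /choice[e he] : forall j, exists e : R, 0 < e /\ forall y,
    cabs (y - z 0 j) < e -> P 0 j y.
    by move=> j; have /nbhsCP[e e0 eP] := zP 0 j; exists e.
  (* The default value 1 keeps the radius positive when there are no coordinates. *)
  exists (\big[Num.min/1]_j e j).
    by apply: lt_bigmin => // j _; exact: (he j).1.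
  move=> w wz; apply: PA => i j; rewrite (ord1 i); apply: (he j).2.
  by apply: lt_le_trans (wz j) _; exact: bigmin_le.
exists (fun i j => [set y | cabs (y - z i j) < e]).
  by move=> i j; apply/nbhsCP; exists e.
by move=> w wz; apply: eA => j; exact: wz.
Qed.

Lemma coord_continuousC (j : 'I_N) : continuous (fun z : Cn => z 0 j).
Proof.
move=> z; apply: (@cvgCP _ _ (nbhs_filter z) (fun w => w 0 j) (z 0 j)).2 =>
  e e0.
by apply/nbhs_rVP; exists e.
Qed.

Lemma rV_continuousP (T : topologicalType) (f : T -> Cn) (x : T) :
  (forall j, {for x, continuous (fun y => f y 0 j)}) -> {for x, continuous f}.
Proof.
move=> fc A /nbhs_rVP[e e0 eA].
have : nbhs x (fun y => forall j, cabs (f y 0 j - f x 0 j) < e).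
  by apply: filter_forall => j;
    exact: (@cvgCP _ _ (nbhs_filter x) _ _).1 (fc j) e e0.
by apply: filterS => y; exact: eA.
Qed.

End Topology.

Section DirectionalDerivative.
Context {R : realType} {N : nat}.
Local Notation C := R[i].
Local Notation Cn := 'rV[C]_N.
Implicit Types (f g : Cn -> C) (z v : Cn).

(** Derivability and the value of the derivative are kept in one relation, so that each rule of
    calculus proves both at once. *)
Definition dd f z v (d : C) : Prop :=
  is_derive (0 : R) (1 : R) (fun t : R =>
    complex.Re (f (z + t%:C *: v))) (complex.Re d) /\
  is_derive (0 : R) (1 : R) (fun t : R =>
    complex.Im (f (z + t%:C *: v))) (complex.Im d).

Lemma dd_dir_derive f z v d : dd f z v d ->
  dir_derivable f z v /\ dir_derive f v z = d.
Proof.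
move=> [[d1 e1] [d2 e2]]; split; first exact: (conj d1 d2).
by rewrite /dir_derive !derive1E e1 e2; case: (d).
Qed.

Lemma dir_derivable_dd f z v : dir_derivable f z v ->
  dd f z v (dir_derive f v z).
Proof.
move=> [d1 d2]; split; apply: DeriveDef; [exact: d1 | | exact: d2 |];
  by rewrite -derive1E.
Qed.

Lemma line0 z v : z + (0 : R)%:C *: v = z.
Proof. by rewrite scale0r addr0. Qed.

Lemma dd_cst (c : C) z v : dd (fun=> c) z v 0.
Proof. by split; exact: is_derive_cst. Qed.

Lemma ddD f g z v d e : dd f z v d -> dd g z v e ->
  dd (fun w => f w + g w) z v (d + e).
Proof.
move=> [f1 f2] [g1 g2]; split.
  rewrite ReD; under eq_fun do rewrite ReD; exact: is_deriveD.
rewrite ImD; under eq_fun do rewrite ImD; exact: is_deriveD.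
Qed.

Lemma ddM f g z v d e : dd f z v d -> dd g z v e ->
  dd (fun w => f w * g w) z v (d * g z + f z * e).
Proof.
move=> [f1 f2] [g1 g2]; split.
  under eq_fun do rewrite ReM.
  apply: (is_derive_eq (is_deriveB (is_deriveM f1 g1) (is_deriveM f2 g2))).
  by rewrite !line0 ReD !ReM /GRing.scale /=; ring.
under eq_fun do rewrite ImM.
apply: (is_derive_eq (is_deriveD (is_deriveM f1 g2) (is_deriveM f2 g1))).
by rewrite !line0 ImD !ImM /GRing.scale /=; ring.
Qed.

Lemma dd_conj f z v d : dd f z v d -> dd (fun w => (f w)^*) z v d^*.
Proof.
move=> [f1 f2]; split.
  by rewrite Re_conj; under eq_fun do rewrite Re_conj.
by rewrite Im_conj; under eq_fun do rewrite Im_conj; exact: is_deriveN.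
Qed.

Lemma dd_coord j z v : dd (fun w => w 0 j) z v (v 0 j).
Proof.
have affine (a b : R) : is_derive (0 : R) (1 : R) (fun t : R => a + t * b) b.
  apply: (is_derive_eq (is_deriveD (is_derive_cst a _ _)
    (is_deriveM (is_derive_id (0 : R) (1 : R)) (is_derive_cst b (0 : R) (1 :
      R))))).
  by rewrite /GRing.scale /= mul0r mulr1 !add0r.
split.
  by under eq_fun do rewrite !mxE ReD ReM /= mul0r subr0; exact: affine.
by under eq_fun do rewrite !mxE ImD ImM /= mul0r addr0; exact: affine.
Qed.

Lemma dd_real_comp (h : R -> R) (h' : R) (u : Cn -> R) z v d :
  is_derive (u z) (1 : R) h h' -> dd (fun w => (u w)%:C) z v d ->
  dd (fun w => (h (u w))%:C) z v (h'%:C * d).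
Proof.
move=> hd [/= u1 u2].
have d0 : complex.Im d = 0.
  by case: u2 => _ <-; exact: derive_cst.
split.
  rewrite ReM /= mul0r subr0.
  apply: (@is_derive1_comp R h (fun t : R => u (z + t%:C *: v))) => //.
  by rewrite line0.
by rewrite ImM /= d0 mulr0 mul0r addr0; exact: is_derive_cst.
Qed.

End DirectionalDerivative.

Section Smoothness.
Context {R : realType} {N : nat}.
Local Notation C := R[i].
Local Notation Cn := 'rV[C]_N.
Local Notation Ck k := (@Ck_on R N k setT).
Local Notation smooth := (@smooth_on R N setT).
Implicit Types (f g : Cn -> C) (z v : Cn).

Lemma CkS k f (f' : Cn -> Cn -> C) : continuous f ->
  (forall v z, dd f z v (f' v z)) -> (forall v, Ck k (f' v)) -> Ck k.+1 f.
Proof.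
move=> fc fd fk; split=> [z _|v]; first exact: fc.
split=> [z _|]; first by have [] := dd_dir_derive (fd v z).
by have -> : dir_derive f v = f' v by apply/funext => z;
  have [] := dd_dir_derive (fd v z).
Qed.

Lemma Ck_cont k f : Ck k f -> continuous f.
Proof. by case: k => [|k] [fc _] z; exact: fc. Qed.

Lemma Ck_dd k f v z : Ck k.+1 f -> dd f z v (dir_derive f v z).
Proof. by move=> [_ /(_ v)[/(_ z I) fd _]]; exact: dir_derivable_dd. Qed.

Lemma Ck_derive k f v : Ck k.+1 f -> Ck k (dir_derive f v).
Proof. by move=> [_ /(_ v)[]]. Qed.

Lemma CkW k f : Ck k.+1 f -> Ck k f.
Proof.
elim: k f => [|k IH] f fk; first by split=> // z _; exact: (Ck_cont fk).
apply: (CkS (f' := dir_derive f)); first exact: (Ck_cont fk).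
  by move=> v z; exact: (Ck_dd v z fk).
by move=> v; apply: IH; exact: Ck_derive.
Qed.

Lemma cont_cst (c : C) : continuous (fun _ : Cn => c).
Proof. by move=> z; exact: cst_continuous. Qed.

Lemma contCP f z : {for z, continuous f} <->
  ((fun w => complex.Re (f w)) @ z --> complex.Re (f z)) /\
  ((fun w => complex.Im (f w)) @ z --> complex.Im (f z)).
Proof. exact: contC. Qed.

Lemma contD f g : continuous f -> continuous g -> continuous (fun z =>
  f z + g z).
Proof.
move=> fc gc z; have /contCP[f1 f2] := fc z; have /contCP[g1 g2] := gc z.
apply/contCP; split.
  by rewrite ReD; under eq_fun do rewrite ReD; exact: (cvgD f1 g1).
by rewrite ImD; under eq_fun do rewrite ImD; exact: (cvgD f2 g2).
Qed.

Lemma contM f g : continuous f -> continuous g -> continuous (fun z =>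
  f z * g z).
Proof.
move=> fc gc z; have /contCP[f1 f2] := fc z; have /contCP[g1 g2] := gc z.
apply/contCP; split.
  by rewrite ReM; under eq_fun do rewrite ReM;
    exact: (cvgB (cvgM f1 g1) (cvgM f2 g2)).
by rewrite ImM; under eq_fun do rewrite ImM;
  exact: (cvgD (cvgM f1 g2) (cvgM f2 g1)).
Qed.

Lemma cont_conj f : continuous f -> continuous (fun z => (f z)^*).
Proof.
move=> fc z; have /contCP[f1 f2] := fc z; apply/contCP; split.
  by rewrite Re_conj; under eq_fun do rewrite Re_conj.
by rewrite Im_conj; under eq_fun do rewrite Im_conj; exact: (cvgN f2).
Qed.

Lemma Ck_cst k (c : C) : Ck k (fun=> c).
Proof.
elim: k c => [|k IH] c; first by split=> // z _; exact: cont_cst.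
apply: (CkS (f' := fun _ _ => 0)) => //; first exact: cont_cst.
by move=> v z; exact: dd_cst.
Qed.

Lemma CkD k f g : Ck k f -> Ck k g -> Ck k (fun z => f z + g z).
Proof.
elim: k f g => [|k IH] f g fk gk.
  by split=> // z _; exact: (contD (Ck_cont fk) (Ck_cont gk)).
apply: (CkS (f' := fun v z => dir_derive f v z + dir_derive g v z)).
- exact: (contD (Ck_cont fk) (Ck_cont gk)).
- by move=> v z; exact: (ddD (Ck_dd v z fk) (Ck_dd v z gk)).
- by move=> v; exact: (IH _ _ (Ck_derive v fk) (Ck_derive v gk)).
Qed.

Lemma CkM k f g : Ck k f -> Ck k g -> Ck k (fun z => f z * g z).
Proof.
elim: k f g => [|k IH] f g fk gk.
  by split=> // z _; exact: (contM (Ck_cont fk) (Ck_cont gk)).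
apply: (CkS (f' := fun v z => dir_derive f v z * g z + f z * dir_derive g v z)).
- exact: (contM (Ck_cont fk) (Ck_cont gk)).
- by move=> v z; exact: (ddM (Ck_dd v z fk) (Ck_dd v z gk)).
- by move=> v; apply: CkD;
  [exact: (IH _ _ (Ck_derive v fk) (CkW gk)) | exact: (IH _ _ (CkW fk)
  (Ck_derive v gk))].
Qed.

Lemma Ck_conj k f : Ck k f -> Ck k (fun z => (f z)^*).
Proof.
elim: k f => [|k IH] f fk; first by split=> // z _;
  exact: (cont_conj (Ck_cont fk)).
apply: (CkS (f' := fun v z => (dir_derive f v z)^*)).
- exact: (cont_conj (Ck_cont fk)).
- by move=> v z; exact: (dd_conj (Ck_dd v z fk)).
- by move=> v; exact: (IH _ (Ck_derive v fk)).
Qed.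

Lemma Ck_coord k j : Ck k (fun z => z 0 j).
Proof.
case: k => [|k]; first by split=> // z _; exact: coord_continuousC.
apply: (CkS (f' := fun v _ => v 0 j)).
- exact: coord_continuousC.
- by move=> v z; exact: dd_coord.
- by move=> v; exact: Ck_cst.
Qed.

Lemma smooth_cst (c : C) : smooth (fun=> c).
Proof. by move=> k; exact: Ck_cst. Qed.

Lemma smoothD f g : smooth f -> smooth g -> smooth (fun z => f z + g z).
Proof. by move=> fs gs k; exact: CkD. Qed.

Lemma smoothM f g : smooth f -> smooth g -> smooth (fun z => f z * g z).
Proof. by move=> fs gs k; exact: CkM. Qed.

Lemma smooth_conj f : smooth f -> smooth (fun z => (f z)^*).
Proof. by move=> fs k; exact: Ck_conj. Qed.

Lemma smooth_coord j : smooth (fun z => z 0 j).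
Proof. by move=> k; exact: Ck_coord. Qed.

Lemma smooth_sum (I : Type) (r : seq I) (P : pred I) (F : I -> Cn -> C) :
  (forall i, smooth (F i)) -> smooth (fun z => \sum_(i <- r | P i) F i z).
Proof.
move=> Fs; elim: r => [|i r IH].
  by under eq_fun do rewrite big_nil; exact: smooth_cst.
under eq_fun do rewrite big_cons; case: (P i) => //; exact: smoothD.
Qed.

Lemma smooth_Re f : smooth f -> smooth (fun z => (complex.Re (f z))%:C).
Proof.
move=> fs; have -> : (fun z => (complex.Re (f z))%:C) = (fun z =>
  2^-1 * (f z + (f z)^*)).
  apply/funext => z; case: (f z) => a b.
  rewrite (_ : (a +i* b) + (a +i* b)^* = 2 * a%:C) ?mulKf ?pnatr_eq0//.
  by apply/eqP; rewrite eq_complex /= subrr !(mul0r, mulr0, subr0,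
    addr0) mulrDl mul1r !eqxx.
apply: smoothM; first exact: smooth_cst.
by apply: smoothD => //; exact: smooth_conj.
Qed.

Lemma smooth_Im f : smooth f -> smooth (fun z => (complex.Im (f z))%:C).
Proof.
move=> fs; have -> : (fun z => (complex.Im (f z))%:C) =
    (fun z => (complex.Re (- 'i * f z))%:C).
  by apply/funext => z; case: (f z) => a b;
    rewrite /= !(mul0r, oppr0, mulN1r, sub0r) opprK.
by apply: smooth_Re; apply: smoothM => //; exact: smooth_cst.
Qed.

Lemma smooth_derive f v : smooth f -> smooth (dir_derive f v).
Proof. by move=> fs k; exact: (Ck_derive v (fs k.+1)). Qed.

Lemma smooth_dd f z v : smooth f -> dd f z v (dir_derive f v z).
Proof. by move=> fs; exact: (Ck_dd v z (fs 1%N)). Qed.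

Lemma smooth_cont f : smooth f -> continuous f.
Proof. by move=> fs; exact: (Ck_cont (fs 0%N)). Qed.

(** [h] lists the successive derivatives of [h 0]. The induction on the order of differentiability
    treats all [h n] at once, because a derivative of [h n] composed with [u] is [h n.+1] composed
    with [u], times a derivative of [u]. *)
Lemma smooth_real_comp (h : nat -> R -> R) (D : set R) (u : Cn -> R) :
  (forall k x, D x -> is_derive x (1 : R) (h k) (h k.+1 x)) ->
  (forall z, D (u z)) -> smooth (fun z => (u z)%:C) ->
  smooth (fun z => (h 0%N (u z))%:C).
Proof.
move=> hd Du us k.
suff : forall n, Ck k (fun z => (h n (u z))%:C) by apply.
elim: k => [|k IH] n.
  split=> // z _; apply/contCP; split; last exact: cst_continuous.
  apply: (@continuous_comp Cn R R u (h n)).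
    by have [] := (contCP (fun z => (u z)%:C) z).1 (@smooth_cont _ us z).
  apply/differentiable_continuous/derivable1_diffP.
  by have [] := hd n _ (Du z).
apply: (CkS (f' := fun v z => (h n.+1 (u z))%:C * dir_derive (fun w =>
  (u w)%:C) v z)).
- by have /Ck_cont := IH n.
- by move=> v z; apply: dd_real_comp; [exact: hd | exact: smooth_dd].
- by move=> v; apply: CkM => //; exact: (smooth_derive v us).
Qed.

Lemma smooth_inv (u : Cn -> R) : (forall z, u z != 0) -> smooth (fun z =>
  (u z)%:C) ->
  smooth (fun z => ((u z)^-1)%:C).
Proof.
move=> u0 us.
pose h k (x : R) : R := (-1) ^+ k * k`!%:R * x^-1 ^+ k.+1.
have -> : (fun z => ((u z)^-1)%:C) = (fun z => (h 0%N (u z))%:C).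
  by apply/funext => z; rewrite /h expr0 fact0 !mul1r expr1.
apply: (@smooth_real_comp h [set x | x != 0]) => // k x /= x0.
have dV : is_derive x (1 : R) (fun y : R => y^-1) (- x ^- 2 *: 1).
  exact: (@is_deriveV R id x 1 1).
have -> : h k = cst ((-1) ^+ k * k`!%:R) * (fun y : R => y^-1) ^+ k.+1.
  by apply/funext => y;
    rewrite /h -[RHS]/(_ * ((fun y : R => y^-1) ^+ k.+1) y) exprfctE.
have H := is_deriveM (is_derive_cst ((-1) ^+ k * k`!%:R : R) x (1 :
  R)) (is_deriveX k.+1 dV).
apply: (is_derive_eq H).
rewrite /h /GRing.scale /= mulr0 addr0 mulr1 factS natrM -exprVn expr2 !exprS;
  ring.
Qed.

End Smoothness.

(** * The flat function exp(-1/t) and its derivatives *)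

Section FlatFunction.
Context {R : realType}.
Implicit Types (P : {poly R}) (s t : R).

(* The derivatives of exp(-1/t) are of the form P(1/t) exp(-1/t). *)
Definition gexp P t : R := if 0 < t then P.[t^-1] * expR (- t^-1) else 0.

(** With s = 1/t one has ds/dt = -s^2, so the derivative of P(s) exp(-s) in t is s^2 (P(s) - P'(s))
    exp(-s). *)
Definition dgexp P : {poly R} := 'X^2 * (P - P^`()).

(** With s = 1/t, the exponential series gives s^(i+2) <= (i+2)! exp(s), which bounds each monomial
    of P(s) exp(-s) by a multiple of t^2. A quadratic bound is enough for the derivative at 0 to
    exist and vanish. *)
Lemma gexp_bound P : exists K : R, forall t, `|gexp P t| <= K * t ^+ 2.
Proof.
exists (\sum_(i < size P) `|P`_i| * (i.+2)`!%:R) => t.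
have S0 : 0 <= \sum_(i < size P) `|P`_i| * (i.+2)`!%:R :> R.
  by apply: sumr_ge0 => i _; rewrite mulr_ge0.
rewrite /gexp; case: ltrP => t0; last by rewrite normr0 mulr_ge0// sqr_ge0.
set s := t^-1; have s0 : 0 < s by rewrite invr_gt0.
have -> : t = s^-1 by rewrite invrK.
rewrite exprVn ler_pdivlMr ?exprn_gt0//.
rewrite normrM (ger0_norm (expR_ge0 _)) horner_coef.
apply: le_trans (_ : (\sum_(i < size P) `|P`_i * s ^+ i|) * expR (- s) * s ^+ 2
  <= _).
  by rewrite ler_wpM2r ?sqr_ge0// ler_wpM2r ?expR_ge0// ler_norm_sum.
rewrite !mulr_suml; apply: ler_sum => i _.
rewrite normrM [`|s ^+ i|]ger0_norm ?exprn_ge0 ?(ltW s0)// -!mulrA ler_wpM2l//.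
rewrite mulrCA -exprD addn2 mulrC expRN ler_pdivrMr ?expR_gt0//.
have := expR_ge1Dxn i.+1 (ltW s0); rewrite -[_ <= _]/(_) => h.
have : s ^+ i.+2 / (i.+2)`!%:R <= expR s by apply: le_trans h; rewrite lerDr.
by rewrite ler_pdivrMr ?ltr0n ?fact_gt0// mulrC.
Qed.

Lemma is_derive_flat (g : R -> R) (K : R) :
  (forall t, `|g t| <= K * t ^+ 2) -> is_derive (0 : R) (1 : R) g 0.
Proof.
move=> gK.
have K0 : 0 <= K by have := gK 1; rewrite expr1n mulr1; apply: le_trans.
have g0 : g 0 = 0 by have := gK 0; rewrite expr0n mulr0 normr_le0 => /eqP.
have H : (fun h : R => h^-1 *: ((g \o shift 0) (h *: 1) - g 0)) @ 0^' --> (0 :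
  R).
  apply/cvgrPdist_lt => e e0.
  have d0 : 0 < e / (K + 1) by rewrite divr_gt0// ltr_wpDl.
  exists (e / (K + 1)) => //= h /=; rewrite sub0r normrN => hd h0.
  rewrite g0 /shift /= addr0 subr0 sub0r normrN /GRing.scale /= mulr1 normrM
    normfV.
  rewrite ltr_pdivrMl ?normr_gt0//.
  apply: le_lt_trans (gK h) _;
    rewrite -(real_normK (num_real h)) expr2 mulrA mulrC.
  rewrite ltr_pM2l ?normr_gt0//.
  apply: (@le_lt_trans _ _ ((K + 1) * `|h|));
    first by rewrite ler_wpM2r// lerDl.
  by rewrite mulrC -ltr_pdivlMr// ltr_wpDl.
apply: DeriveDef; first by apply/cvg_ex; exists 0.
exact: cvg_lim.
Qed.

Lemma is_derive_gexp P t : is_derive t (1 : R) (gexp P) (gexp (dgexp P) t).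
Proof.
have [t0|t0|->] := ltrgt0P t.
- have E : \forall x \near t, P.[x^-1] * expR (- x^-1) = gexp P x.
    have : \forall x \near t,
      0 < x by exact: (open_nbhs_nbhs (conj (@open_gt _ 0) t0)).
    by apply: filterS => x x0; rewrite /gexp x0.
  apply: (near_eq_is_derive E) => //.
  have dV : is_derive t (1 : R) (fun y : R => y^-1) (- t ^- 2 *: 1).
    by apply: (@is_deriveV R id t 1 1); rewrite ?gt_eqF.
  have dP := @is_derive1_comp R (horner P) (fun y : R =>
    y^-1) t _ _ (is_derive_poly P t^-1) dV.
  have dE := @is_derive1_comp R expR (fun y : R =>
    - y^-1) t _ _ (is_derive_expR (- t^-1)) (is_deriveN dV).
  apply: (is_derive_eq (is_deriveM dP dE)).
  rewrite /gexp t0 /dgexp !hornerE /GRing.scale /=.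
  by rewrite exprVn; ring.
- have E : \forall x \near t, 0 = gexp P x.
    have : \forall x \near t,
      x < 0 by exact: (open_nbhs_nbhs (conj (@open_lt _ 0) t0)).
    by apply: filterS => x x0; rewrite /gexp ltNge (ltW x0).
  rewrite {2}/gexp ifF; last by apply/negbTE; rewrite -leNgt ltW.
  by apply: (near_eq_is_derive E) => //; exact: is_derive_cst.
- rewrite {2}/gexp ltxx; have [K gK] := gexp_bound P;
  exact: (is_derive_flat gK).
Qed.

End FlatFunction.

Section Bump.
Context {R : realType} {N : nat}.
Local Notation C := R[i].
Local Notation Cn := 'rV[C]_N.
Local Notation smooth := (@smooth_on R N setT).

Lemma smooth_norm2 M (j : 'I_M -> 'I_N) (a : 'I_M -> C) :
  smooth (fun z : Cn => (\sum_k cabs (z 0 (j k) + a k) ^+ 2)%:C).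
Proof.
rewrite (_ : (fun _ => _) = fun z : Cn =>
  \sum_k (z 0 (j k) + a k) * (z 0 (j k) + a k)^*).
  apply: smooth_sum => k; apply: smoothM; last apply: smooth_conj;
    by apply: smoothD; [exact: smooth_coord | exact: smooth_cst].
by apply/funext => z; rewrite rmorph_sum; apply: eq_bigr => k _;
  exact: cabs_sqr.
Qed.

Definition bump (a : Cn) (r : R) (z : Cn) : R :=
  gexp 1 (r ^+ 2 - norm2 (z - a)).

Lemma bump_smooth a r : smooth (fun z => (bump a r z)%:C).
Proof.
apply: (@smooth_real_comp _ _ (fun k => gexp (iter k dgexp 1)) setT) => //.
  by move=> k x _; exact: is_derive_gexp.
rewrite (_ : (fun _ => _) = fun z : Cn =>
  (r ^+ 2)%:C + (-1) * (\sum_j cabs (z 0 j + - a 0 j) ^+ 2)%:C).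
  apply: smoothD; first exact: smooth_cst.
  by apply: smoothM; [exact: smooth_cst | exact: smooth_norm2].
apply/funext => z; rewrite rmorphB mulN1r; congr (_ - _%:C).
by apply: eq_bigr => j _; rewrite !mxE.
Qed.

Lemma gexp1_ge0 (t : R) : 0 <= gexp 1 t.
Proof. by rewrite /gexp; case: ifP => // _; rewrite hornerE mul1r expR_ge0. Qed.

Lemma bump_ge0 a r z : 0 <= bump a r z.
Proof. exact: gexp1_ge0. Qed.

Lemma bump_gt0 a r : 0 < r -> 0 < bump a r a.
Proof.
move=> r0; rewrite /bump subrr /norm2 big1 => [|j _];
  last by rewrite mxE cabs0 expr0n.
by rewrite subr0 /gexp exprn_gt0// hornerE mul1r expR_gt0.
Qed.

Lemma bump_supp a r z : 0 < r -> bump a r z != 0 ->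
  forall j, cabs (z 0 j - a 0 j) < r.
Proof.
move=> r0; rewrite /bump /gexp; case: ifPn; last by rewrite eqxx.
rewrite subr_gt0 => zr _ j;
  rewrite -(@ltr_pXn2r _ 2)// ?nnegrE ?cabs_ge0 ?(ltW r0)//.
apply: le_lt_trans zr; rewrite /norm2 (bigD1 j)//= !mxE lerDl.
by apply: sumr_ge0 => k _; exact: sqr_ge0.
Qed.

End Bump.

(** * Forms, pullbacks and dd^c *)

Section Wirtinger.
Context {R : realType} {N : nat}.
Local Notation C := R[i].
Local Notation Cn := 'rV[C]_N.
Local Notation E := (ealg R N).
Local Notation smooth := (@smooth_on R N setT).
Implicit Types (f g : Cn -> C) (z v : Cn) (j k : 'I_N).

(* f has Wirtinger derivatives p = df/dz_j and q = df/d(conj z_j) at z. *)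
Definition ww j f z (p q : C) : Prop :=
  dd f z (coord_dir (false, j)) (p + q) /\
  dd f z (coord_dir (true, j)) ('i * (p - q)).

Lemma ww_wirt j f z p q : ww j f z p q -> wirt j f z = p /\ wirt_bar j f z = q.
Proof.
move=> [/dd_dir_derive[_ e1] /dd_dir_derive[_ e2]].
have ii : 'i * 'i = -1 :> C by rewrite -expr2 sqrCi.
have nz : (2 : C) != 0 by rewrite pnatr_eq0.
have iN : 'i%C = 'i%R :> C by [].
rewrite /wirt /wirt_bar e1 e2 ?iN !mulrA !ii !mulN1r opprK.
by split; field.
Qed.

Lemma smooth_ww j f z : smooth f -> ww j f z (wirt j f z) (wirt_bar j f z).
Proof.
move=> fs; have ii : 'i * 'i = -1 :> C by rewrite -expr2 sqrCi.
have nz : (2 : C) != 0 by rewrite pnatr_eq0.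
have h (x y : C) (X := 2^-1 * (x - 'i * y)) (Y := 2^-1 * (x + 'i * y)) :
    x = X + Y /\ y = 'i * (X - Y).
  split; first by rewrite /X /Y; field.
  transitivity (- ('i * 'i) * y); first by rewrite ii opprK mul1r.
  by rewrite /X /Y; field.
split; rewrite /wirt /wirt_bar.
  by rewrite -(h _ _).1; exact: smooth_dd.
by rewrite -(h _ _).2; exact: smooth_dd.
Qed.

Lemma ww_cst j (c : C) z : ww j (fun=> c) z 0 0.
Proof. by split; rewrite ?(addr0, subr0, mulr0); exact: dd_cst. Qed.

Lemma wwD j f g z p q p' q' : ww j f z p q -> ww j g z p' q' ->
  ww j (fun w => f w + g w) z (p + p') (q + q').
Proof.
move=> [f1 f2] [g1 g2]; split.
  by rewrite addrACA; exact: ddD.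
by rewrite opprD addrACA mulrDr; exact: ddD.
Qed.

Lemma wwM j f g z p q p' q' : ww j f z p q -> ww j g z p' q' ->
  ww j (fun w => f w * g w) z (p * g z + f z * p') (q * g z + f z * q').
Proof.
move=> [f1 f2] [g1 g2]; split.
  have -> : p * g z + f z * p' + (q * g z + f z * q') =
    (p + q) * g z + f z * (p' + q') by ring.
  exact: ddM.
have -> : 'i * (p * g z + f z * p' - (q * g z + f z * q')) =
  'i * (p - q) * g z + f z * ('i * (p' - q')) by ring.
exact: ddM.
Qed.

Lemma wwZ j (c : C) f z p q : ww j f z p q -> ww j (fun w =>
  c * f w) z (c * p) (c * q).
Proof.
by move=> fw; have := wwM (ww_cst j c z) fw; rewrite !mul0r !add0r.
Qed.

Lemma ww_conj j f z p q : ww j f z p q -> ww j (fun w => (f w)^*) z q^* p^*.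
Proof.
move=> [f1 f2]; split.
  by rewrite addrC -rmorphD; exact: dd_conj.
rewrite (_ : 'i * _ = ('i * (p - q))^*); first exact: dd_conj.
by rewrite rmorphM rmorphB /= conjCi mulNr -mulrN opprB.
Qed.

Lemma ww_real_comp j (h : R -> R) (h' : R) (u : Cn -> R) z p q :
  is_derive (u z) (1 : R) h h' -> ww j (fun w => (u w)%:C) z p q ->
  ww j (fun w => (h (u w))%:C) z (h'%:C * p) (h'%:C * q).
Proof.
move=> hd [u1 u2]; split.
  by rewrite -mulrDr; exact: dd_real_comp.
by rewrite -mulrBr mulrCA; exact: dd_real_comp.
Qed.

Lemma ww_sum j (I : Type) (r : seq I) (F : I -> Cn -> C) (p q : I -> C) z :
  (forall i, ww j (F i) z (p i) (q i)) ->
  ww j (fun w => \sum_(i <- r) F i w) z (\sum_(i <- r) p i) (\sum_(i <- r) q i).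
Proof.
move=> Fd; elim: r => [|i r IH].
  by under eq_fun do rewrite big_nil; rewrite !big_nil; exact: ww_cst.
by under eq_fun do rewrite big_cons; rewrite !big_cons; exact: wwD.
Qed.

Lemma coord_dirE s j k : coord_dir (s,
  j) 0 k = (if s then 'i else 1) * (j == k)%:R :> C.
Proof. by rewrite /coord_dir !mxE eqxx /= eq_sym; case: s. Qed.

Lemma ww_coord j k z : ww j (fun w => w 0 k) z (j == k)%:R 0.
Proof.
split; rewrite ?addr0 ?subr0.
  by have := dd_coord k z (coord_dir (false, j)); rewrite coord_dirE mul1r.
by have := dd_coord k z (coord_dir (true, j)); rewrite coord_dirE.
Qed.

Lemma wirt_cst j (c : C) z : wirt j (fun=> c) z = 0.
Proof. by have [] := ww_wirt (ww_cst j c z). Qed.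
Lemma wirt_bar_cst j (c : C) z : wirt_bar j (fun=> c) z = 0.
Proof. by have [] := ww_wirt (ww_cst j c z). Qed.

Lemma form0E f z : form0 f z = f z *: (1 : E).
Proof. by []. Qed.

Lemma form0A f z A : form0 f z A = if A == finset.set0 then f z else 0.
Proof.
rewrite /form0 !ffunE /GRing.scale /=; case: eqP => _; first by rewrite mulr1.
by rewrite mulr0.
Qed.

Lemma form0_coef f z (D : (Cn -> C) -> C) : D (fun=> 0) = 0 ->
  [ffun A => D (fun w => form0 f w A)] = D f *: (1 : E).
Proof.
move=> D0; apply/ffunP => A.
rewrite ffunE [RHS](_ : _ = form0 (fun=> D f) z A)// form0A.
under eq_fun do rewrite form0A.
by case: eqP.
Qed.

Lemma del_form0 f z : del (form0 f) z = \sum_j wirt j f z *: (edz j : E).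
Proof.
apply: eq_bigr => j _;
  rewrite (@form0_coef f z (fun h => wirt j h z)) ?wirt_cst//.
by rewrite ewedgeE -scalerAr mulr1.
Qed.

Lemma delbar_form0 f z :
  delbar (form0 f) z = \sum_j wirt_bar j f z *: (edzb j : E).
Proof.
apply: eq_bigr => j _;
  rewrite (@form0_coef f z (fun h => wirt_bar j h z)) ?wirt_bar_cst//.
by rewrite ewedgeE -scalerAr mulr1.
Qed.

(** With the conjugate derivatives taken first, dd^c of [u] is read off from the matrix [p] of its
    mixed second derivatives. *)
Lemma ddcE (u : Cn -> R) (q : 'I_N -> Cn -> C) (p p' : 'I_N -> 'I_N -> Cn ->
  C) z :
  (forall k w, wirt_bar k (fun w => (u w)%:C) w = q k w) ->
  (forall j k w, ww j (q k) w (p j k w) (p' j k w)) ->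
  ddc u z = ('i / (pi : R)%:C) *: \sum_j \sum_k p j k z *: g2 j k.
Proof.
move=> uq qp; congr (_ *: _).
have -> : delbar (form0 (fun z => (u z)%:C)) = fun z =>
  \sum_k q k z *: (edzb k : E).
  by apply/funext => w; rewrite delbar_form0; apply: eq_bigr => k _; rewrite uq.
apply: eq_bigr => j _.
have -> : [ffun A => wirt j (fun w =>
  (\sum_k q k w *: (edzb k : E) : extalg R N) A) z] =
    \sum_k p j k z *: (edzb k : E) :> E.
  apply/ffunP => A; rewrite ffunE sum_ffunE.
  have -> : (fun w => (\sum_k q k w *: (edzb k : E) : extalg R N) A) =
      fun w => \sum_k (edzb k : extalg R N) A * q k w.
    by apply/funext => w; rewrite sum_ffunE; apply: eq_bigr => k _;
      rewrite ffunE mulrC.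
  have [-> _] := ww_wirt (ww_sum (index_enum 'I_N) (fun k =>
    wwZ ((edzb k : extalg R N) A) (qp j k z))).
  by apply: eq_bigr => k _; rewrite [RHS]ffunE mulrC.
rewrite ewedgeE mulr_sumr; apply: eq_bigr => k _.
exact: (esym (scalerAr _ (edz j : E) (edzb k : E))).
Qed.

Lemma wedge_powE (phi : dform R N) (k : nat) z : wedge_pow phi k z = (phi z :
  E) ^+ k.
Proof.
elim: k => [|k IH]; first by rewrite expr0 /wedge_pow /= form0E scale1r.
by rewrite exprS -IH.
Qed.

End Wirtinger.

Lemma split_lshift m n (j : 'I_m) : fintype.split (lshift n j) = inl j.
Proof. exact: (unsplitK (inl j)). Qed.

Lemma split_rshift m n (j : 'I_n) : fintype.split (rshift m j) = inr j.
Proof. exact: (unsplitK (inr j)). Qed.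

Section Epos1Expand.
Context {R : realType} {N : nat}.
Local Notation C := R[i].
Lemma epos1_expand (c : 'rV[C]_N) :
  epos1 c = 'i *: \sum_j \sum_k (c 0 j * (c 0 k)^*) *: g2 j k.
Proof.
have Z (A : algType C) (I : finType) (x y : I -> C) (a b : I -> A) :
   (\sum_j x j *: a j) * (\sum_k y k *: b k) = \sum_j \sum_k (x j * y k) *: (a
     j * b k).
  rewrite mulr_suml; apply: eq_bigr => j _; rewrite mulr_sumr;
    apply: eq_bigr => k _.
  by rewrite -scalerAl -scalerAr scalerA.
by rewrite epos1E; congr (_ *: _);
  exact: (Z (ealg R N) _ (fun j => c 0 j) (fun k => (c 0 k)^*) (fun j =>
  edz j) (fun k => edzb k)).
Qed.
End Epos1Expand.

(** * Pullback along maps whose components are multiples of coordinates *)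

Section MonomialPullback.
Context {R : realType} {M N : nat}.
Local Notation C := R[i].
Variables (mu : 'I_N -> C) (sigma : 'I_N -> 'I_M).
Hypothesis sigma_mono : forall x y, (sigma x < sigma y)%N = (x < y)%N.

Definition gcoef (k : 'I_(N + N)) : C :=
  match fintype.split k with inl j => mu j | inr j => (mu j)^* end.

Definition gidx (k : 'I_(N + N)) : 'I_(M + M) :=
  match fintype.split k with inl j => lshift M (sigma j) | inr j =>
    rshift M (sigma j) end.

Definition monmap : ealg R N -> ealg R M := gmap gcoef gidx.

Lemma gidx_mono x y : (gidx x < gidx y)%N = (x < y)%N.
Proof.
rewrite /gidx; case: (fintype.split_ordP x) => i ->;
  case: (fintype.split_ordP y) => j -> /=.
- exact: sigma_mono.
- by rewrite !(leq_trans (ltn_ord _)) ?leq_addr.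
- by rewrite [LHS]ltnNge [RHS]ltnNge !(ltnW (leq_trans (ltn_ord _) (leq_addr _
  _))).
- by rewrite !ltn_add2l.
Qed.

Lemma monmap_edz j : monmap (edz j) = mu j *: (edz (sigma j) : ealg R M).
Proof. by rewrite /monmap gmap_egen ?/gcoef ?/gidx ?split_lshift//;
  exact: gidx_mono. Qed.

Lemma monmap_edzb j : monmap (edzb j) = (mu j)^* *: (edzb (sigma j) : ealg R M).
Proof. by rewrite /monmap gmap_egen ?/gcoef ?/gidx ?split_rshift//;
  exact: gidx_mono. Qed.

Lemma monmapM a b : monmap (a * b) = monmap a * monmap b.
Proof. by rewrite /monmap gmapM//; exact: gidx_mono. Qed.

Lemma monmapX a k : monmap (a ^+ k) = monmap a ^+ k.
Proof. by rewrite /monmap gmapX//; exact: gidx_mono. Qed.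

Lemma monmap1 : monmap 1 = 1.
Proof. by rewrite /monmap gmap1//; exact: gidx_mono. Qed.

Lemma monmap_g2 j k :
  monmap (g2 j k) = (mu j * (mu k)^*) *: g2 (sigma j) (sigma k).
Proof.
rewrite /g2 monmapM monmap_edz monmap_edzb.
have Z (A : algType C) (x y : C) (a b : A) :
  (x *: a) * (y *: b) = (x * y) *: (a * b).
  by rewrite -scalerAl -scalerAr scalerA.
exact: Z.
Qed.

Lemma monmapD a b : monmap (a + b) = monmap a + monmap b.
Proof. exact: gmapD. Qed.

Lemma monmapZ (k : C) a : monmap (k *: a) = k *: monmap a.
Proof. exact: gmapZ. Qed.

Lemma monmap_sum (I : Type) (r : seq I) (P : pred I) F :
  monmap (\sum_(i <- r | P i) F i) = \sum_(i <- r | P i) monmap (F i).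
Proof. exact: gmap_sum. Qed.

(** Each component of [f] is a multiple of one coordinate, so its differential is a constant
    multiple of one generator and the pullback acts pointwise by an algebra map. Dilations and the
    projection onto V both have this form. *)
Lemma pullback_monmap (f : 'rV[C]_M -> 'rV[C]_N) (phi : dform R N) z :
  (forall w j, f w 0 j = mu j * w 0 (sigma j)) ->
  pullback f phi z = monmap (phi (f z)).
Proof.
move=> fE; apply: eq_bigr => A _; congr (_ *: _); apply: eq_bigr => k _.
have wc j i w : ww j (fun w => f w 0 i) w (mu i * (j == sigma i)%:R) 0.
  have -> : (fun w => f w 0 i) = (fun w => mu i * w 0 (sigma i)).
    by apply/funext => w'; exact: fE.
  by have := wwZ (mu i) (ww_coord j (sigma i) w); rewrite mulr0.
rewrite /dext del_form0 delbar_form0 /gcoef /gidx.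
case: (fintype.split k) => i.
  rewrite (bigD1 (sigma i))//= [X in _ + X + _]big1 => [|j ji]; last first.
    by rewrite (ww_wirt (wc j i z)).1 (negPf ji) mulr0 scale0r.
  rewrite (ww_wirt (wc (sigma i) i z)).1 eqxx mulr1 addr0 big1 ?addr0// => j _.
  by rewrite (ww_wirt (wc j i z)).2 scale0r.
rewrite big1 => [|j _];
  last by rewrite (ww_wirt (ww_conj (wc j i z))).1 conjC0 scale0r.
rewrite add0r (bigD1 (sigma i))//= big1 => [|j ji]; last first.
  by rewrite (ww_wirt (ww_conj (wc j i z))).2 (negPf ji) mulr0 conjC0 scale0r.
by rewrite (ww_wirt (ww_conj (wc (sigma i) i z))).2 eqxx mulr1 addr0.
Qed.

Lemma monmap_epos1 (c : 'rV[C]_N) :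
  monmap (epos1 c) = 'i *: \sum_j \sum_k (c 0 j * (c 0 k)^*) *: ((mu j * (mu
    k)^*) *: g2 (sigma j) (sigma k)).
Proof.
rewrite epos1_expand.
rewrite monmapZ monmap_sum; congr (_ *: _); apply: eq_bigr => j _.
rewrite monmap_sum; apply: eq_bigr => k _.
by rewrite monmapZ monmap_g2.
Qed.

End MonomialPullback.

Section Scaling.
Context {R : realType} {N : nat}.
Local Notation C := R[i].
Local Notation Cn := 'rV[C]_N.
Local Notation smooth := (@smooth_on R N setT).
Variable (mu : 'I_N -> R).
Implicit Types (f : Cn -> C) (z v : Cn).

Definition scl (z : Cn) : Cn := \row_j ((mu j)%:C * z 0 j).

Definition sclmap : ealg R N -> ealg R N := monmap (fun j => (mu j)%:C) id.

Let idm (x y : 'I_N) : (id x < id y)%N = (x < y)%N. Proof. by []. Qed.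

Lemma conjCR (x : R) : (x%:C)^* = x%:C :> C.
Proof. by apply/eqP; rewrite eq_complex /= oppr0 !eqxx. Qed.

Lemma sclmap_epos1 (c : Cn) : sclmap (epos1 c) = epos1 (scl c).
Proof.
rewrite /sclmap monmap_epos1// epos1_expand; congr (_ *: _).
apply: eq_bigr => j _; apply: eq_bigr => k _.
by rewrite scalerA !mxE rmorphM /= conjCR; congr (_ *: _); ring.
Qed.

(** Each i alpha /\ conj(alpha) is sent to one of the same kind, with alpha rescaled. Dilated
    currents therefore remain positive. *)
Lemma sclmap_pos q a : strongly_positive q a -> strongly_positive q (sclmap a).
Proof.
move=> /strongly_positiveP[L [KL ->]]; apply/strongly_positiveP.
rewrite /sclmap monmap_sum; apply: cone_sum => x /KL[x0 <-].
rewrite monmapZ; apply: coneZ => //; first exact: mulr_ge0.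
elim: x.2 => [|al s IH]; first by rewrite /eprod big_nil monmap1//;
  apply: cone1; exact: ler01.
rewrite /eprod big_cons monmapM// -[size _]add1n; apply: coneM => //;
  first exact: mulr_ge0.
by rewrite -/(sclmap _) sclmap_epos1; exact: pos1_epos1.
Qed.

Lemma gidx_id (k : 'I_(N + N)) : gidx (M := N) id k = k.
Proof. by rewrite /gidx; case: (fintype.split_ordP k) => j ->. Qed.

Lemma sclmapA a A : (sclmap a :
  extalg R N) A = (\prod_(k in A) gcoef (fun j =>
  (mu j)%:C) k) * (a : extalg R N) A.
Proof.
rewrite /sclmap /monmap [in LHS](ebas_expand a) gmap_sum sum_ffunE (bigD1 A)//=
  big1 => [|B BA].
  rewrite gmapZ gmap_ebas; last exact: gidx_mono.
  rewrite (eq_imset _ gidx_id) finset.imset_id !ffunE eqxx /GRing.scale /=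
    addr0 mulr1.
  exact: mulrC.
rewrite gmapZ gmap_ebas; last exact: gidx_mono.
rewrite (eq_imset _ gidx_id) finset.imset_id !ffunE eq_sym (negPf BA)
  /GRing.scale /=.
by rewrite !mulr0.
Qed.

Lemma scl_line z v (t : R) : scl (z + t%:C *: v) = scl z + t%:C *: scl v.
Proof. by apply/rowP => j; rewrite !mxE; ring. Qed.

Lemma dd_scl f z v d : dd f (scl z) (scl v) d -> dd (f \o scl) z v d.
Proof.
by rewrite /dd => -[f1 f2]; split; under eq_fun do rewrite /= scl_line.
Qed.

Lemma scl_continuous : continuous scl.
Proof.
move=> z; apply: rV_continuousP => j.
have -> : (fun y => scl y 0 j) = (fun y : Cn => (mu j)%:C * y 0 j).
  by apply/funext => y; rewrite mxE.
by apply: contM => //; [exact: cont_cst | exact: coord_continuousC].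
Qed.

Lemma smooth_scl f : smooth f -> smooth (f \o scl).
Proof.
move=> fs k; elim: k f fs => [|k IH] f fs.
  split=> // z _; apply: continuous_comp; first exact: scl_continuous.
  exact: (smooth_cont fs).
apply: (CkS (f' := fun v => dir_derive f (scl v) \o scl)).
- move=> z; apply: continuous_comp; first exact: scl_continuous.
  exact: (smooth_cont fs).
- by move=> v z; apply: dd_scl; exact: smooth_dd.
- by move=> v; apply: IH; exact: smooth_derive.
Qed.

Lemma dd_scale f z v d (r : R) : dd f z v d -> dd f z (r%:C *: v) (r%:C * d).
Proof.
have lin (g : R -> R) d' : is_derive (0 : R) (1 : R) g d' ->
    is_derive (0 : R) (1 : R) (fun t : R => g (t * r)) (r * d').
  move=> gd; have rd : is_derive (0 : R) (1 : R) (fun t : R => t * r) r.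
    apply: (is_derive_eq (is_deriveM (is_derive_id (0 : R) (1 :
      R)) (is_derive_cst r (0 : R) (1 : R)))).
    by rewrite /GRing.scale /= mul0r mulr1 add0r.
  rewrite mulrC; apply: (@is_derive1_comp R g (fun t : R =>
    t * r) 0 d' r) => //.
  by rewrite mul0r.
move=> [f1 f2]; split.
  rewrite ReM /= mul0r subr0; have := lin _ _ f1.
  by under eq_fun do rewrite rmorphM /= -scalerA.
rewrite ImM /= mul0r addr0; have := lin _ _ f2.
by under eq_fun do rewrite rmorphM /= -scalerA.
Qed.

Lemma scl_coord_dir (b : bool) (j : 'I_N) : scl (coord_dir (b,
  j)) = (mu j)%:C *: coord_dir (b, j).
Proof.
apply/rowP => k; rewrite !mxE; case: (eqVneq k j) => [->//|kj].
by rewrite /= !mulr0.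
Qed.

Lemma ww_scl j f z : smooth f -> ww j (f \o scl) z
  ((mu j)%:C * wirt j f (scl z)) ((mu j)%:C * wirt_bar j f (scl z)).
Proof.
move=> fs; have [w1 w2] := smooth_ww j (scl z) fs.
split; apply: dd_scl; rewrite scl_coord_dir.
  by rewrite -mulrDr; exact: dd_scale.
by rewrite -mulrBr mulrCA; exact: dd_scale.
Qed.

(** The factor [mu j] produced by the chain rule is also the factor by which [sclmap] multiplies
    dz_j and, [mu] being real, its conjugate. Closedness of the dilated currents rests on this. *)
Lemma sclmap_dext (phi : dform R N) z : (forall A, smooth (fun z => phi z A)) ->
  dext (fun w => sclmap (phi (scl w))) z = sclmap (dext phi (scl z)).
Proof.
move=> phis.
have ws j A : ww j (fun w => (sclmap (phi (scl w)) : extalg R N) A) z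
    ((mu j)%:C * (\prod_(k in A) gcoef (fun j =>
      (mu j)%:C) k * wirt j (fun w => phi w A) (scl z)))
    ((mu j)%:C * (\prod_(k in A) gcoef (fun j =>
      (mu j)%:C) k * wirt_bar j (fun w => phi w A) (scl z))).
  rewrite (_ : (fun w => _) = fun w => (\prod_(k in A) gcoef (fun j =>
    (mu j)%:C) k) * ((fun w => phi w A) \o scl) w).
    by rewrite (mulrCA _ _ (wirt _ _ _)) (mulrCA _ _ (wirt_bar _ _ _));
      apply: wwZ; exact: (ww_scl j z (phis A)).
  by apply/funext => w; rewrite sclmapA.
rewrite /dext /sclmap monmapD; congr (_ + _).
  rewrite monmap_sum; apply: eq_bigr => j _.
  rewrite !ewedgeE monmapM// monmap_edz//.
  rewrite (_ : [ffun A => _] = (mu j)%:C *: sclmap [ffun A =>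
    wirt j (fun w => phi w A) (scl z)]).
    exact: (esym (etrans (esym (scalerAl _ _ _)) (scalerAr _ (edz j :
      ealg R N) _))).
  by apply/ffunP => A; rewrite [RHS]ffunE sclmapA !ffunE (ww_wirt (ws j A)).1.
rewrite monmap_sum; apply: eq_bigr => j _.
rewrite !ewedgeE monmapM// monmap_edzb// conjCR.
rewrite (_ : [ffun A => _] = (mu j)%:C *: sclmap [ffun A =>
  wirt_bar j (fun w => phi w A) (scl z)]).
  exact: (esym (etrans (esym (scalerAl _ _ _)) (scalerAr _ (edzb j :
    ealg R N) _))).
by apply/ffunP => A; rewrite [RHS]ffunE sclmapA !ffunE (ww_wirt (ws j A)).2.
Qed.

End Scaling.

(** The complex Hessian of log(|x''|^2 + |theta|^2) is a rank-one matrix plus a diagonal one; this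
    separates the two contributions. *)
Lemma sum_rank1_diag (K : comNzRingType) (V : lmodType K) (I : finType) (G :
  I -> I -> V)
    (x y : K) (f c d : I -> K) :
  \sum_j \sum_k (x * c j * d k + y * (f k * (j == k)%:R)) *: G j k =
  x *: (\sum_j \sum_k (c j * d k) *: G j k) + y *: \sum_k f k *: G k k.
Proof.
rewrite !scaler_sumr -big_split; apply: eq_bigr => j _.
transitivity (\sum_k ((x * c j * d k) *: G j k +
  (y * (f k * (j == k)%:R)) *: G j k)).
  by apply: eq_bigr => k _; rewrite scalerDl.
rewrite big_split; congr (_ + _).
  by rewrite scaler_sumr; apply: eq_bigr => k _; rewrite scalerA mulrA.
rewrite (bigD1 j)//= big1 => [|k kj];
  last by rewrite eq_sym (negPf kj) !mulr0 scale0r.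
by rewrite eqxx mulr1 addr0 scalerA.
Qed.

Section Coefficients.
Context {R : realType} {N : nat}.
Local Notation E := (ealg R N).
Local Notation "a `at A" := ((a : extalg R N) A) (at level 10).

Lemma coefZ (k : R[i]) (a : E) A : (k *: a) `at A = k * a `at A.
Proof. by rewrite ffunE. Qed.
Lemma coefD (a b : E) A : (a + b) `at A = a `at A + b `at A.
Proof. by rewrite ffunE. Qed.
Lemma coefN (a : E) A : (- a) `at A = - (a `at A).
Proof. by rewrite ffunE. Qed.
Lemma coef_sum (I : Type) (r : seq I) (P : pred I) (F : I -> E) A :
  (\sum_(i <- r | P i) F i) `at A = \sum_(i <- r | P i) (F i) `at A.
Proof. by rewrite sum_ffunE. Qed.

End Coefficients.

Section BaseForm.
Context {R : realType} {m : nat}.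
Local Notation C := R[i].

Lemma omegaVE (z : 'rV[C]_m) :
  @omegaV R m z = (pi^-1)%:C *: ('i *: \sum_j g2 j j) :> ealg R m.
Proof.
have n2E : (fun z : 'rV[C]_m => (norm2 z)%:C) = fun z =>
  \sum_k z 0 k * (z 0 k)^*.
  by apply/funext => w; exact: norm2C.
have wn (j : 'I_m) (w : 'rV[C]_m) : ww j (fun z : 'rV[C]_m =>
  (norm2 z)%:C) w (w 0 j)^* (w 0 j).
  rewrite n2E.
  have := ww_sum (index_enum 'I_m) (fun k =>
    wwM (ww_coord j k w) (ww_conj (ww_coord j k w))).
  rewrite (bigD1 j)//= big1 => [|k kj]; last first.
    by rewrite eq_sym (negPf kj) mul0r conjC0 mulr0 addr0.
  rewrite (bigD1 j)//= big1 => [|k kj]; last first.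
    by rewrite eq_sym (negPf kj) mul0r conjC_nat mulr0 addr0.
  by rewrite eqxx conjC0 conjC_nat mul1r !mulr0 mul0r add0r mulr1 !addr0.
rewrite /omegaV (@ddcE _ _ _ (fun k w => w 0 k) (fun j k _ =>
  (j == k)%:R) (fun _ _ _ => 0)).
- have -> : \sum_j \sum_k (j == k)%:R *: g2 j k = \sum_j g2 j j :> ealg R m.
    apply: eq_bigr => j _; rewrite (bigD1 j)//= big1 => [|k kj].
      by rewrite eqxx addr0; exact: scale1r.
    by rewrite eq_sym (negPf kj); exact: scale0r.
  have Z (V : lmodType C) (x y w : C) (v : V) : w = y * x ->
    w *: v = y *: (x *: v).
    by move=> ->; rewrite scalerA.
  by apply: Z; rewrite mulrC fmorphV.
- by move=> k w; have [_ ->] := ww_wirt (wn k w).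
- by move=> j k w; exact: ww_coord.
Qed.

End BaseForm.

(** * The forms of the mass hypothesis on the normal bundle *)

Section TangentForms.
Context {R : realType} {m n : nat}.
Local Notation C := R[i].
Local Notation Cn := 'rV[C]_(m + n).
Local Notation E := (ealg R (m + n)).
Local Notation smooth := (@smooth_on R (m + n) setT).
Implicit Types (z w : Cn) (j k : 'I_(m + n)).

Definition fiber j : bool := if fintype.split j is inr _ then true else false.

Lemma fiberL (j : 'I_m) : fiber (lshift n j) = false.
Proof. by rewrite /fiber split_lshift. Qed.

Lemma fiberR (j : 'I_n) : fiber (rshift m j) = true.
Proof. by rewrite /fiber split_rshift. Qed.

Definition dmu (l : R) j : R := if fiber j then l else 1.

Lemma dilationE (l : R) : dilation l%:C = scl (dmu l) :> (Cn -> Cn).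
Proof.
apply/funext => z; apply/rowP => j; rewrite !mxE /dmu /fiber.
by case: (fintype.split_ordP j) => i ->; rewrite ?mxE ?mul1r.
Qed.

Lemma pullback_dilation (l : R) (phi : dform R (m + n)) z :
  pullback (dilation l%:C) phi z = sclmap (dmu l) (phi (scl (dmu l) z)).
Proof.
rewrite -dilationE; apply: pullback_monmap => // w j.
by rewrite dilationE mxE.
Qed.

Definition sden (theta : C) z : R := norm2 (rsubmx z) + cabs theta ^+ 2.

(** These are the coefficients of the (1,0)-part of the differential of |x''|^2, so [epos1 (zfib z)]
    is i del s /\ delbar s with s = [sden theta z]. *)
Definition zfib z : Cn := \row_j (if fiber j then (z 0 j)^* else 0).

Definition betafib : E := \sum_j (fiber j)%:R *: ('i *: g2 j j).
Definition betabase : E := \sum_j (~~ fiber j)%:R *: ('i *: g2 j j).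

(** With s = |x''|^2 + |theta|^2, this is 1/(2 pi) times i del delbar s / s - i del s /\ delbar s /
    s^2, the explicit value of dd^c of (1/2) log s for nonzero theta. *)
Definition ttform (theta : C) z : E :=
  (2^-1 / pi)%:C *: ((sden theta z)^-1%:C *: betafib - ((sden theta z)^-1 ^+
    2)%:C *: (epos1 (zfib z) : E)).

Definition omV : E := (pi^-1)%:C *: betabase.

Lemma sdenE theta : (fun z => (sden theta z)%:C) =
  (fun z => \sum_j (fiber j)%:R * (z 0 j * (z 0 j)^*) + (cabs theta ^+ 2)%:C).
Proof.
apply/funext => z; rewrite /sden rmorphD /= norm2C; congr (_ + _).
rewrite [RHS]big_split_ord /= [X in _ = X + _]big1 => [|j _];
  last by rewrite fiberL mul0r.
by rewrite add0r; apply: eq_bigr => j _; rewrite fiberR mul1r !mxE.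
Qed.

Lemma sden_gt0 theta z : theta != 0 -> 0 < sden theta z.
Proof.
move=> t0; rewrite ltr_wpDl//; first by apply: sumr_ge0 => j _; exact: sqr_ge0.
by rewrite exprn_gt0// -ltcR -normC_cabs normr_gt0.
Qed.

Lemma ww_sden theta j z : ww j (fun z => (sden theta z)%:C) z
  ((fiber j)%:R * (z 0 j)^*) ((fiber j)%:R * z 0 j).
Proof.
rewrite sdenE.
have wk k : ww j (fun z => (fiber k)%:R * (z 0 k * (z 0 k)^*)) z
    ((fiber k)%:R * ((j == k)%:R * (z 0 k)^* + z 0 k * 0))
    ((fiber k)%:R * (0 * (z 0 k)^* + z 0 k * (j == k)%:R)).
  apply: wwZ; have := wwM (ww_coord j k z) (ww_conj (ww_coord j k z)).
  by rewrite conjC0 conjC_nat.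
have := wwD (ww_sum (index_enum 'I_(m +
  n)) wk) (ww_cst j (cabs theta ^+ 2)%:C z).
rewrite !addr0 (bigD1 j)//= big1 => [|k kj]; last first.
  by rewrite eq_sym (negPf kj) mul0r mulr0 addr0 mulr0.
rewrite (bigD1 j)//= big1 => [|k kj]; last first.
  by rewrite eq_sym (negPf kj) mul0r mulr0 addr0 mulr0.
by rewrite eqxx mul1r !mulr0 mul0r add0r mulr1 !addr0.
Qed.

Lemma betafibE : betafib = 'i *: \sum_j (fiber j)%:R *: g2 j j.
Proof. by rewrite scaler_sumr; apply: eq_bigr => j _;
  rewrite scalerA [RHS]scalerA mulrC. Qed.

Lemma ddc_uT theta z : theta != 0 -> ddc (uT theta) z = ttform theta z.
Proof.
move=> t0.
(* [q k] is the conjugate derivative of (1/2) log [sden]; [p j k] and [p' j k] are the two Wirtinger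
   derivatives of [q k]. *)
pose q k w : C := (2^-1 * (sden theta w)^-1)%:C * ((fiber k)%:R * w 0 k).
pose p j k w : C := (- 2^-1 * ((sden theta w)^-1 ^+ 2))%:C * ((fiber j)%:R * (w
  0 j)^*) * ((fiber k)%:R * w 0 k)
   + (2^-1 * (sden theta w)^-1)%:C * ((fiber k)%:R * (j == k)%:R).
pose p' j k w : C := (- 2^-1 * ((sden theta w)^-1 ^+ 2))%:C * ((fiber j)%:R * w
  0 j) * ((fiber k)%:R * w 0 k)
   + (2^-1 * (sden theta w)^-1)%:C * ((fiber k)%:R * 0).
rewrite (@ddcE _ _ _ q p p').
- rewrite /ttform; have ->
  : epos1 (zfib z) = 'i *: \sum_j \sum_k ((fiber j)%:R * (z 0 j)^* * ((fiber
  k)%:R * z 0 k)) *: g2 j k.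
    rewrite epos1_expand; congr (_ *: _); apply: eq_bigr => j _;
      apply: eq_bigr => k _.
    rewrite !mxE; congr (_ *: _); congr (_ * _).
      by case: (fiber j); rewrite ?mul1r ?mul0r.
    by case: (fiber k); rewrite ?mul1r ?mul0r ?conjCK ?conjC0.
  rewrite (sum_rank1_diag (V := E)).
  rewrite betafibE.
  have fin (V : lmodType C) (P Q : V) (a : R) :
      ('i / (pi : R)%:C) *: ((- 2^-1 * a ^+ 2)%:C *: P + (2^-1 * a)%:C *: Q) =
      (2^-1 / pi)%:C *: (a%:C *: ('i *: Q) - (a ^+ 2)%:C *: ('i *: P)).
    rewrite addrC scalerDr scalerBr !scalerA -scaleNr.
    have pinv : (pi : R)%:C^-1 = (pi^-1)%:C by rewrite fmorphV.
    congr (_ *: _ + _ *: _); rewrite pinv !(rmorphM, rmorphN) /=; ring.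
  exact: fin.
- move=> k w; have s0 := sden_gt0 w t0.
  have hd : is_derive (sden theta w) (1 : R) (fun x =>
    2^-1 * ln x) (2^-1 * (sden theta w)^-1).
    have := is_deriveZ 2^-1 (is_derive1_ln s0); exact.
  by have [_ ->] := ww_wirt (ww_real_comp hd (ww_sden theta k w)).
- move=> j k w; have s0 := sden_gt0 w t0.
  have hd : is_derive (sden theta w) (1 : R) (fun x =>
    2^-1 * x^-1) (- 2^-1 * (sden theta w)^-1 ^+ 2).
    have h := is_deriveZ 2^-1 (@is_deriveV R id (sden theta w) 1 1 (lt0r_neq0
      s0) (is_derive_id _ _)).
    by apply: (is_derive_eq h);
      rewrite /GRing.scale /= mulr1 mulrN mulNr exprVn.
  exact: (wwM (ww_real_comp hd (ww_sden theta j w)) (wwZ (fiber k)%:R (ww_coord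
    j k w))).
Qed.

Lemma TTE theta i z : theta != 0 -> TT theta i z = ttform theta z ^+ i.
Proof. by move=> t0; rewrite /TT wedge_powE ddc_uT. Qed.

Lemma epos1Z (k : C) (c : Cn) : epos1 (k *: c) = (k * k^*) *: (epos1 c : E).
Proof.
rewrite !epos1E elinZ elinbZ.
have Z (A : algType C) (t x y : C) (a b : A) :
  t *: ((x *: a) * (y *: b)) = (x * y) *: (t *: (a * b)).
  by rewrite -scalerAl -scalerAr !scalerA; congr (_ *: _); ring.
exact: (Z E).
Qed.

Lemma zfib_scl (l : R) z :
  scl (dmu l) (zfib (scl (dmu l) z)) = (l ^+ 2)%:C *: zfib z.
Proof.
apply/rowP => j; rewrite !mxE /dmu; case: (fiber j); last by rewrite !mulr0.
by rewrite rmorphM /= conjCR rmorphXn /= expr2 mulrA.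
Qed.

Lemma sden_scl (l : R) z : l != 0 ->
  sden 1 (scl (dmu l) z) = l ^+ 2 * sden (l%:C^-1) z.
Proof.
move=> l0; rewrite /sden (_ : cabs 1 = 1); last by rewrite /cabs normr1.
rewrite mulrDr -fmorphV cabsR /= real_normK ?num_real// exprVn mulfV
  ?expf_neq0// expr1n.
congr (_ + _); rewrite /norm2 mulr_sumr; apply: eq_bigr => k _.
by rewrite !mxE /dmu fiberR cabsM cabsR exprMn real_normK ?num_real.
Qed.

Lemma sclmap_g2diag (mu : 'I_(m + n) -> R) (x : C) j :
  sclmap mu (x *: ('i *: g2 j j)) = x *: ('i *: ((mu j * mu j)%:C *: g2 j j)).
Proof.
rewrite /sclmap 2!monmapZ; congr (_ *: (_ *: _)).
by rewrite monmap_g2// conjCR -rmorphM.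
Qed.

Lemma betafib_scl (l : R) : sclmap (dmu l) betafib = (l ^+ 2)%:C *: betafib.
Proof.
rewrite /sclmap monmap_sum scaler_sumr; apply: eq_bigr => j _.
rewrite -/(sclmap _ _) sclmap_g2diag /dmu.
have Z (V : lmodType C) (t x y b : C) (v : V) : x * b = t * b ->
  b *: (y *: (x *: v)) = t *: (b *: (y *: v)).
  move=> xb; rewrite !scalerA; congr (_ *: _).
  by transitivity (x * b * y); [ring | rewrite xb; ring].
apply: Z; case: (fiber j); last by rewrite !mulr0.
by rewrite expr2.
Qed.

Lemma betabase_scl (l : R) : sclmap (dmu l) betabase = betabase.
Proof.
rewrite /sclmap monmap_sum; apply: eq_bigr => j _.
rewrite -/(sclmap _ _) sclmap_g2diag /dmu.
have Z0 (V : lmodType C) (a b : V) :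
  (~~ true)%:R *: a = (~~ true)%:R *: b by rewrite !scale0r.
have Z1 (V : lmodType C) (x y : C) (a : V) :
  x *: (y *: ((1 * 1)%:C *: a)) = x *: (y *: a).
  by rewrite mulr1 scale1r.
by case: (fiber j); [exact: Z0 | exact: Z1].
Qed.

Lemma omV_scl (l : R) : sclmap (dmu l) omV = omV.
Proof. by rewrite /sclmap monmapZ -/(sclmap _ _) betabase_scl. Qed.

(** Scaling multiplies the fibre form by l^2 and the rank-one term by l^4. Their denominators become
    l^2 and l^4 times those for theta = 1/l, so all powers of l cancel. *)
Lemma ttform_scl (l : R) z : l != 0 ->
  sclmap (dmu l) (ttform 1 (scl (dmu l) z)) = ttform (l%:C^-1) z.
Proof.
move=> l0; rewrite /ttform.
have dist (x y w : C) (a b : E) : sclmap (dmu l) (x *: (y *: a - w *: b)) =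
    x *: (y *: sclmap (dmu l) a - w *: sclmap (dmu l) b).
  rewrite /sclmap monmapZ monmapD -scaleNr !monmapZ scaleNr; congr (_ *: _).
rewrite dist.
have e1 : sclmap (dmu l) (epos1 (zfib (scl (dmu l) z))) =
    ((l ^+ 2)%:C * (l ^+ 2)%:C) *: (epos1 (zfib z) : E).
  rewrite sclmap_epos1 zfib_scl; apply: etrans (epos1Z _ _) _.
  by congr ((_ * _) *: _); exact: conjCR.
rewrite e1 betafib_scl (sden_scl z l0).
have lN : l ^+ 2 != 0 by rewrite expf_neq0.
have Z (V : lmodType C) (t a b c d e f : C) (x y : V) :
   a * b = e -> c * d = f ->
   t *: (a *: (b *: x) - c *: (d *: y)) = t *: (e *: x - f *: y).
  by move=> <- <-; rewrite !scalerA.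
apply: (Z E); rewrite -!rmorphM /=; congr (_%:C).
  by rewrite invfM mulrAC mulVf// mul1r.
rewrite invfM; set s := (sden _ z)^-1; set q := l ^+ 2 in lN *.
by transitivity (s ^+ 2 * (q^-1 * q) ^+ 2);
  [ring | rewrite mulVf// expr1n mulr1].
Qed.

Lemma ttform_smooth theta A : theta != 0 -> smooth (fun z =>
  (ttform theta z : extalg R (m + n)) A).
Proof.
move=> t0.
have iss : smooth (fun z => ((sden theta z)^-1)%:C).
  apply: smooth_inv => [z|]; first exact/lt0r_neq0/sden_gt0.
  rewrite sdenE; apply: smoothD; last exact: smooth_cst.
  apply: smooth_sum => j; apply: smoothM; first exact: smooth_cst.
  by apply: smoothM; [exact: smooth_coord | apply/smooth_conj/smooth_coord].
have zs j : smooth (fun z => zfib z 0 j).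
  rewrite (_ : (fun _ => _) = fun z : Cn => if fiber j then (z 0 j)^* else 0).
    by case: (fiber j); [apply/smooth_conj/smooth_coord | exact: smooth_cst].
  by apply/funext => z; rewrite mxE.
rewrite (_ : (fun _ => _) = fun z =>
  (2^-1 / pi)%:C * (((sden theta z)^-1)%:C * (betafib : extalg R (m + n)) A +
  (-1) * (((sden theta z)^-1)%:C * ((sden theta z)^-1)%:C * ('i * \sum_j \sum_k
    (zfib z 0 j * (zfib z 0 k)^*) * (g2 j k : extalg R (m + n)) A)))).
  apply: smoothM; first exact: smooth_cst.
  apply: smoothD; first by apply: smoothM => //; exact: smooth_cst.
  apply: smoothM; first exact: smooth_cst.
  apply: smoothM; first exact: smoothM.
  apply: smoothM; first exact: smooth_cst.
  apply: smooth_sum => j; apply: smooth_sum => k.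
  apply: smoothM; last exact: smooth_cst.
  by apply: smoothM => //; exact: smooth_conj.
apply/funext => z; rewrite /ttform epos1_expand coefZ coefD coefN.
rewrite (coefZ _ betafib) mulN1r; congr (_ * (_ - _)).
rewrite coefZ -rmorphM expr2; congr (_ * _); rewrite coefZ; congr (_ * _).
rewrite coef_sum; apply: eq_bigr => j _; rewrite coef_sum;
  apply: eq_bigr => k _.
exact: coefZ.
Qed.

Lemma betabase_comm (a : E) : GRing.comm betabase a.
Proof.
apply/commr_sym/commr_sum => j _; apply/commr_sym.
rewrite /GRing.comm -!scalerAl -!scalerAr; congr (_ *: (_ *: _)).
exact: egen2_comm.
Qed.

Lemma omV_comm (a : E) : GRing.comm omV a.
Proof. by rewrite /GRing.comm -scalerAl -scalerAr betabase_comm. Qed.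

Definition fibgens : {set 'I_((m + n) + (m + n))} :=
  [set lshift (m + n) (rshift m k) | k in 'I_n]%SET.
Definition basegens : {set 'I_((m + n) + (m + n))} :=
  [set lshift (m + n) (lshift n k) | k in 'I_m]%SET.

Lemma graded_g2 (G : {set 'I_((m + n) + (m + n))}) j k :
  lshift (m + n) j \in G -> rshift (m + n) k \notin G ->
    graded G 1 (g2 j k : E).
Proof.
move=> jG kG; rewrite /g2 /edz /edzb -!ebas1 -[1%N]addn0; apply: gradedM.
  have := @graded_ebas R _ G [set lshift (m + n) j]%SET.
  rewrite (_ : _ :&: G = [set lshift (m + n) j])%SET ?cards1//.
  by apply/setP => x; rewrite !inE; case: eqP => // ->.
have := @graded_ebas R _ G [set rshift (m + n) k]%SET.
rewrite (_ : _ :&: G = finset.set0)%SET ?cards0//.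
by apply/setP => x; rewrite !inE; case: eqP => // ->; apply/negbTE.
Qed.

(** Every term of [ttform] contains exactly one generator dz_j with [j] a fibre index, and there are
    only [n] of these. *)
Lemma ttform_vanish theta z i : (n < i)%N -> ttform theta z ^+ i = 0.
Proof.
move=> ni; have gt : graded fibgens 1 (ttform theta z).
  have g2G j k : fiber j -> graded fibgens 1 (g2 j k : E).
    move=> fj; apply: graded_g2.
      move: fj; case: (fintype.split_ordP j) => i' ->; rewrite ?fiberL// => _.
      by apply: imset_f.
    by apply/imsetP => -[k' _ /eqP]; rewrite eq_rlshift.
  rewrite /ttform; apply: gradedZ; apply: gradedD.
    apply: gradedZ; apply: graded_sum => j _.
    have [fj|_] := boolP (fiber j); last first.
      by rewrite (_ : _ *: _ = 0); [exact: graded0 | exact: scale0r].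
    by do 2 apply: gradedZ; exact: g2G.
  rewrite -scaleNr; apply: gradedZ; rewrite epos1_expand; apply: gradedZ.
  apply: graded_sum => j _; apply: graded_sum => k _.
  have [fj|nfj] := boolP (fiber j); first by apply: gradedZ; exact: g2G.
  by rewrite (_ : _ *: _ = 0) ?mxE ?(negPf nfj) ?mul0r;
    [exact: graded0 | exact: scale0r].
have := @gradedX _ _ _ _ _ i gt; rewrite mul1n => /graded_vanish; apply.
by apply: leq_ltn_trans ni; rewrite (leq_trans (leq_imset_card _ _))// card_ord.
Qed.

Lemma omV_vanish i : (m < i)%N -> omV ^+ i = 0.
Proof.
move=> mi; have gt : graded basegens 1 omV.
  apply: gradedZ; apply: graded_sum => j _.
  have [fj|fj] := boolP (fiber j).
    by rewrite (_ : _ *: _ = 0); [exact: graded0 | exact: scale0r].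
  do 2 apply: gradedZ; apply: graded_g2.
    move: fj; case: (fintype.split_ordP j) => i' ->; rewrite ?fiberR// => _.
    by apply: imset_f.
  by apply/imsetP => -[k' _ /eqP]; rewrite eq_rlshift.
have := @gradedX _ _ _ _ _ i gt; rewrite mul1n => /graded_vanish; apply.
by apply: leq_ltn_trans mi; rewrite (leq_trans (leq_imset_card _ _))// card_ord.
Qed.

Lemma betabaseE : betabase = 'i *: \sum_(j < m) g2 (lshift n j) (lshift n j).
Proof.
have Z1 (V : lmodType C) (x : V) : (~~ false)%:R *: x = x by rewrite scale1r.
have Z0 (V : lmodType C) (x : V) : (~~ true)%:R *: x = 0 by rewrite scale0r.
rewrite /betabase big_split_ord /= [X in _ + X]big1 => [|j _].
  rewrite addr0 scaler_sumr; apply: eq_bigr => j _.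
  by rewrite fiberL; exact: Z1.
by rewrite fiberR; exact: Z0.
Qed.

Lemma pullback_omegaV (k : nat) z :
  pullback lsubmx (wedge_pow (@omegaV R m) k) z = omV ^+ k.
Proof.
have mono (x y : 'I_m) : (lshift n x < lshift n y)%N = (x < y)%N by [].
have e : monmap (fun=> 1) (lshift n) ((pi^-1)%:C *: ('i *: \sum_(j < m) g2 j
  j)) = omV :> E.
  rewrite /omV betabaseE 2!monmapZ monmap_sum.
  congr (_ *: (_ *: _)); apply: eq_bigr => j _.
  by rewrite monmap_g2// conjC1 mulr1; exact: scale1r.
rewrite (@pullback_monmap R (m + n) m (fun=> 1) (lshift n)) => [|w i].
  by rewrite wedge_powE monmapX// omegaVE e.
by rewrite mxE mul1r.
Qed.

Definition omE z : E := ttform 1 z + omV.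

Let cpos q (a : E) := cone (fun x : C => 0 <= x) q a.

(* Lagrange's identity absorbs the negative term of dd^c log(|x''|^2 + 1). *)
Lemma omE_lower (M : R) : 0 <= M -> exists2 e : R, 0 < e &
  forall z, norm2 (rsubmx z) <= M -> cpos 1 (omE z - e%:C *: (ebeta : E)).
Proof.
move=> M0; pose D := 1 + M; have D1 : 1 <= D by rewrite lerDl.
have D0 : 0 < D by rewrite (lt_le_trans ltr01).
have pi0 := @pi_gt0 R.
(* Along the fibre the smallest eigenvalue of dd^c u_1 is (1 + |x''|^2)^-2 / (2 pi), at least D^-2 /
   (2 pi) where |x''|^2 <= M. The base part has the larger eigenvalue 1 / pi. *)
exists (2^-1 / pi * D^-1 ^+ 2);
  first by rewrite mulr_gt0 ?divr_gt0 ?invr_gt0 ?exprn_gt0 ?invr_gt0.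
move=> z zM; pose r := norm2 (rsubmx z); pose s := (sden 1 z)^-1.
have r0 : 0 <= r by apply: sumr_ge0 => j _; exact: sqr_ge0.
have sE : sden 1 z = r + 1.
  by rewrite /sden (_ : cabs 1 = 1) ?expr1n// /cabs normr1.
have s0 : 0 < s by rewrite invr_gt0 sE ltr_wpDl.
have sle : s <= 1 by rewrite invf_le1 sE ?lerDr ?ltr_wpDl.
have sD : D^-1 <= s.
  have rD : r + 1 <= D by rewrite /D addrC lerD2l.
  have r10 : 0 < r + 1 by rewrite ltr_wpDl.
  by rewrite /s sE lef_pV2 ?posrE.
have nz : norm2 (zfib z) = r.
  rewrite /norm2 big_split_ord /= big1 => [|j _]; last first.
    by rewrite mxE fiberL cabs0 expr0n.
  rewrite add0r; apply: eq_bigr => j _; rewrite !mxE fiberR.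
  by rewrite /cabs norm_conjC.
have Dv0 : 0 <= D^-1 by rewrite invr_ge0 ltW.
have D2 : D^-1 ^+ 2 <= s ^+ 2.
  by apply: lerXn2r => //; rewrite nnegrE ?Dv0//; exact: ltW.
have sr1 : s * r <= 1.
  by rewrite /s sE mulrC ler_pdivrMr ?ltr_wpDl// mul1r lerDl.
have s2r : s ^+ 2 * r <= 1.
  by rewrite expr2 -mulrA mulr_ile1 ?mulr_ge0 ?(ltW s0).
have D21 : D^-1 ^+ 2 <= 1 by rewrite expr_le1// invf_le1.
have sI : s * (r + 1) = 1 by rewrite /s sE mulVf// gt_eqF// ltr_wpDl.
pose c1 := 2^-1 / pi : R.
have c10 : 0 <= c1 by rewrite divr_ge0 ?invr_ge0 ?(ltW pi0).
(* As s (r + 1) = 1, one has s - s^2 r = s^2. Lagrange's identity is spent on r (F + B) - P with the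
   full form F + B; the excess of B is paid from B / pi, which suffices because [c1] is 1 / (2 pi)
   and both s^2 r and D^-2 are at most 1. *)
have key (V : lmodType C) (F B P : V) :
    (c1)%:C *: (s%:C *: F - (s ^+ 2)%:C *: P) +
      (pi^-1)%:C *: B - (c1 * D^-1 ^+ 2)%:C *: (F + B) =
    (c1 * s ^+ 2)%:C *: (r%:C *: (F + B) - P) +
      (c1 * (s ^+ 2 - D^-1 ^+ 2))%:C *: F +
    (pi^-1 - c1 * (s ^+ 2 * r + D^-1 ^+ 2))%:C *: B.
  have cF : (c1 * (s ^+ 2 - D^-1 ^+ 2))%:C = (c1 * s)%:C - (c1 * s ^+ 2 * r)%:C
    - (c1 * D^-1 ^+ 2)%:C :> C.
    rewrite -!rmorphB; congr (_%:C).
    by rewrite -[s in c1 * s - _]mulr1 -sI; ring.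
  have cB : (pi^-1 - c1 * (s ^+ 2 * r + D^-1 ^+ 2))%:C =
      (pi^-1)%:C - (c1 * s ^+ 2 * r)%:C - (c1 * D^-1 ^+ 2)%:C :> C.
    by rewrite -!rmorphB; congr (_%:C); ring.
  rewrite cF cB !scalerBr !scalerDr !scalerA -!rmorphM !scalerBl.
  move: ((c1 * s)%:C *: F) ((c1 * s ^+ 2)%:C *: P) ((pi^-1)%:C *: B) ((c1 * s
    ^+ 2 * r)%:C *: F)
    ((c1 * s ^+ 2 * r)%:C *: B) ((c1 * D^-1 ^+ 2)%:C *: F) ((c1 * D^-1 ^+ 2)%:C
      *: B).
  move=> a b c d e f g.
  rewrite opprD !addrA; apply/eqP; rewrite -subr_eq0; apply/eqP.
  rewrite !opprD !opprK !addrA.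
  by rewrite (ACl (1*9*(2*8)*(3*12)*(4*11)*(5*14)*(6*10)*(7*13)))/= !(subrr,
    addNr, addr0, add0r).
have posG (b : 'I_(m + n) -> bool) : cpos 1 (\sum_j (b j)%:R *: ('i *: g2 j j)).
  apply: cone_sum => j _; apply: coneZ; [exact: mulr_ge0 | exact: ler0n |].
  by rewrite -epos1_delta; exact: pos1_epos1.
have posR (x : R) (a : E) : 0 <= x -> cpos 1 a -> cpos 1 (x%:C *: a).
  by move=> x0 pa; apply: coneZ => //; [exact: mulr_ge0 | rewrite lecR].
have bE : ebeta = betafib + betabase :> E.
  rewrite -big_split; apply: eq_bigr => j _.
  have Z (V : lmodType C) (x : V) :
    x = (fiber j)%:R *: x + (~~ fiber j)%:R *: x.
    by case: (fiber j); rewrite !scale1r scale0r ?addr0 ?add0r.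
  exact: Z.
rewrite /omE /ttform -/s -/c1 bE key.
apply: coneD; first apply: coneD.
- apply: posR; first by rewrite mulr_ge0// exprn_ge0// ltW.
  by rewrite -bE -nz; exact: lagrange.
- by apply: posR; [rewrite mulr_ge0// subr_ge0 | exact: posG].
- apply: posR; last exact: posG.
  rewrite subr_ge0; apply: (@le_trans _ _ (c1 * 2));
    first by rewrite ler_wpM2l// -[2]/(1 + 1) lerD.
  by rewrite /c1 mulrAC mulVf ?mul1r// pnatr_eq0.
Qed.

Lemma omE_pos z : cpos 1 (omE z).
Proof.
have r0 : 0 <= norm2 (rsubmx z) by apply: sumr_ge0 => j _; exact: sqr_ge0.
have [e e0 /(_ z (lexx _)) h] := omE_lower r0.
rewrite -(subrK (e%:C *: (ebeta : E)) (omE z)); apply: coneD => //.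
by apply: coneZ; [exact: mulr_ge0 | rewrite lecR ltW | exact: pos1_ebeta].
Qed.

End TangentForms.

(** * Test forms and the fiberwise dilations *)

Section CompactInduction.
Context {T : topologicalType}.

(** If [P K] failed, the sets [B] with [P (K \ B)] would form a proper filter containing [K]. At a
    cluster point in [K] the local hypothesis puts the complement of a neighbourhood into this
    filter, a contradiction. *)
Lemma compact_ind (P : set T -> Prop) (K : set T) :
  P set0 -> (forall A B, A `<=` B -> P B -> P A) ->
  (forall A B, P A -> P B -> P (A `|` B)) ->
  compact K -> (forall x, K x -> exists2 A, nbhs x A & P A) -> P K.
Proof.
move=> P0 Psub PU Kc Kloc; apply: contrapT => nPK.
pose F : set_system T := [set B | P (K `\` B)].
have F1 : Filter F.
  apply: Build_Filter.
  - by apply: Psub P0 => x [_ /(_ I)].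
  - move=> A B FA FB; apply: Psub (PU _ _ FA FB) => x [Kx nAB].
    have [Ax|nAx] := pselect (A x); last by left.
    by right; split=> // Bx; exact: nAB.
  - by move=> A B AB; apply: Psub => x [Kx nBx]; split=> // /AB.
have FF : ProperFilter F.
  by apply: Build_ProperFilter => FB; apply: nPK; apply: Psub FB => x Kx; split.
have FK : F K by apply: Psub P0 => x [Kx /(_ Kx)].
have [x [Kx /= clx]] := Kc F FF FK.
have [A Ax PA] := Kloc x Kx.
have FA : F (~` A) by apply: Psub PA => y [_ /contrapT].
by have [y [nAy Ay]] := clx _ _ FA Ax.
Qed.

End CompactInduction.

Section BoxCompact.
Context {R : realType} {N : nat}.
Local Notation C := R[i].
Local Notation Cn := 'rV[C]_N.

Definition square (a : C) (r : R) : set C :=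
  [set w | `|complex.Re w - complex.Re a| <= r /\ `|complex.Im w - complex.Im
    a| <= r].

Definition box (a : Cn) (r : R) : set Cn :=
  [set z | forall j, square (a 0 j) r (z 0 j)].

Lemma square_compact a r : compact (square a r).
Proof.
pose f (p : R * R) : C := p.1 +i* p.2.
have -> : square a r = f @` (`[complex.Re a - r, complex.Re a + r]%classic `*`
                            `[complex.Im a - r, complex.Im a + r]%classic).
  apply/seteqP; split=> [w [w1 w2]|_ [[x y] /= [x1 y1] <-]].
    exists (complex.Re w, complex.Im w); last by case: w {w1 w2}.
    by rewrite /= !in_itv /= -!ler_distl.
  by move: x1 y1; rewrite /= !in_itv /= -!ler_distl.
apply: continuous_compact; last by apply: compact_setX; exact: segment_compact.
apply: continuous_subspaceT => p; apply/contC; split => /=;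
  [exact: cvg_fst | exact: cvg_snd].
Qed.

Lemma box_compact a r : compact (box a r).
Proof.
by have := @rV_compact C N (fun j => square (a 0 j) r) (fun j =>
  @square_compact (a 0 j) r).
Qed.

Lemma nbhs_box (z : Cn) (O : set Cn) : nbhs z O ->
  exists2 r : R, 0 < r & box z r `<=` O.
Proof.
move=> /nbhs_rVP[e e0 eO]; exists (e / 3); first by rewrite divr_gt0.
move=> w wz; apply: eO => j; have [w1 w2] := wz j.
apply: le_lt_trans (cabs_le_ReIm _) _.
rewrite ReB ImB; move: w1 w2 e0; set u := `|_|; set v := `|_|; lra.
Qed.

Lemma box_nbhs (a z : Cn) (r s : R) : s < r -> box a s z -> nbhs z (box a r).
Proof.
move=> sr az; apply/nbhs_rVP; exists (r - s); first by rewrite subr_gt0.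
move=> w wz j; have [w1 w2] := az j; have := wz j.
move=> h; split.
  have := le_lt_trans (Re_cabs _) h; rewrite ReB => {}h.
  rewrite -(subrKA (complex.Re (z 0 j))) (le_trans (ler_normD _ _))//.
  by rewrite -(subrK s r) lerD// ltW.
have := le_lt_trans (Im_cabs _) h; rewrite ImB => {}h.
rewrite -(subrKA (complex.Im (z 0 j))) (le_trans (ler_normD _ _))//.
by rewrite -(subrK s r) lerD// ltW.
Qed.

End BoxCompact.

Section TestForms.
Context {R : realType} {N : nat}.
Local Notation C := R[i].
Local Notation Cn := 'rV[C]_N.
Local Notation E := (ealg R N).
Local Notation smooth := (@smooth_on R N setT).
Implicit Types (W K : set Cn) (f g : Cn -> C) (phi psi : Cn -> E).

Definition stest W f := smooth f /\
  exists K, [/\ compact K, K `<=` W & forall z, ~ K z -> f z = 0].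

Definition sform phi := forall A, smooth (fun z => (phi z : extalg R N) A).

Lemma sform_cst (a : E) : sform (fun=> a).
Proof. by move=> A; exact: smooth_cst. Qed.

Lemma sformD phi psi : sform phi -> sform psi -> sform (fun z => phi z + psi z).
Proof.
move=> h1 h2 A; under eq_fun do rewrite coefD.
exact: smoothD.
Qed.

Lemma sformZ f phi : smooth f -> sform phi -> sform (fun z => f z *: phi z).
Proof.
move=> h1 h2 A; under eq_fun do rewrite coefZ.
exact: smoothM.
Qed.

Lemma sformM phi psi : sform phi -> sform psi -> sform (fun z => phi z * psi z).
Proof.
move=> h1 h2 A.
have -> : (fun z => ((phi z * psi z : E) : extalg R N) A) =
    fun z => \sum_(B in powerset A) ((-1) ^+ inversions B (A :\: B)%SET *
      (phi z : extalg R N) B) * (psi z : extalg R N) (A :\: B)%SET.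
  by apply/funext => z; rewrite -ewedgeE ffunE.
apply: smooth_sum => B; apply: smoothM => //; apply: smoothM => //.
exact: smooth_cst.
Qed.

Lemma sformX phi k : sform phi -> sform (fun z => phi z ^+ k).
Proof.
move=> h; elim: k => [|k IH]; first by under eq_fun do rewrite expr0;
  exact: sform_cst.
by under eq_fun do rewrite exprS; exact: sformM.
Qed.

Lemma stestD W f g : stest W f -> stest W g -> stest W (fun z => f z + g z).
Proof.
move=> [fs [K [Kc KW fK]]] [gs [L [Lc LW gL]]]; split; first exact: smoothD.
exists (K `|` L); split; first exact: compactU.
  by move=> z [/KW|/LW].
by move=> z nKL; rewrite fK ?gL ?addr0// => h; apply: nKL; [right|left].
Qed.

Lemma stestM W f g : smooth f -> stest W g -> stest W (fun z => f z * g z).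
Proof.
move=> fs [gs [L [Lc LW gL]]]; split; first exact: smoothM.
by exists L; split=> // z /gL ->; rewrite mulr0.
Qed.

Lemma test_scale W f phi : stest W f -> sform phi -> test_form W (fun z =>
  f z *: phi z).
Proof.
move=> [fs [K [Kc KW fK]]] ps; split; first exact: sformZ.
by exists K; split=> // z /fK ->; exact: scale0r.
Qed.

Lemma test_form0 W : test_form W (fun=> 0 : extalg R N).
Proof.
split; first by move=> A; under eq_fun do rewrite ffunE; exact: smooth_cst.
exists set0; split=> //; exact: compact0.
Qed.

Lemma test_formZD W (a : C) (phi psi : dform R N) : test_form W phi ->
  test_form W psi ->
  test_form W (fun z => a *: phi z + psi z).
Proof.
move=> [h1 [K [Kc KW pK]]] [h2 [L [Lc LW pL]]]; split.
  by apply: (@sformD (fun z => a *: phi z) psi) => //; apply: sformZ => //;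
    exact: smooth_cst.
exists (K `|` L); split; first exact: compactU.
  by move=> z [/KW|/LW].
move=> z nKL; rewrite pK ?pL ?addr0//; last 2 first.
- by move=> h; apply: nKL; right.
- by move=> h; apply: nKL; left.
exact: scaler0.
Qed.

Lemma test_formE W phi psi : (forall z, phi z = psi z) -> test_form W phi ->
  test_form W psi.
Proof. by move=> h; rewrite (_ : phi = psi)//; exact/funext. Qed.

Lemma test_form_sum W (I : Type) (r : seq I) (F : I -> dform R N) :
  (forall i, test_form W (F i)) -> test_form W (fun z => \sum_(i <- r) F i z).
Proof.
move=> h; elim: r => [|i r IH].
  by under eq_fun do rewrite big_nil; exact: test_form0.
have -> : (fun z => \sum_(j <- i :: r) F j z) = (fun z =>
  1 *: F i z + \sum_(j <- r) F j z).
  by apply/funext => z; rewrite big_cons scale1r.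
exact: test_formZD.
Qed.

Section Linear.
Variables (W : set Cn) (T : dform R N -> C).
Hypothesis T_current : current W T.

Lemma currentZD a phi psi : test_form W phi -> test_form W psi ->
  T (fun z => a *: phi z + psi z) = a * T phi + T psi.
Proof. by have [h _] := T_current; exact: h. Qed.

Lemma current0 : T (fun=> 0) = 0.
Proof.
have t0 := test_form0 W; have := currentZD (-1) t0 t0.
rewrite (_ : (fun _ => _) = (fun=> 0)); last by apply/funext => z;
  rewrite scaler0 addr0.
by rewrite mulN1r addNr.
Qed.

Lemma currentZ a phi : test_form W phi -> T (fun z => a *: phi z) = a * T phi.
Proof.
move=> tp; have := currentZD a tp (test_form0 W).
rewrite (_ : (fun _ => _ + _) = (fun z => a *: phi z));
  last by apply/funext => z; rewrite addr0.
by rewrite current0 addr0.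
Qed.

Lemma currentD phi psi : test_form W phi -> test_form W psi ->
  T (fun z => phi z + psi z) = T phi + T psi.
Proof.
move=> tp ts; have := currentZD 1 tp ts.
rewrite (_ : (fun _ => _ + _) = (fun z => phi z + psi z));
  last by apply/funext => z; rewrite scale1r.
by rewrite mul1r.
Qed.

Lemma current_sum (I : Type) (r : seq I) (F : I -> dform R N) :
  (forall i, test_form W (F i)) -> T (fun z =>
    \sum_(i <- r) F i z) = \sum_(i <- r) T (F i).
Proof.
move=> h; elim: r => [|i r IH].
  rewrite big_nil (_ : (fun _ => _) = (fun=> 0)) ?current0//.
  by apply/funext => z; rewrite big_nil.
rewrite big_cons -IH -currentD//; last exact: test_form_sum.
by congr T; apply/funext => z; rewrite big_cons.
Qed.

End Linear.

Lemma stest_bump W (a : Cn) r : 0 < r -> box a r `<=` W -> stest W (fun z =>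
  (bump a r z)%:C).
Proof.
move=> r0 bW; split; first exact: bump_smooth.
exists (box a r); split=> //; first exact: box_compact.
move=> z nb; congr (_%:C); apply/eqP/negPn/negP => bz; apply: nb => j.
have /ltW h := bump_supp r0 bz j.
by split; rewrite -?ReB -?ImB (le_trans _ h)// ?Re_cabs ?Im_cabs.
Qed.

End TestForms.

(** * Collapse of compact sets onto the zero section *)

Section Squeeze.
Context {R : realType} {m n : nat}.
Local Notation C := R[i].
Local Notation Cn := 'rV[C]_(m + n).
Local Notation sq l := (scl (@dmu R m n l)).
Implicit Types (W K U : set Cn).

Lemma sq_comp (k l : R) (z : Cn) : sq k (sq l z) = sq (k * l) z.
Proof.
apply/rowP => j; rewrite !mxE /dmu; case: (fiber j); rewrite ?mul1r//.
by rewrite rmorphM mulrA.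
Qed.

Lemma sq1 (z : Cn) : sq 1 z = z.
Proof. by apply/rowP => j; rewrite !mxE /dmu; case: (fiber j);
  rewrite mul1r. Qed.

(** The factor 1/l contracts the fibre coordinates, so each point tends to its projection [sq 0 z];
    compactness makes the threshold for [l] uniform on [K]. *)
Lemma squeeze W K : compact K -> (forall z, K z -> nbhs (sq 0 z) W) ->
  exists2 r : R, 0 < r & forall l, r <= l -> forall z, K z -> W (sq l^-1 z).
Proof.
move=> Kc KW; pose P A := exists2 r : R, 0 < r & forall l, r <= l ->
  forall z, A z -> W (sq l^-1 z).
apply: (@compact_ind _ P) Kc _.
- by exists 1.
- by move=> A B AB [r r0 h]; exists r => // l rl z /AB; exact: h.
- move=> A B [r r0 hA] [s s0 hB]; exists (r + s); first exact: addr_gt0.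
  move=> l rsl z [Az|Bz]; [apply: hA | apply: hB] => //; apply: le_trans rsl.
    by rewrite lerDl ltW.
  by rewrite lerDr ltW.
move=> z0 /KW /nbhs_rVP[e e0 eW].
pose M := 1 + \sum_j cabs (z0 0 j); have M1 : 1 <= M.
  by rewrite lerDl; apply: sumr_ge0 => j _; exact: cabs_ge0.
have M0 : 0 < M by exact: lt_le_trans M1.
pose d := Num.min 1 e; have d0 : 0 < d by rewrite lt_min ltr01.
exists [set w : Cn | forall j, cabs (w 0 j - z0 0 j) < d].
  by apply/nbhs_rVP; exists d.
(* Near [z0] all coordinates have modulus below 1 + M, so division by such an [l] brings the fibre
   coordinates below [e]. *)
exists ((1 + M) / e); first by rewrite divr_gt0// addr_gt0.
move=> l lr w wz; apply: eW => j; rewrite !mxE /dmu; have wj := wz j.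
have l0 : 0 < l by apply: lt_le_trans lr; rewrite divr_gt0// addr_gt0.
case: (fiber j); last by rewrite !mul1r (lt_le_trans wj)// ge_min lexx orbT.
rewrite mul0r subr0 cabsM cabsR gtr0_norm ?invr_gt0// mulrC ltr_pdivrMr//.
have wM : cabs (w 0 j) < 1 + M.
  rewrite -(subrK (z0 0 j) (w 0 j)) (le_lt_trans (cabsD _ _))//.
  apply: ltr_leD; first by rewrite (lt_le_trans wj)// ge_min lexx.
  rewrite (le_trans (_ : _ <= \sum_j cabs (z0 0 j)))//; last by rewrite lerDr.
  rewrite (bigD1 j)//= lerDl; apply: sumr_ge0 => k _; exact: cabs_ge0.
apply: lt_le_trans wM _; rewrite mulrC -ler_pdivrMr//.
Qed.

Definition pull (l : R) (phi : dform R (m + n)) : dform R (m + n) :=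
  fun z => sclmap (dmu l) (phi (sq l z)).

Lemma pullbackE l phi : pullback (dilation l%:C) phi = pull l phi.
Proof. by apply/funext => z; exact: pullback_dilation. Qed.

Lemma normal_bundleE U : normal_bundle (zero_section U) = [set z | U (sq 0 z)].
Proof.
apply/funext => z; rewrite /normal_bundle /zero_section /=; congr U.
apply/rowP => j; rewrite !mxE /dmu /fiber;
  case: (fintype.split_ordP j) => i -> /=.
  by rewrite mxE mul1r.
by rewrite mxE mul0r.
Qed.

Lemma pull_supp l (phi : dform R (m + n)) K z : l != 0 -> supported_in K phi ->
  ~ (sq l^-1 @` K) z -> pull l phi z = 0.
Proof.
move=> l0 pK nz; rewrite /pull pK; first by rewrite /sclmap /monmap gmap0.
move=> Kz; apply: nz; exists (sq l z) => //.
by rewrite sq_comp mulVf// sq1.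
Qed.

Lemma pull_sform l (phi : dform R (m + n)) : sform phi -> sform (pull l phi).
Proof.
move=> ps A; under eq_fun do rewrite sclmapA.
apply: smoothM; first exact: smooth_cst.
exact: (smooth_scl (dmu l) (ps A)).
Qed.

Lemma pull_test U l (phi : dform R (m + n)) K : l != 0 -> compact K ->
  (forall A, smooth_on setT (fun z => phi z A)) -> supported_in K phi ->
  (forall z, K z -> U (sq l^-1 z)) -> test_form U (pull l phi).
Proof.
move=> l0 Kc ps pK KU; split; first exact: pull_sform.
exists (sq l^-1 @` K); split.
- apply: continuous_compact => //; apply: continuous_subspaceT;
  exact: scl_continuous.
- by move=> _ [z /KU Uz <-].
- by move=> z; exact: pull_supp.
Qed.

End Squeeze.

(** * Uniform bounds for the dilated currents *)

Section NearInfinity.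
Context {R : realType}.
Local Notation C := R[i].

Lemma near_pinfty_ge (r : R) (P : R -> Prop) : (forall l, r <= l -> P l) ->
  \forall l \near +oo, P l.
Proof. by move=> h; exists r; split; [exact: num_real | move=> x /ltW;
  exact: h]. Qed.

Lemma near_pinfty_le (r : R) : \forall l \near +oo, r <= l.
Proof. exact: (@near_pinfty_ge r (fun l => r <= l)). Qed.

Lemma near_pinfty_gt0 : \forall l \near +oo, 0 < (l : R).
Proof. by exists 0; split; [exact: num_real | ]. Qed.

Lemma near_pinfty_forall (I : finType) (F : I -> R -> Prop) :
  (forall i, \forall l \near +oo, F i l) ->
    \forall l \near +oo, forall i, F i l.
Proof. by move=> h; apply: filter_forall. Qed.

Lemma cabs_le_ge0 (x y : C) : 0 <= x -> x <= y -> cabs x <= cabs y.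
Proof.
move=> x0 xy; have y0 : 0 <= y by exact: le_trans xy.
by rewrite -lecR -!normC_cabs !ger0_norm.
Qed.

Lemma cabs_le_between (x y : C) : 0 <= y + x -> 0 <= y - x -> cabs x <= cabs y.
Proof.
move=> h1 h2.
have y0 : 0 <= y.
  have := addr_ge0 h1 h2; rewrite addrACA subrr addr0 -mulr2n.
  by rewrite -mulr_natr pmulr_lge0 ?ltr0n.
have xr : x \is Num.real.
  rewrite -(addrK y x) rpredB//; last exact: ger0_real.
  by apply: ger0_real; rewrite addrC.
rewrite -lecR -!normC_cabs (ger0_norm y0) real_ler_norml//.
by apply/andP; split; rewrite -subr_ge0 ?opprK // addrC.
Qed.

End NearInfinity.

Section Bidegree.
Context {R : realType} {N : nat}.
Local Notation E := (ealg R N).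

Lemma card_holo (A : {set 'I_(N + N)}) :
  #|[set j : 'I_N | lshift N j \in A]%SET| = #|(A :&: holo)%SET|.
Proof.
rewrite -(card_imset _ (@lshift_inj N N)); apply: eq_card => x.
rewrite !inE; apply/imsetP/andP => [[j]|[xA /imsetP[j _ xj]]].
  by rewrite inE => jA ->; split=> //; exact: imset_f.
by exists j => //; rewrite inE -xj.
Qed.

Lemma card_antiholo (A : {set 'I_(N + N)}) :
  #|[set j : 'I_N | rshift N j \in A]%SET| = #|(A :&: antiholo)%SET|.
Proof.
rewrite -(card_imset _ (@rshift_inj N N)); apply: eq_card => x.
rewrite !inE; apply/imsetP/andP => [[j]|[xA /imsetP[j _ xj]]].
  by rewrite inE => jA ->; split=> //; exact: imset_f.
by exists j => //; rewrite inE -xj.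
Qed.

Lemma bidegree_ebas (k : R[i]) (A : {set 'I_(N + N)}) :
  has_bidegree #|(A :&: holo)%SET| #|(A :&: antiholo)%SET| (k *: (ebas A : E)).
Proof.
move=> B; rewrite coefZ ffunE card_holo card_antiholo.
by case: (eqVneq B A) => [->//|_]; rewrite mulr0 eqxx.
Qed.

Lemma bidegree_sclmap (mu : 'I_N -> R) a b (x : E) :
  has_bidegree a b x -> has_bidegree a b (sclmap mu x).
Proof.
move=> h A; rewrite sclmapA => nz; apply: h.
by apply: contraNneq nz => ->; rewrite mulr0.
Qed.

End Bidegree.

Section MainBound.
Context {R : realType} {m n p : nat}.
Local Notation C := R[i].
Local Notation Cn := 'rV[C]_(m + n).
Local Notation E := (ealg R (m + n)).
Local Notation smooth := (@smooth_on R (m + n) setT).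
Local Notation sq l := (scl (@dmu R m n l)).
Variables (U : set Cn) (T : dform R (m + n) -> C).
Hypotheses (p_le : (p <= m + n)%N) (U_open : open U).
Hypothesis T_pc : positive_closed p U T.
Hypothesis T_mass : forall i : nat,
  (maxn (n - p) 0 <= i <= minn (m + n - p) n)%N ->
  exists r : R, 0 < r /\
    loc_unif_bounded_mass [set lambda : R[i] | r <= cabs lambda] U
      (fun lambda =>
         cwedge (cwedge T (TT lambda^-1 i))
                (pullback lsubmx (wedge_pow omegaV (m + n - p - i)))).

Local Notation q := (m + n - p)%N.
Local Notation Eb := (normal_bundle (zero_section U)).
Local Notation Tl l phi := (T (pull l phi)).

Let T_cur : current U T. Proof. by have [[]] := T_pc. Qed.

Lemma Eb_nbhs z : Eb z -> nbhs (sq 0 z) U.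
Proof. by rewrite normal_bundleE => Uz; exact: open_nbhs_nbhs. Qed.

(** The threshold for [l] depends on the support [K] alone, so it serves all forms supported there
    at once. *)
Lemma pull_near_test K : compact K -> K `<=` Eb -> \forall l \near +oo, 0 < l /\
  forall phi : dform R (m + n), (forall A, smooth (fun z => phi z A)) ->
    supported_in K phi -> test_form U (pull l phi).
Proof.
move=> Kc KE; have [r r0 h] := squeeze Kc (fun z Kz => Eb_nbhs (KE z Kz)).
apply: (@near_pinfty_ge _ r) => l rl; have l0 := lt_le_trans r0 rl;
  split=> // phi ps pK.
by apply: (pull_test (lt0r_neq0 l0) Kc ps pK) => z; exact: h.
Qed.

Lemma test_near phi : test_form Eb phi ->
  \forall l \near +oo, 0 < l /\ test_form U (pull l phi).
Proof.
move=> [ps [K [Kc KE pK]]].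
by apply: filterS (pull_near_test Kc KE) => l [l0 h]; split=> //; exact: h.
Qed.

(** For [i] in the range of the hypothesis this unfolds the definition of mass at the point
    [sq 0 z0] of V. Otherwise one power is zero: i < n - p forces q - i > m, which kills the power
    of [omV], and i > n kills that of [ttform]. *)
Lemma local_mass (z0 : Cn) (i : nat) : Eb z0 -> (i <= q)%N ->
  exists2 W : set Cn, nbhs (sq 0 z0) W & exists C0 : R,
  \forall l \near +oo, forall g : Cn -> C, stest W g ->
    (forall z, cabs (g z) <= 1) ->
  cabs (T (fun z => ttform l%:C^-1 z ^+ i * (omV ^+ (q - i) * (g z *: 1)) :
    E)) <= C0.
Proof.
move=> Ez0 iq.
have [iR|] := boolP (maxn (n - p) 0 <= i <= minn q n)%N; last first.
  move=> iR; exists setT; first exact: filterT.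
  exists 0; near=> l => g _ _.
  rewrite (_ : (fun z => _) = (fun=> 0));
    first by rewrite (current0 T_cur) cabs0.
  apply/funext => z; move: iR;
    rewrite maxn0 leq_min iq /= negb_and -!ltnNge => /orP[h|h].
    rewrite omV_vanish ?mul0r ?mulr0//.
    by move: h p_le iq; lia.
  by rewrite ttform_vanish// mul0r.
have [r [r0 /(_ (sq 0 z0))]] := T_mass iR.
have Uz0 : U (sq 0 z0) by move: Ez0; rewrite normal_bundleE.
move=> /(_ Uz0)[W [Wo Wz WU [C0 hC]]]; exists W; first exact: open_nbhs_nbhs.
exists C0; near=> l => g [gs [K [Kc KW gK]]] g1.
have l0 : 0 < l by near: l; exact: near_pinfty_gt0.
have rl : r <= cabs l%:C.
  by rewrite cabsR gtr0_norm//; near: l; exact: near_pinfty_le.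
have := hC _ rl; rewrite /mass => /(le_trans _) h.
rewrite -lee_fin; apply: h; apply: ereal_sup_ubound; exists g => /=.
  split=> //; split; first by move=> A; under eq_fun do rewrite coefZ;
    apply: smoothM => //; exact: smooth_cst.
  by exists K; split=> // z /gK; rewrite /form0 => ->; exact: scale0r.
rewrite /cwedge /dwedge; congr ((cabs (T _))%:E); apply/funext => z.
rewrite pullback_omegaV TTE// invr_eq0.
by rewrite eq_complex /= eqxx andbT gt_eqF.
Unshelve. all: by end_near. Qed.

Lemma pullZD l (a : C) (phi psi : dform R (m + n)) :
  pull l (fun z => a *: phi z + psi z) = fun z =>
    a *: pull l phi z + pull l psi z.
Proof. by apply/funext => z; rewrite /pull /sclmap monmapD monmapZ. Qed.

Lemma pull_scale l (f : Cn -> C) (phi : dform R (m + n)) :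
  pull l (fun z => f z *: phi z) = fun z => f (sq l z) *: pull l phi z.
Proof. by apply/funext => z; rewrite /pull /sclmap monmapZ. Qed.

(** The binomial formula applies because [omV] is central. Dilation turns theta = 1 into theta =
    1/l, so the terms are exactly the forms of the mass hypothesis. *)
Lemma pull_omE l k z : l != 0 ->
  pull l (fun z => omE z ^+ k) z = \sum_(i < k.+1) ('C(k, i))%:R *:
    ((ttform l%:C^-1 z ^+ i * omV ^+ (k - i)) : E).
Proof.
move=> l0; rewrite /pull /sclmap monmapX// /omE monmapD -!/(sclmap _ _).
rewrite ttform_scl// omV_scl addrC exprDn_comm; last exact: omV_comm.
apply: eq_bigr => i _; rewrite [RHS]scaler_nat; congr (_ *+ _).
have h : GRing.comm (omV ^+ (k - i)) (ttform l%:C^-1 z ^+ i).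
  by apply: commrX; apply: commr_sym; apply: commrX; apply: commr_sym;
    exact: omV_comm.
exact: h.
Qed.

Lemma stest_sq W K l (g : Cn -> C) : l != 0 -> smooth g -> compact K ->
  (forall z, ~ K z -> g z = 0) -> (forall z, K z -> W (sq l^-1 z)) ->
  stest W (fun z => g (sq l z)).
Proof.
move=> l0 gs Kc gK KW; split; first exact: smooth_scl.
exists (sq l^-1 @` K); split.
- by apply: continuous_compact => //; apply: continuous_subspaceT;
  exact: scl_continuous.
- by move=> _ [z /KW Wz <-].
- move=> z nz; apply: gK => Kz; apply: nz; exists (sq l z) => //.
  by rewrite sq_comp mulVf// sq1.
Qed.

Lemma bump_le1 (a : Cn) (r : R) z : cabs (bump a r z)%:C <= 1.
Proof.
rewrite cabsR ger0_norm ?bump_ge0// /bump /gexp; case: ifP => // t0.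
by rewrite hornerE mul1r expR_le1 oppr_le0 invr_ge0 ltW.
Qed.

Lemma bump_out (a : Cn) (r : R) z : 0 < r -> ~ box a r z ->
  (bump a r z)%:C = 0 :> C.
Proof.
move=> r0; have [_ [K [_ KW h]]] := stest_bump r0 (@subset_refl _ (box a r)).
by move=> nb; apply: h => /KW.
Qed.

Lemma nbhs_rV_forall (I : finType) (f : I -> set Cn) (z : Cn) :
  (forall i, nbhs z (f i)) -> nbhs z [set w | forall i, f i w].
Proof. exact: (@filter_forall Cn I f (nbhs z) (nbhs_filter z)). Qed.

Lemma nbhs_collapse (W : set Cn) (z : Cn) :
  nbhs (sq 0 z) W -> nbhs z [set w | nbhs (sq 0 w) W].
Proof.
move=> /nbhs_rVP[e e0 eW]; apply/nbhs_rVP; exists (e / 2);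
  first by rewrite divr_gt0.
move=> w wz; apply/nbhs_rVP; exists (e / 2); first by rewrite divr_gt0.
move=> v vw; apply: eW => j;
  rewrite -(subrKA (sq 0 w 0 j)) (le_lt_trans (cabsD _ _))//.
rewrite (splitr e) ltrD// (le_lt_trans _ (wz j))// !mxE /dmu.
by case: (fiber j); rewrite ?mul1r// !mul0r subrr cabs0 cabs_ge0.
Qed.

Definition om_bump (z0 : Cn) (r : R) : dform R (m + n) :=
  fun z => (bump z0 r z)%:C *: (omE z ^+ q : E).

(** The box is taken so small that its projection lies inside all [q.+1] neighbourhoods given by
    [local_mass]. For large [l] the bump composed with the dilation is then a function of modulus at
    most 1 supported in each of them, and the [q.+1] bounds add up with binomial weights. *)
Lemma om_bound (z0 : Cn) : Eb z0 -> exists r : R, [/\ 0 < r, box z0 r `<=` Eb &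
  exists C0 : R, \forall l \near +oo,
    cabs (Tl l (om_bump z0 r)) <= C0].
Proof.
move=> Ez0.
have /choice[W hW] : forall i : 'I_q.+1, exists W : set Cn,
  nbhs (sq 0 z0) W /\ exists C0 : R,
    \forall l \near +oo, forall g : Cn -> C, stest W g ->
      (forall z, cabs (g z) <= 1) ->
    cabs (T (fun z => ttform l%:C^-1 z ^+ i * (omV ^+ (q - i) * (g z *: 1)) :
      E)) <= C0.
  by move=> i; have [W h1 h2] := local_mass Ez0 (ltn_ord i : (i <= q)%N);
    exists W.
have Onb : nbhs z0 (Eb `&` [set z | forall i, nbhs (sq 0 z) (W i)]).
  apply: filterI; last by apply: nbhs_rV_forall => i;
    exact: (nbhs_collapse (hW i).1).
  have := nbhs_collapse (Eb_nbhs Ez0); apply: filterS => z h.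
  by rewrite normal_bundleE; exact: nbhs_singleton h.
have [r r0 bO] := nbhs_box Onb.
have bE : box z0 r `<=` Eb by move=> z /bO[].
exists r; split=> //.
have /choice[C0 hC] : forall i : 'I_q.+1, exists C0 : R,
    \forall l \near +oo, forall g : Cn -> C, stest (W i) g ->
      (forall z, cabs (g z) <= 1) ->
    cabs (T (fun z => ttform l%:C^-1 z ^+ i * (omV ^+ (q - i) * (g z *: 1)) :
      E)) <= C0.
  by move=> i; exact: (hW i).2.
exists (\sum_(i < q.+1) ('C(q, i))%:R * C0 i).
have sqW : \forall l \near +oo, forall i z, box z0 r z -> W i (sq l^-1 z).
  apply: (@near_pinfty_forall _ _ (fun (i : 'I_q.+1) l =>
    forall z, box z0 r z -> W i (sq l^-1 z))) => i.
  have [s s0 h] := @squeeze R m n (W i) _ (@box_compact R _ z0 r) (fun z bz =>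
    (bO z bz).2 i).
  exact: (near_pinfty_ge h).
have hC' : \forall l \near +oo, forall i : 'I_q.+1, forall g : Cn ->
  C, stest (W i) g -> (forall z, cabs (g z) <= 1) ->
    cabs (T (fun z => ttform l%:C^-1 z ^+ i * (omV ^+ (q - i) * (g z *: 1)) :
      E)) <= C0 i.
  exact: (@near_pinfty_forall _ _ (fun (i : 'I_q.+1) l =>
    forall g : Cn -> C, stest (W i) g ->
    (forall z, cabs (g z) <= 1) ->
    cabs (T (fun z => ttform l%:C^-1 z ^+ i * (omV ^+ (q - i) * (g z *: 1)) :
      E)) <= C0 i)).
have [sU _ hU] := squeeze (@box_compact R _ z0 r) (fun z bz =>
  Eb_nbhs (bE z bz)).
near=> l.
have l0 : 0 < l by near: l; exact: near_pinfty_gt0.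
have ln0 := lt0r_neq0 l0.
have li0 : l%:C^-1 != 0 :> C by rewrite invr_eq0 eq_complex /= eqxx andbT.
pose g z := (bump z0 r (sq l z))%:C.
have gU : stest U g.
  apply: (stest_sq ln0 (bump_smooth z0 r) (@box_compact R _ z0 r)).
    by move=> z; exact: bump_out.
  by move=> z; apply: hU; near: l; exact: near_pinfty_le.
rewrite (_ : pull l _ = fun z => \sum_(i < q.+1) ('C(q, i))%:R *:
    ((ttform l%:C^-1 z ^+ i * (omV ^+ (q - i) * (g z *: 1))) : E)); last first.
  rewrite /om_bump pull_scale; apply/funext => z;
    rewrite pull_omE// scaler_sumr.
  apply: eq_bigr => i _.
  have Z (A : algType C) (k c : C) (a b : A) :
      k *: (c *: (a * b)) = c *: (a * (b * (k *: 1))).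
    by rewrite -scalerAr mulr1 -scalerAr !scalerA mulrC.
  exact: (Z E (g z)).
have tt i : test_form U (fun z =>
  (ttform l%:C^-1 z ^+ i * (omV ^+ (q - i) * (g z *: 1))) : E).
  apply: (test_formE (phi := fun z =>
    g z *: (ttform l%:C^-1 z ^+ i * omV ^+ (q - i) : E))).
    move=> z; have Z (A : algType C) (k : C) (a b : A) :
      k *: (a * b) = a * (b * (k *: 1)).
      by rewrite -scalerAr mulr1 -scalerAr.
    exact: Z.
  apply: test_scale => //; apply: sformM; last exact: sform_cst.
  by apply: sformX => A; exact: ttform_smooth.
rewrite (current_sum T_cur) => [|i]; last first.
  apply: (test_formE _ (test_formZD ('C(q, i))%:R (tt i) (test_form0 U))) => z.
  exact: addr0.
apply: le_trans (cabs_sum _ _ _) _; apply: ler_sum => i _.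
rewrite (currentZ T_cur)// cabsM (_ : cabs _ = ('C(q, i))%:R); last first.
  by rewrite /cabs normr_nat -(rmorph_nat (real_complex R)).
rewrite ler_wpM2l//.
have hl : forall i : 'I_q.+1, forall g : Cn -> C, stest (W i) g ->
  (forall z, cabs (g z) <= 1) ->
    cabs (T (fun z => ttform l%:C^-1 z ^+ i * (omV ^+ (q - i) * (g z *: 1)) :
      E)) <= C0 i.
  by near: l.
apply: hl => [|z]; last exact: bump_le1.
apply: (stest_sq ln0 (bump_smooth z0 r) (@box_compact R _ z0 r)).
  by move=> z; exact: bump_out.
have hs : forall i z, box z0 r z -> W i (sq l^-1 z) by near: l.
by move=> z; exact: hs.
Unshelve. all: by end_near. Qed.

Lemma TlZ l (a : C) (phi : dform R (m + n)) : test_form U (pull l phi) ->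
  Tl l (fun z => a *: phi z) = a * Tl l phi.
Proof.
move=> h; rewrite -(currentZ T_cur)//; congr T.
by apply/funext => z; rewrite /pull /sclmap monmapZ.
Qed.

Lemma TlD l (phi psi : dform R (m + n)) : test_form U (pull l phi) ->
  test_form U (pull l psi) -> Tl l (fun z =>
    phi z + psi z) = Tl l phi + Tl l psi.
Proof.
move=> h1 h2; rewrite -(currentD T_cur)//; congr T.
by apply/funext => z; rewrite /pull /sclmap monmapD.
Qed.

Lemma Tl_sum l (I : Type) (r : seq I) (F : I -> dform R (m + n)) :
  (forall i, test_form U (pull l (F i))) ->
  Tl l (fun z => \sum_(i <- r) F i z) = \sum_(i <- r) Tl l (F i).
Proof.
move=> h; rewrite -(current_sum T_cur)//; congr T.
by apply/funext => z; rewrite /pull /sclmap monmap_sum.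
Qed.

Lemma Tl_ge0 l (phi : dform R (m + n)) : test_form U (pull l phi) ->
  (forall z, strongly_positive q (phi z)) -> 0 <= Tl l phi.
Proof.
move=> h hp; have [_ Tp _] := T_pc; apply: Tp => // z.
exact: sclmap_pos.
Qed.

Lemma box_fiber_bound (z0 : Cn) (r : R) : 0 < r -> exists2 M : R, 0 <= M &
  forall z, box z0 r z -> norm2 (rsubmx z) <= M.
Proof.
(* A box bounds real and imaginary parts separately by [r], hence the modulus of a difference by r +
   r. *)
move=> r0; exists (\sum_(j < n) (cabs (z0 0 (rshift m j)) + (r + r)) ^+ 2).
  by apply: sumr_ge0 => j _; exact: sqr_ge0.
move=> z bz; apply: ler_sum => j _; rewrite mxE.
have r20 : 0 <= cabs (z0 0 (rshift m j)) + (r +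
  r) by rewrite !addr_ge0 ?cabs_ge0 ?ltW.
rewrite ler_pXn2r ?nnegrE ?cabs_ge0//.
rewrite -(subrK (z0 0 (rshift m j)) (z 0 (rshift m j))) (le_trans (cabsD _
  _))//.
rewrite addrC lerD2l (le_trans (cabs_le_ReIm _))//.
have [h1 h2] := bz (rshift m j).
by rewrite ReB ImB lerD.
Qed.

Lemma eprod_pos (s : seq Cn) : size s = q -> cone (fun x : C =>
  0 <= x) q (eprod s).
Proof. by move=> sq; rewrite -[eprod s]scale1r; apply: cone_eprod => //;
  exact: ler01. Qed.

Lemma test_pullZ l (a : C) (phi : dform R (m + n)) : test_form U (pull l phi) ->
  test_form U (pull l (fun z => a *: phi z)).
Proof.
move=> h; apply: (test_formE _ (test_formZD a h (test_form0 U))) => z.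
by rewrite addr0 /pull /sclmap monmapZ.
Qed.

Lemma test_pullD l (phi psi : dform R (m + n)) : test_form U (pull l phi) ->
  test_form U (pull l psi) -> test_form U (pull l (fun z => phi z + psi z)).
Proof.
move=> h1 h2; apply: (test_formE _ (test_formZD 1 h1 h2)) => z.
by rewrite scale1r /pull /sclmap monmapD.
Qed.

Lemma Tl_dominated (phi psi : dform R (m + n)) (K C0 : R) :
  test_form Eb phi -> test_form Eb psi -> 0 <= K ->
  (forall z, strongly_positive q (phi z)) ->
  (forall z, strongly_positive q (K%:C *: psi z + (-1) *: phi z)) ->
  (\forall l \near +oo, cabs (Tl l psi) <= C0) ->
  \forall l \near +oo, cabs (Tl l phi) <= K * C0.
Proof.
move=> tphi tpsi K0 phi0 dom hC.
have t1 := test_near tphi; have t2 := test_near tpsi.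
near=> l.
have [_ tl] : 0 < l /\ test_form U (pull l phi) by near: l; exact: t1.
have [_ sl] : 0 < l /\ test_form U (pull l psi) by near: l; exact: t2.
have hl : cabs (Tl l psi) <= C0 by near: l; exact: hC.
have kl := test_pullZ K%:C sl; have ml := test_pullZ (-1) tl.
have e1 := Tl_ge0 tl phi0.
have e2 : Tl l phi <= K%:C * Tl l psi.
  rewrite -subr_ge0 -mulN1r -(TlZ K%:C sl) -(TlZ (-1) tl).
  apply: le_trans (Tl_ge0 (test_pullD kl ml) dom) _.
  by rewrite le_eqVlt; apply/orP; left; apply/eqP; exact: TlD.
apply: le_trans (cabs_le_ge0 e1 e2) _.
by rewrite cabsM cabsR (ger0_norm K0) ler_wpM2l.
Unshelve. all: by end_near. Qed.

(** On the box, [lagrange] and [omE_lower] bound [epos1 al] by [norm2 al] times [ebeta], hence by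
    [norm2 al / e] times [omE]; [pos_eprod_le] multiplies these bounds. Off the box the bump
    vanishes. *)
Lemma eprod_bound_bump (z0 : Cn) (r : R) (s : seq Cn) : 0 < r ->
  box z0 r `<=` Eb ->
  size s = q ->
  (exists C0 : R, \forall l \near +oo,
    cabs (Tl l (om_bump z0 r)) <= C0) ->
  exists C0 : R, \forall l \near +oo,
    cabs (Tl l (fun z => (bump z0 r z)%:C *: eprod s)) <= C0.
Proof.
move=> r0 bE sizes [C0 hC].
have [M M0 bM] := box_fiber_bound z0 r0.
have [e e0 he] := @omE_lower R m n M M0.
have n20 (al : Cn) : 0 <= norm2 al / e.
  by rewrite divr_ge0 ?(ltW e0)//; apply: sumr_ge0 => j _; exact: sqr_ge0.
pose K : R := \prod_(al <- s) (norm2 al / e).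
have K0 : 0 <= K by apply: prodr_ge0.
have chi := stest_bump r0 bE.
exists (K * C0); apply: Tl_dominated hC => //.
- by apply: test_scale => //; exact: sform_cst.
- apply: test_scale => //; apply: sformX; apply: sformD; last exact: sform_cst.
  by move=> A; apply: ttform_smooth; exact: oner_neq0.
- move=> z; apply/strongly_positiveP; apply: coneZ.
  + exact: mulr_ge0.
  + by rewrite lecR bump_ge0.
  + exact: eprod_pos.
move=> z; apply/strongly_positiveP.
have Z1 (V : lmodType C) (b k : C) (x y : V) :
  k *: (b *: x) + (-1) *: (b *: y) = b *: (k *: x - y).
  by rewrite scalerBr !scalerA mulrC mulN1r scaleNr.
rewrite (Z1 E).
have [bz|nbz] := pselect (box z0 r z); last first.
  by rewrite (bump_out r0 nbz) (_ : _ *: _ = 0);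
    [exact: cone0 | exact: scale0r].
apply: coneZ; [exact: mulr_ge0 | by rewrite lecR bump_ge0 |].
rewrite -sizes; have ->
  : K%:C = \prod_(al <- s) (norm2 al / e)%:C by rewrite rmorph_prod.
apply: (pos_eprod_le (D := fun al => (norm2 al / e)%:C)).
- exact: omE_pos.
- by move=> al; rewrite lecR.
move=> al.
have Z (V : lmodType C) (o b a : V) : (norm2 al / e)%:C *: o - a =
   (norm2 al / e)%:C *: (o - e%:C *: b) + ((norm2 al)%:C *: b - a).
  rewrite scalerBr scalerA -rmorphM divfK ?gt_eqF//.
  by rewrite addrA subrK.
rewrite (Z E _ ebeta); apply: coneD; last exact: lagrange.
by apply: coneZ; [exact: mulr_ge0 | rewrite lecR | apply: he; exact: bM].
Qed.

Lemma eprod_bound_near (z0 : Cn) : Eb z0 ->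
  exists r : R, [/\ 0 < r, box z0 r `<=` Eb &
  forall s, size s = q -> exists C0 : R, \forall l \near +oo,
    cabs (Tl l (fun z => (bump z0 r z)%:C *: eprod s)) <= C0].
Proof.
move=> Ez0; have [r [r0 bE hr]] := om_bound Ez0.
exists r; split; [exact: r0 | exact: bE | move=> s sizes].
exact: (eprod_bound_bump r0 bE sizes hr).
Qed.

End MainBound.

(** * Bounds by the sup norm of the coefficients on a compact set *)

Section UniformBound.
Context {R : realType} {m n p : nat}.
Local Notation C := R[i].
Local Notation Cn := 'rV[C]_(m + n).
Local Notation E := (ealg R (m + n)).
Local Notation smooth := (@smooth_on R (m + n) setT).
Variables (U : set Cn) (T : dform R (m + n) -> C).
Local Notation q := (m + n - p)%N.
Local Notation Eb := (normal_bundle (zero_section U)).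
Local Notation Tl l phi := (T (pull l phi)).
Hypotheses (U_open : open U) (T_pc : positive_closed p U T).
Hypothesis T_loc : forall z0, Eb z0 ->
  exists r : R, [/\ 0 < r, box z0 r `<=` Eb &
  forall s, size s = q -> exists C0 : R, \forall l \near +oo,
    cabs (Tl l (fun z => (bump z0 r z)%:C *: eprod s)) <= C0].

Lemma pull_near_stest f (a : E) : stest Eb f -> \forall l \near +oo,
  0 < l /\ test_form U (pull l (fun z => f z *: a)).
Proof.
by move=> fs; apply: (test_near U_open); apply: test_scale => //;
  exact: sform_cst.
Qed.

(** A majorant [u] replaces a partition of unity: for domination it is enough that [u] be
    nonnegative, at least 1 on [K], and of controlled mass, and these properties survive sums. *)
Lemma cover_bound (K : set Cn) : compact K -> K `<=` Eb -> exists u : Cn -> R,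
  [/\ stest Eb (fun z => (u z)%:C), forall z, 0 <= u z, forall z, K z ->
    1 <= u z &
   forall s, size s = q -> exists C0 : R, \forall l \near +oo,
    cabs (Tl l (fun z => (u z)%:C *: eprod s)) <= C0].
Proof.
move=> Kc KE; pose P (A : set Cn) := exists u : Cn -> R,
  [/\ stest Eb (fun z => (u z)%:C), forall z, 0 <= u z, forall z, A z ->
    1 <= u z &
   forall s, size s = q -> exists C0 : R, \forall l \near +oo,
    cabs (Tl l (fun z => (u z)%:C *: eprod s)) <= C0].
apply: (@compact_ind _ P) Kc _.
- exists (fun=> 0); split=> //.
    by split; [exact: smooth_cst | exists set0; split=> //; exact: compact0].
  move=> s _; exists 0; near=> l.
  have [[Tcur _] _ _] := T_pc.
  rewrite (_ : pull l _ = fun=> 0) ?(current0 Tcur) ?cabs0//.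
  apply/funext => z; rewrite /pull (_ : _ *: _ = 0); last exact: scale0r.
  by rewrite /sclmap /monmap gmap0.
- by move=> A B AB [u [h1 h2 h3 h4]]; exists u; split=> // z /AB; exact: h3.
- move=> A B [u [h1 h2 h3 h4]] [v [k1 k2 k3 k4]]; exists (fun z => u z + v z);
  split.
  + have := stestD h1 k1.
    by rewrite (_ : (fun z => _ + _) = fun z => (u z + v z)%:C)//;
      apply/funext => z; rewrite rmorphD.
  + by move=> z; exact: addr_ge0.
  + by move=> z [/h3 uz|/k3 vz];
    [rewrite -[1]addr0 lerD | rewrite -[1]add0r lerD].
  + move=> s sizes; have [C1 hC1] := h4 s sizes; have [C2 hC2] := k4 s sizes.
    have t1 := pull_near_stest (eprod s) h1;
      have t2 := pull_near_stest (eprod s) k1.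
    exists (C1 + C2).
    apply: filterS (filterI (filterI t1 t2) (filterI hC1 hC2)) =>
      l [[[_ tl] [_ sl]] [hl1 hl2]].
    rewrite (_ : (fun z => _) = (fun z =>
      (u z)%:C *: eprod s + (v z)%:C *: eprod s)); last first.
      have Z (V : lmodType C) (x y : R) (e : V) :
        (x + y)%:C *: e = x%:C *: e + y%:C *: e.
        by rewrite rmorphD scalerDl.
      by apply/funext => z; exact: (Z E).
    rewrite (TlD T_pc tl sl) (le_trans (cabsD _ _))//.
    exact: lerD.
move=> z0 /KE /T_loc[r [r0 bE hr]].
pose c := bump z0 r z0; have c0 : 0 < c by exact: bump_gt0.
have chi := stest_bump r0 bE.
exists [set z | cabs ((bump z0 r z)%:C - c%:C) < c / 2].
  have c20 : 0 < c / 2 by rewrite divr_gt0.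
  exact: (@cvgCP R _ _ (nbhs_filter z0) _ _).1 (smooth_cont (bump_smooth z0 r)
    (x:=z0)) _ c20.
(* On the chosen neighbourhood the bump exceeds c / 2, half its value at the centre, so this
   multiple is at least 1. *)
exists (fun z => 2 / c * bump z0 r z); split.
- have -> : (fun z => (2 / c * bump z0 r z)%:C) = fun z =>
  (2 / c)%:C * (bump z0 r z)%:C.
    by apply/funext => z; rewrite rmorphM.
  exact: stestM (smooth_cst _) chi.
- by move=> z; rewrite mulr_ge0 ?bump_ge0// divr_ge0// ltW.
- move=> z /=; rewrite -rmorphB cabsR /= ltr_distl => /andP[h _].
  rewrite mulrAC ler_pdivlMr// mul1r.
  by move: h; set b := bump _ _ _; lra.
- move=> s /hr[C0 hC0]; have t1 := pull_near_stest (eprod s) chi.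
  exists (2 / c * C0).
  apply: filterS (filterI t1 hC0) => l [[_ tl] hl].
  rewrite (_ : (fun z => _) = (fun z =>
    (2 / c)%:C *: ((bump z0 r z)%:C *: eprod s))); last first.
    have Z (V : lmodType C) (x y : R) (e : V) :
      (x * y)%:C *: e = x%:C *: (y%:C *: e).
      by rewrite rmorphM scalerA.
    by apply/funext => z; exact: (Z E).
  have cc0 : 0 <= 2 / c by rewrite divr_ge0// ltW.
  rewrite (TlZ T_pc _ tl) cabsM cabsR (ger0_norm cc0) ler_wpM2l.
Unshelve. all: by end_near. Qed.

Lemma cabs_TlDZ l (a : C) (phi psi : dform R (m + n)) (x y : R) :
  test_form U (pull l phi) -> test_form U (pull l psi) ->
  cabs (Tl l phi) <= x -> cabs (Tl l psi) <= y ->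
  cabs (Tl l (fun z => phi z + a *: psi z)) <= x + cabs a * y.
Proof.
move=> h1 h2 hx hy; rewrite (TlD T_pc h1 (test_pullZ a h2)) (TlZ T_pc a h2).
by rewrite (le_trans (cabsD _ _))// lerD// cabsM ler_wpM2l// cabs_ge0.
Qed.

Lemma cabs_Tl_sum l (I : Type) (r : seq I) (F : I ->
  dform R (m + n)) (c : I -> R) :
  (forall i, test_form U (pull l (F i))) ->
    (forall i, cabs (Tl l (F i)) <= c i) ->
  cabs (Tl l (fun z => \sum_(i <- r) F i z)) <= \sum_(i <- r) c i.
Proof.
move=> tF hF; rewrite (Tl_sum T_pc r tF) (le_trans (cabs_sum _ _ _))//.
by apply: ler_sum => i _; exact: hF.
Qed.

Definition supp_bounded (K : set Cn) (B : R) (f : Cn -> C) :=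
  [/\ smooth f, forall z, ~ K z -> f z = 0 & forall z, cabs (f z) <= B].

Lemma supp_bounded_test (K : set Cn) B f (a : E) l :
  (forall phi : dform R (m + n), (forall A, smooth (fun z => phi z A)) ->
    supported_in K phi -> test_form U (pull l phi)) ->
  supp_bounded K B f -> test_form U (pull l (fun z => f z *: a)).
Proof.
move=> h [fs fK _]; apply: h; first by apply: sformZ => //; exact: sform_cst.
by move=> z /fK ->; exact: scale0r.
Qed.

(** Both B u + g and B u - g are nonnegative, so positivity of T encloses its value on [g] between
    the two signs of its value on B u. *)
Lemma real_bound l (u g : Cn -> R) (B : R) (s : seq Cn) : size s = q ->
  (forall z, `|g z| <= B * u z) ->
  test_form U (pull l (fun z => (u z)%:C *: eprod s)) ->
  test_form U (pull l (fun z => (g z)%:C *: eprod s)) ->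
  cabs (Tl l (fun z => (g z)%:C *: eprod s)) <=
  cabs (B%:C * Tl l (fun z => (u z)%:C *: eprod s)).
Proof.
move=> sizes gB tu tg.
have ZN (V : lmodType C) (k x y : R) (e : V) :
  k%:C *: (x%:C *: e) + y%:C *: e = (k * x + y)%:C *: e.
  by rewrite scalerA -scalerDl -rmorphM -rmorphD.
have pos (y : Cn -> R) : (forall z, 0 <= B * u z + y z) ->
    test_form U (pull l (fun z => (y z)%:C *: eprod s)) ->
    0 <= B%:C * Tl l (fun z => (u z)%:C *: eprod s) + Tl l (fun z =>
      (y z)%:C *: eprod s).
  move=> y0 ty; have tb := test_pullZ B%:C tu.
  rewrite -(TlZ T_pc _ tu) -(TlD T_pc tb ty);
    apply: (Tl_ge0 T_pc (test_pullD tb ty)) => z.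
  apply/strongly_positiveP; rewrite (ZN E); apply: coneZ.
  - exact: mulr_ge0.
  - by rewrite lecR.
  - exact: eprod_pos.
apply: cabs_le_between; first apply: pos => // z.
  by rewrite -lerBlDl sub0r; have := gB z; rewrite ler_norml => /andP[].
have eN : (fun z => (-1) *: ((g z)%:C *: eprod s)) = (fun z =>
  (- g z)%:C *: eprod s).
  have Z (V : lmodType C) (x : R) (e : V) : (-1) *: (x%:C *: e) = (- x)%:C *: e.
    by rewrite scalerA mulN1r rmorphN.
  by apply/funext => z; exact: (Z E).
have tm := test_pullZ (-1) tg; rewrite eN in tm.
have := TlZ T_pc (-1) tg; rewrite eN mulN1r => <-.
by apply: pos => // z; rewrite subr_ge0; have := gB z;
  rewrite ler_norml => /andP[].
Qed.

Lemma eprod_bound (K : set Cn) (s : seq Cn) : compact K -> K `<=` Eb ->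
  size s = q ->
  exists2 C0 : R, 0 <= C0 & \forall l \near +oo, forall B f,
    supp_bounded K B f ->
    cabs (Tl l (fun z => f z *: eprod s)) <= C0 * B.
Proof.
move=> Kc KE sizes; have [u [ut u0 u1 hu]] := cover_bound Kc KE.
have [C0 hC] := hu s sizes; have t1 := pull_near_stest (eprod s) ut.
have t2 := pull_near_test U_open Kc KE.
(* The real and imaginary parts of [f] each cost one constant; the maximum with 0 makes it
   nonnegative. *)
exists (2 * Num.max 0 C0); first by rewrite mulr_ge0// le_max lexx.
apply: filterS (filterI (filterI t1 t2) hC) => l [[[_ tu] [_ tK]] hl] B f fKB.
have [fs fK fB] := fKB.
have gb (g : Cn -> R) : smooth (fun z =>
  (g z)%:C) -> (forall z, ~ K z -> g z = 0) ->
    (forall z, `|g z| <= B) -> test_form U (pull l (fun z =>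
      (g z)%:C *: eprod s)) /\
    cabs (Tl l (fun z => (g z)%:C *: eprod s)) <= Num.max 0 C0 * B.
  move=> gs gK gB.
  have tg : test_form U (pull l (fun z => (g z)%:C *: eprod s)).
    apply: (@supp_bounded_test K B (fun z => (g z)%:C)) => //; split=> // z.
      by move=> /gK ->.
    by rewrite cabsR.
  split=> //.
  have B0 : 0 <= B by apply: le_trans (gB 0).
  apply: le_trans (@real_bound l u g B s sizes _ tu tg) _ => [z|].
    have [Kz|/gK ->] := pselect (K z); last by rewrite normr0 mulr_ge0.
    by apply: le_trans (gB z) _; rewrite -[X in X <= _]mulr1 ler_wpM2l// u1.
  rewrite cabsM cabsR (ger0_norm B0) mulrC ler_wpM2r//.
  by apply: le_trans hl _; rewrite le_max lexx orbT.
have [t3 b3] := gb _ (smooth_Re fs) (fun z nz => congr1 (fun x =>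
  complex.Re x) (fK z nz))
  (fun z => le_trans (Re_cabs _) (fB z)).
have [t4 b4] := gb _ (smooth_Im fs) (fun z nz => congr1 (fun x =>
  complex.Im x) (fK z nz))
  (fun z => le_trans (Im_cabs _) (fB z)).
have -> : (fun z => f z *: eprod s) = (fun z =>
  (complex.Re (f z))%:C *: eprod s +
    'i *: ((complex.Im (f z))%:C *: eprod s)).
  apply/funext => z.
  have Z (V : lmodType C) (x : C) (e : V) :
    x *: e = (complex.Re x)%:C *: e + 'i *: ((complex.Im x)%:C *: e).
    rewrite scalerA -scalerDl; congr (_ *: _).
    by case: x => a b; apply/eqP;
      rewrite eq_complex /= !(mul0r, mulr0, mul1r, addr0, subr0, add0r) !eqxx.
  exact: (Z E).
apply: le_trans (cabs_TlDZ 'i t3 t4 b3 b4) _.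
rewrite (_ : cabs 'i = 1); last by rewrite /cabs normCi.
by rewrite mul1r -[2]/(1 + 1) (mulrDl 1) mul1r (mulrDl _ _ B).
Qed.

(** If the bidegree of e_A is not (q, q), the current vanishes on this form for bidegree reasons.
    Otherwise [span_ebas] writes e_A as a combination of products of forms i alpha /\ conj(alpha),
    each covered by [eprod_bound]. *)
Lemma basis_bound (K : set Cn) (A : {set 'I_((m + n) + (m + n))}) :
  compact K -> K `<=` Eb ->
  exists C0 : R, \forall l \near +oo, forall B f, supp_bounded K B f ->
    test_form U (pull l (fun z => f z *: (ebas A : E))) /\
    cabs (Tl l (fun z => f z *: (ebas A : E))) <= C0 * B.
Proof.
move=> Kc KE; have t2 := pull_near_test U_open Kc KE.
have [[hA aA]|nA] := pselect (#|(A :&: holo)%SET| = q /\ #|(A :&: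
  antiholo)%SET| = q); last first.
  exists 0; apply: filterS t2 => l [_ tK] B f fKB;
    have tl := supp_bounded_test (ebas A) tK fKB.
  split=> //; have [[_ Tpp] _ _] := T_pc.
  have nq : (#|(A :&: holo)%SET|, #|(A :&: antiholo)%SET|) <> (q, q).
    by move=> [h1 h2]; apply: nA.
  rewrite (Tpp _ _ _ nq tl) ?cabs0 ?mul0r// => z.
  by apply: bidegree_sclmap; exact: bidegree_ebas.
have [L [KL eA]] := @span_ebas R (m + n) q A hA aA.
have /choice[c hc] : forall k : 'I_(size L), exists C0 : R, \forall l \near +oo,
    forall B f, supp_bounded K B f -> cabs (Tl l (fun z =>
      f z *: eprod (nth (0, [::]) L k).2)) <= C0 * B.
  move=> k; have [_ sk] := KL _ (mem_nth (0, [::]) (ltn_ord k)).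
  by have [C0 _ hC] := eprod_bound Kc KE sk; exists C0.
exists (\sum_(k < size L) cabs (nth (0, [::]) L k).1 * c k).
have hc' := near_pinfty_forall hc.
apply: filterS (filterI t2 hc') => l [[_ tK] hl] B f fKB.
have tl := supp_bounded_test (ebas A) tK fKB; split=> //.
have tk (k : 'I_(size L)) :=
  supp_bounded_test (eprod (nth (0, [::]) L k).2) tK fKB.
have -> : (fun z => f z *: (ebas A : E)) = fun z => \sum_(k < size L)
    (nth (0, [::]) L k).1 *: (f z *: eprod (nth (0, [::]) L k).2).
  apply/funext => z; rewrite eA (big_nth (0, [::])) big_mkord.
  have Z (V : lmodType C) (I : finType) (x : C) (F : I -> C) (G : I -> V) :
      x *: (\sum_k F k *: G k) = \sum_k F k *: (x *: G k).
    by rewrite scaler_sumr; apply: eq_bigr => k _; rewrite !scalerA mulrC.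
  exact: (Z E).
rewrite mulr_suml.
apply: (@cabs_Tl_sum l _ _ (fun (k : 'I_(size L)) z =>
  (nth (0, [::]) L k).1 *: (f z *: eprod (nth (0, [::]) L k).2))) => k.
  exact: (test_pullZ _ (tk k)).
rewrite (TlZ T_pc _ (tk k)) cabsM -mulrA ler_wpM2l ?cabs_ge0//.
exact: hl.
Qed.

(** Two features are used later: no derivatives of the coefficients enter, so approximation in the
    sup norm is enough, and the threshold for [l] is common to all forms supported in [K]. *)
Lemma main_bound (K : set Cn) : compact K -> K `<=` Eb ->
  exists C0 : R, \forall l \near +oo, forall (phi : dform R (m + n)) B,
    (forall A, smooth (fun z => phi z A)) -> supported_in K phi ->
    (forall A z, cabs (phi z A) <= B) -> cabs (Tl l phi) <= C0 * B.
Proof.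
move=> Kc KE.
have /choice[c hc] := fun A => @basis_bound K A Kc KE.
exists (\sum_A c A); have hc' := near_pinfty_forall hc.
apply: filterS hc' => l hl phi B ps pK pB.
have sb A : supp_bounded K B (fun z => phi z A).
  by split=> // z /pK ->; rewrite ffunE.
have -> : phi = fun z => \sum_A phi z A *: (ebas A : E).
  by apply/funext => z; exact: ebas_expand.
rewrite mulr_suml; apply: (@cabs_Tl_sum l _ _ (fun A z =>
  phi z A *: (ebas A : E))) => A.
  exact: (hl A _ _ (sb A)).1.
exact: (hl A _ _ (sb A)).2.
Qed.

End UniformBound.

(** * Passage to the limit *)

Section CountableDensity.
Context {R : realType} {N : nat}.
Local Notation C := R[i].
Local Notation Cn := 'rV[C]_N.
Local Notation E := (ealg R N).

Definition ratC (x : rat * rat) : C := ratr x.1 +i* ratr x.2.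

Lemma ratC_dense (z : C) (e : R) : 0 < e -> exists x, square z e (ratC x).
Proof.
have H (y : R) : 0 < e -> exists r : rat, `|ratr r - y| <= e.
  move=> e0; have [r] := @rat_in_itvoo R (y - e) (y + e) ltac:(lra).
  by rewrite in_itv /= => /andP[h1 h2]; exists r; rewrite ler_distl !ltW.
move=> e0; have [a ha] := H (complex.Re z) e0;
  have [b hb] := H (complex.Im z) e0.
by exists (a, b).
Qed.

(* A box with rational centre and radius 1/(k+1), and a rational approximation
   of the coefficients of a form on it. *)
Definition bcode := ({ffun 'I_N ->
  rat * rat} * nat * {ffun {set 'I_(N + N)} -> rat * rat})%type.

Definition cbox (b : bcode) : set Cn :=
  box (\row_j ratC (b.1.1 j)) (b.1.2.+1%:R^-1).

Definition cunion (L : seq bcode) : set Cn :=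
  [set z | exists2 b, b \in L & cbox b z].

(** A code is not itself a form: it prescribes coefficients up to 1/(j+1) on finitely many boxes
    containing the support. Two forms with the same code therefore differ by at most 2/(j+1)
    everywhere. *)
Definition approximates (c : nat * seq bcode) (phi : dform R N) :=
  supported_in (cunion c.2) phi /\ forall b, b \in c.2 -> forall z, cbox b z ->
  forall A, cabs (phi z A - ratC (b.2 A)) <= c.1.+1%:R^-1.

Lemma rational_box (z0 : Cn) (O : set Cn) : nbhs z0 O ->
  exists (a : {ffun 'I_N -> rat * rat}) (k : nat), forall v,
    nbhs z0 (cbox (a, k, v)) /\ cbox (a, k, v) `<=` O.
Proof.
move=> /nbhs_box[r r0 rO].
(* The rational centre is chosen within half the radius of [z0], so points of the box are within 3/2
   of the radius of [z0], which is less than [r]. *)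
have [k hk] : exists k : nat, k.+1%:R^-1 < r / 2.
  have r20 : 0 < r / 2 by rewrite divr_gt0.
  have [k _ /(_ k (leqnn k))] := near_infty_natSinv_lt (PosNum r20).
  by exists k.
have k0 : 0 < k.+1%:R^-1 :> R by rewrite invr_gt0 ltr0n.
have /choice[a ha] : forall j, exists x,
  square (z0 0 j) (k.+1%:R^-1 / 2) (ratC x).
  by move=> j; apply: ratC_dense; rewrite divr_gt0.
exists [ffun j => a j], k => v; split.
  apply: (@box_nbhs _ _ _ _ _ (k.+1%:R^-1 / 2)).
    by rewrite /= ltr_pdivrMr// ltr_pMr// ltr1n.
  move=> j; rewrite mxE /= ffunE; have [h1 h2] := ha j.
  by split; rewrite distrC.
move=> w wb; apply: rO => j; have [h1 h2] := ha j.
have := wb j; rewrite mxE /= ffunE => -[h3 h4]; split.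
  rewrite -(subrKA (complex.Re (ratC (a j)))) (le_trans (ler_normD _ _))//.
  by apply: le_trans (lerD h3 h1) _; move: k0 hk => /=; set x := _^-1; lra.
rewrite -(subrKA (complex.Im (ratC (a j)))) (le_trans (ler_normD _ _))//.
by apply: le_trans (lerD h4 h2) _; move: k0 hk => /=; set x := _^-1; lra.
Qed.

Lemma cunion_cat L M : cunion (L ++ M) = cunion L `|` cunion M.
Proof.
apply/seteqP; split=> z.
  by move=> [b]; rewrite mem_cat => /orP[bL|bM] bz; [left|right]; exists b.
by case=> -[b bL bz]; exists b => //; rewrite mem_cat bL ?orbT.
Qed.

Lemma cunion_compact L : compact (cunion L).
Proof.
elim: L => [|b L IH].
  by rewrite (_ : cunion [::] = set0); [exact: compact0 | apply/seteqP;
    split=> z // -[]].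
rewrite -cat1s cunion_cat; apply: compactU => //.
rewrite (_ : cunion [:: b] = cbox b); first exact: box_compact.
apply/seteqP; split=> z; first by move=> [b']; rewrite inE => /eqP ->.
by exists b => //; rewrite mem_head.
Qed.

Lemma compact_cunion (P : bcode -> Prop) (K : set Cn) : compact K ->
  (forall z, K z -> exists b, nbhs z (cbox b) /\ P b) ->
  exists L, (forall b, b \in L -> P b) /\ forall z, K z -> nbhs z (cunion L).
Proof.
move=> Kc KP; pose Q (A : set Cn) := exists L, (forall b, b \in L -> P b) /\
  forall z, A z -> nbhs z (cunion L).
have sub (L M : seq bcode) : {subset L <= M} -> cunion L `<=` cunion M.
  by move=> LM z [b /LM bM bz]; exists b.
apply: (@compact_ind _ Q) Kc _.
- by exists [::].
- by move=> A B AB [L [h1 h2]]; exists L; split=> // z /AB; exact: h2.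
- move=> A B [L [h1 h2]] [M [k1 k2]]; exists (L ++ M); split.
    by move=> b; rewrite mem_cat => /orP[/h1|/k1].
  move=> z [/h2|/k2] /nbhs_rVP[e e0 he]; apply/nbhs_rVP; exists e => // w /he;
    apply: sub => b bL;
    by rewrite mem_cat bL ?orbT.
move=> z /KP[b [zb Pb]]; move: zb => /nbhs_rVP[e e0 he].
exists [set w : Cn | forall j, cabs (w 0 j - z 0 j) < e / 2].
  by apply/nbhs_rVP; exists (e / 2) => //; rewrite divr_gt0.
exists [:: b]; split; first by move=> b'; rewrite inE => /eqP ->.
move=> w wz; apply/nbhs_rVP; exists (e / 2); first by rewrite divr_gt0.
move=> v vw; exists b; first by rewrite mem_head.
apply: he => j; rewrite -(subrKA (w 0 j)) (le_lt_trans (cabsD _ _))//.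
by rewrite (splitr e) ltrD.
Qed.

Lemma compact_neighborhood (K O : set Cn) : compact K -> (forall z, K z ->
  nbhs z O) ->
  exists K', [/\ compact K', K' `<=` O & forall z, K z -> nbhs z K'].
Proof.
move=> Kc KO.
have [L [h1 h2]] : exists L, (forall b, b \in L ->
  cbox b `<=` O) /\ forall z, K z -> nbhs z (cunion L).
  apply: (compact_cunion (P := fun b => cbox b `<=` O)) => // z /KO zO.
  have [a [k h]] := rational_box zO.
  by exists (a, k, [ffun=> (0, 0)]); exact: h.
exists (cunion L); split=> //; first exact: cunion_compact.
by move=> z [b /h1]; exact.
Qed.

Lemma exists_approx (K O : set Cn) (phi : dform R N) (j : nat) : compact K ->
  (forall z, K z -> nbhs z O) -> sform phi -> supported_in K phi ->
  exists L, approximates (j, L) phi /\ cunion L `<=` O.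
Proof.
move=> Kc KO ps pK; pose e : R := j.+1%:R^-1;
  have e0 : 0 < e by rewrite invr_gt0 ltr0n.
pose P b := cbox b `<=` O /\ forall z, cbox b z ->
  forall A, cabs (phi z A - ratC (b.2 A)) <= e.
have [L [h1 h2]] : exists L, (forall b, b \in L -> P b) /\ forall z, K z ->
  nbhs z (cunion L).
  apply: (compact_cunion (P := P)) => // z0 /KO zO.
  (* One third for the oscillation of [phi] near [z0], one each for the real and imaginary parts of
     the rational approximation. *)
  have e30 : 0 < e / 3 by rewrite divr_gt0.
  have /choice[v hv] : forall A, exists x, square (phi z0 A) (e / 3) (ratC x).
    by move=> A; exact: ratC_dense.
  have zA A : nbhs z0 [set z | cabs (phi z A - phi z0 A) < e / 3].
    exact: (@cvgCP R _ _ (nbhs_filter z0) _ _).1 (smooth_cont (ps A) (x:=z0)) _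
      e30.
  have zAll : nbhs z0 [set z | forall A, cabs (phi z A - phi z0 A) < e / 3].
    exact: (@filter_forall Cn _ (fun A =>
      [set z | cabs (phi z A - phi z0 A) < e / 3]) (nbhs z0) (nbhs_filter z0)).
  have [a [k hk]] := rational_box (@filterI _ _ (nbhs_filter z0) _ _ zO zAll).
  exists (a, k, [ffun A => v A]); have [nb sb] := hk [ffun A => v A];
    split=> //; split.
    by move=> z /sb[].
  move=> z /sb[_ /= hz] A;
    rewrite ffunE -(subrKA (phi z0 A)) (le_trans (cabsD _ _))//.
  have [s1 s2] := hv A; have := cabs_le_ReIm (phi z0 A - ratC (v A)).
  rewrite ReB ImB (distrC (complex.Re _)) (distrC (complex.Im _)) => h3.
  have h4 := hz A.
  apply: (le_trans (lerD (ltW h4) (le_trans h3 (lerD s1 s2)))).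
  by clear -e0; lra.
exists L; split; last by move=> z [b /h1[bO _]]; exact: bO.
split; last by move=> b /h1[_ h]; exact: h.
by move=> z nz; apply: pK => /h2 /nbhs_singleton.
Qed.

Lemma approximates_close c (phi psi : dform R N) :
  approximates c phi -> approximates c psi -> forall z A,
  cabs (phi z A - psi z A) <= 2 * c.1.+1%:R^-1.
Proof.
move=> [p1 p2] [s1 s2] z A.
have c0 : 0 <= c.1.+1%:R^-1 :> R by rewrite invr_ge0 ler0n.
have [[b bL bz]|nz] := pselect (cunion c.2 z); last first.
  by rewrite p1// s1// subrr cabs0 mulr_ge0.
rewrite -(subrKA (ratC (b.2 A))) (le_trans (cabsD _ _))//.
have h1 := p2 b bL z bz A; have := s2 b bL z bz A.
rewrite -[cabs (psi _ _ - _)]cabsN opprB => h2.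
by rewrite -[2]/(1 + 1) mulrDl mul1r lerD.
Qed.

End CountableDensity.

(** * Limits along an ultrafilter *)

Section FilterLimits.
Context {R : realType}.
Local Notation C := R[i].
Variables (G : set_system R).
Context {GU : UltraFilter G}.

Definition lim_to (g : R -> C) (x : C) := forall e : R, 0 < e ->
  G [set l | cabs (g l - x) < e].

(** A bounded function eventually takes its values in a compact square, so its image filter has a
    cluster point; for an ultrafilter a cluster point is a limit. *)
Lemma lim_to_exists (g : R -> C) (M : R) : G [set l | cabs (g l) <= M] ->
  exists x, lim_to g x.
Proof.
move=> gM.
have GP : ProperFilter G := @ultra_proper _ G GU.
have FF : ProperFilter (g @ G) := fmap_proper_filter g GP.
have FA : G (g @^-1` square 0 M).
  apply: filterS gM => l /= h; split; rewrite /= subr0.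
    exact: le_trans (Re_cabs _) h.
  exact: le_trans (Im_cabs _) h.
have [x [_ clx]] := square_compact FF FA.
exists x => e e0; apply: contrapT => nG.
have GN : (g @ G) (~` [set y | cabs (y - x) < e]).
  have [h|] := in_ultra_setVsetC [set l | cabs (g l - x) < e] GU;
    first by case: nG.
  exact.
have xB : nbhs x [set y | cabs (y - x) < e] by apply/nbhsCP; exists e.
by have [y [ny yy]] := clx _ _ GN xB.
Qed.

Lemma lim_to_unique g x y : lim_to g x -> lim_to g y -> x = y.
Proof.
move=> gx gy; apply/eqP; rewrite -subr_eq0; apply/negPn/negP => nz.
have d0 : 0 < cabs (x - y) by rewrite -ltcR -normC_cabs normr_gt0.
have e0 : 0 < cabs (x - y) / 2 by rewrite divr_gt0.
have [l [/= h1 h2]] := filter_ex (filterI (gx _ e0) (gy _ e0)).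
suff : cabs (x - y) < cabs (x - y) by rewrite ltxx.
rewrite -[X in X < _](congr1 _ (subrKA (g l) x (- y))) (le_lt_trans (cabsD _
  _))//.
by rewrite -[cabs (x - g l)]cabsN opprB [ltRHS]splitr ltrD.
Qed.

Lemma lim_to_eq g h x : G [set l | g l = h l] -> lim_to g x -> lim_to h x.
Proof. by move=> gh gx e e0;
  apply: filterS (filterI gh (gx e e0)) => l [/= ->]. Qed.

Lemma lim_to_cst x : lim_to (fun=> x) x.
Proof. by move=> e e0; apply: filterE => l /=; rewrite subrr cabs0. Qed.

Lemma lim_toZD (a : C) g h x y : lim_to g x -> lim_to h y ->
  lim_to (fun l => a * g l + h l) (a * x + y).
Proof.
move=> gx hy e e0; have a0 : 0 < cabs a + 1 by rewrite ltr_wpDl// cabs_ge0.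
have e1 : 0 < e / 2 / (cabs a + 1) by rewrite !divr_gt0.
have e2 : 0 < e / 2 by rewrite divr_gt0.
apply: filterS (filterI (gx _ e1) (hy _ e2)) => l [/= h1 h2].
rewrite opprD addrACA -mulrBr (le_lt_trans (cabsD _ _))// (splitr e).
apply: ler_ltD => //; rewrite cabsM.
rewrite (le_trans (_ : _ <= (cabs a + 1) * cabs (g l - x)))//.
  by rewrite ler_wpM2r ?cabs_ge0// lerDl.
by rewrite mulrC -ler_pdivlMr// ltW.
Qed.

Lemma lim_to_bound g x (B : R) : G [set l | cabs (g l) <= B] ->
  lim_to g x -> cabs x <= B.
Proof.
move=> gB gx; apply/ler_addgt0Pr => e e0.
have [l [/= h1 h2]] := filter_ex (filterI gB (gx _ e0)).
have -> : x = g l - (g l - x) by rewrite opprB addrC subrK.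
by rewrite (le_trans (cabsD _ _))// cabsN lerD// ltW.
Qed.

Lemma lim_to_ge0 g x : G [set l | 0 <= g l] -> lim_to g x -> 0 <= x.
Proof.
move=> g0 gx.
have key e : 0 < e -> `|complex.Im x| <= e /\ - e <= complex.Re x.
  move=> e0; have [l [/= h1 h2]] := filter_ex (filterI g0 (gx _ e0)).
  move: h1; rewrite lecE /= => /andP[/eqP im0 re0].
  have := le_trans (Im_cabs (g l - x)) (ltW h2).
  have := le_trans (Re_cabs (g l - x)) (ltW h2).
  rewrite ReB ImB im0 sub0r normrN => h3 h4; split=> //.
  move: h3; rewrite ler_norml => /andP[_ h3].
  by rewrite lerNl -[X in X <= _]add0r (le_trans _ h3)// lerD2r.
rewrite lecE /=; apply/andP; split.
  rewrite -normr_le0; apply/ler_addgt0Pr => e /key[h _].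
  by rewrite add0r.
apply/ler_addgt0Pr => e /key[_ h]; by rewrite -lerBlDr sub0r.
Qed.

End FilterLimits.

Lemma quarter_half_quarter (R : realType) (x e : R) : x < e / 2 ->
  e / 4 + x + e / 4 < e.
Proof. by lra. Qed.

(** * The limit current and a sequence realizing it *)

Section LimitCurrent.
Context {R : realType} {m n p : nat}.
Local Notation C := R[i].
Local Notation Cn := 'rV[C]_(m + n).
Local Notation E := (ealg R (m + n)).
Local Notation smooth := (@smooth_on R (m + n) setT).
Variables (U : set Cn) (T : dform R (m + n) -> C).
Local Notation q := (m + n - p)%N.
Local Notation Eb := (normal_bundle (zero_section U)).
Local Notation Tl l phi := (T (pull l phi)).
Hypotheses (U_open : open U) (T_pc : positive_closed p U T).
Hypothesis T_bound : forall K : set Cn, compact K -> K `<=` Eb ->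
  exists C0 : R, \forall l \near +oo, forall (phi : dform R (m + n)) B,
    (forall A, smooth (fun z => phi z A)) -> supported_in K phi ->
    (forall A z, cabs (phi z A) <= B) -> cabs (Tl l phi) <= C0 * B.

Lemma compact_support_bounded (phi : dform R (m + n)) : test_form Eb phi ->
  exists B : R, forall A z, cabs (phi z A) <= B.
Proof.
move=> [ps [K [Kc _ pK]]].
pose P (S : set Cn) := exists2 B : R, 0 <= B & forall A z, S z ->
  cabs (phi z A) <= B.
have [B B0 h] : P K.
  apply: (@compact_ind _ P) Kc _.
  - by exists 0.
  - by move=> S S' SS' [B B0 h]; exists B => // A z /SS'; exact: h.
  - move=> S S' [B B0 h] [D D0 k]; exists (B + D); first exact: addr_ge0.
    move=> A z [/(h A) zS|/(k A) zS]; apply: le_trans zS _.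
      by rewrite lerDl.
    by rewrite lerDr.
  move=> z0 Kz0.
  have zA A : nbhs z0 [set z | cabs (phi z A - phi z0 A) < 1].
    exact: (@cvgCP R _ _ (nbhs_filter z0) _ _).1 (smooth_cont (ps A) (x:=z0)) _
      ltr01.
  exists [set z | forall A, cabs (phi z A - phi z0 A) < 1].
    exact: (@filter_forall Cn _ (fun A =>
      [set z | cabs (phi z A - phi z0 A) < 1]) (nbhs z0) (nbhs_filter z0)).
  exists (1 + \sum_A cabs (phi z0 A)).
    by rewrite addr_ge0// sumr_ge0// => A _; exact: cabs_ge0.
  move=> A z /(_ A) h; rewrite -(subrK (phi z0 A) (phi z A)) (le_trans (cabsD _
    _))//.
  apply: lerD; first exact: ltW.
  by rewrite (bigD1 A)//= lerDl sumr_ge0// => ? _; exact: cabs_ge0.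
exists B => A z; have [Kz|/pK ->] := pselect (K z); first exact: h.
by rewrite ffunE cabs0.
Qed.

Lemma Tl_eventually_bounded phi : test_form Eb phi ->
  exists M : R, \forall l \near +oo, cabs (Tl l phi) <= M.
Proof.
move=> tp; have [B hB] := compact_support_bounded tp.
have [ps [K [Kc KE pK]]] := tp; have [C0 hC] := T_bound Kc KE.
by exists (C0 * B); apply: filterS hC => l; apply.
Qed.

Variable G : set_system R.
Context {GU : UltraFilter G}.
Hypothesis G_pinfty : pinfty_nbhs R `<=` G.

(** The default 0 is taken only where no limit exists, which by [TlimP] never happens on test
    forms. *)
Definition Tlim (phi : dform R (m + n)) : C :=
  xget 0 [set x | lim_to G (fun l => Tl l phi) x].

Lemma TlimE phi x : lim_to G (fun l => Tl l phi) x -> Tlim phi = x.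
Proof. by move=> h; apply: (lim_to_unique _ h);
  exact: (xgetPex 0 (ex_intro _ x h)). Qed.

Lemma TlimP phi : test_form Eb phi -> lim_to G (fun l => Tl l phi) (Tlim phi).
Proof.
move=> /Tl_eventually_bounded[M hM].
have [x hx] := lim_to_exists (G_pinfty hM).
exact: (xgetPex 0 (ex_intro _ x hx)).
Qed.

(** For large [l] the pulled-back form is a test form on U, and the pullback respects linear
    combinations, bidegree, strong positivity and the exterior derivative. Each property of T thus
    holds eventually and passes to the limit. *)
Lemma Tlim_positive_closed : positive_closed p Eb Tlim.
Proof.
have [[Tcur Tpp] Tpos Tcl] := T_pc.
have near_test phi : test_form Eb phi ->
  G [set l | 0 < l /\ test_form U (pull l phi)].
  by move=> tp; apply: G_pinfty; exact: test_near.
split; [split; [split|]| |].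
- move=> a phi psi tp ts; apply: TlimE.
  apply: lim_to_eq (lim_toZD a (TlimP tp) (TlimP ts)).
  apply: filterS (filterI (near_test _ tp) (near_test _ ts)) =>
    l [[_ h1] [_ h2]] /=.
  by rewrite -(currentZD Tcur a h1 h2) pullZD.
(* The limit has order zero: the bound uses only the empty list of derivatives, so [0%N] serves for
   every compact set. *)
- move=> K Kc KE; have [C0 hC] := T_bound Kc KE;
  exists C0, 0%N => phi B tp pK hB.
  apply: lim_to_bound (TlimP tp); apply: filterS (G_pinfty hC) => l h.
  have [ps _] := tp; apply: h => // A z; exact: (hB A [::] z isT).
- move=> a b phi nab tp hb; apply: TlimE; apply: lim_to_eq (lim_to_cst 0).
  apply: filterS (near_test _ tp) => l [_ h] /=; apply/esym;
    apply: (Tpp a b) => // z.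
  exact: bidegree_sclmap.
- move=> phi tp hp; apply: lim_to_ge0 (TlimP tp).
  apply: filterS (near_test _ tp) => l [_ h] /=; exact: (Tl_ge0 T_pc).
- move=> phi tp; apply: TlimE; apply: lim_to_eq (lim_to_cst 0).
  apply: filterS (near_test _ tp) => l [_ h] /=.
  have -> : pull l (dext phi) = dext (pull l phi).
    by apply/funext => z; rewrite /pull sclmap_dext//; have [] := tp.
  by rewrite Tcl.
Qed.

Lemma near_along (lam : nat -> R) (P : R ->
  Prop) : (forall j, j.+1%:R <= lam j) ->
  (\forall l \near +oo, P l) -> \forall j \near \oo, P (lam j).
Proof.
move=> hlam [M [_ hM]]; have := nbhs_infty_ger M.
apply: filterS => j Mj; apply: hM; apply: le_lt_trans Mj _.
by apply: lt_le_trans (hlam j); rewrite ltr_nat.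
Qed.

(** Convergence is imposed on the countable family [fam] only. Any test form differs from a member
    of the family by a form with fixed compact support and small sup norm, on which the order-zero
    bound controls the dilated currents and the limit alike. *)
Lemma Tlim_sequence : exists lam : nat -> R, (forall j, j.+1%:R <= lam j) /\
  forall phi, test_form Eb phi -> forall e : R, 0 < e ->
  \forall j \near \oo, cabs (Tl (lam j) phi - Tlim phi) < e.
Proof.
have /choice[fam hfam] : forall c : nat * seq (@bcode (m + n)),
  exists phi : dform R (m + n),
    test_form Eb phi /\ ((exists2 psi,
      test_form Eb psi & approximates c psi) -> approximates c phi).
  move=> c; have [[psi tp ap]|nex] :=
    pselect (exists2 psi : dform R (m + n),
    test_form Eb psi & approximates c psi).
    by exists psi.
  by exists (fun=> 0); split=> //; exact: test_form0.
(* At stage [j] only the finitely many codes numbered up to [j] are imposed; a finite intersection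
   of members of the ultrafilter is nonempty, so a common [l] exists. *)
have /choice[lam hlam] : forall j : nat, exists l : R, j.+1%:R <= l /\
    forall k : 'I_j.+1, forall c, unpickle k = Some c ->
      cabs (Tl l (fam c) - Tlim (fam c)) < j.+1%:R^-1.
  move=> j; have j0 : 0 < j.+1%:R^-1 :> R by rewrite invr_gt0 ltr0n.
  have h1 : G [set l | j.+1%:R <= l] by apply: G_pinfty; exact: near_pinfty_le.
  have h2 : G [set l | forall k : 'I_j.+1, forall c, unpickle k = Some c ->
      cabs (Tl l (fam c) - Tlim (fam c)) < j.+1%:R^-1].
    apply: (@filter_forall R _ (fun (k : 'I_j.+1) l =>
      forall c, unpickle k = Some c ->
      cabs (Tl l (fam c) - Tlim (fam c)) < j.+1%:R^-1) G) => k.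
    case: (unpickle k) => [c|]; last by apply: filterE => l c.
    by apply: filterS (TlimP (hfam c).1 j0) => l h c' [<-].
  have [l [/= l1 l2]] := filter_ex (filterI h1 h2).
  by exists l.
have lamj j := (hlam j).1.
exists lam; split=> // phi tp e e0.
have [ps [K [Kc KE pK]]] := tp.
have KEn z : K z -> nbhs z Eb.
  move=> /KE Ez; have := nbhs_collapse (Eb_nbhs U_open Ez);
    move=> /nbhs_rVP[d d0 hd].
  by apply/nbhs_rVP; exists d => // w /hd h; rewrite normal_bundleE;
    exact: nbhs_singleton h.
(* The boxes of a code may overflow the support of [phi], so the support of the difference is
   controlled in a compact neighbourhood rather than in [K]. *)
have [K' [K'c K'E KK']] := compact_neighborhood Kc KEn.
have [C0 hC] := T_bound K'c K'E.
pose D := Num.max 0 C0 + 1; have D0 : 0 < D by rewrite ltr_wpDl// le_max lexx.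
have C0D : C0 <= D by rewrite (@le_trans _ _ (Num.max 0 C0)) ?le_max ?lexx
  ?orbT// lerDl.
(* Forms sharing a code of precision [i] differ by at most 2/(i+1). The positive majorant [D] of
   [C0] can be divided by, and the resulting [i] makes the bound on the difference at most e / 4. *)
have d0 : 0 < e / 4 / (D * 2) by rewrite !divr_gt0// mulr_gt0.
have [i _ /(_ i (leqnn i)) hi] := near_infty_natSinv_lt (PosNum d0).
have delta : C0 * (2 * i.+1%:R^-1) <= e / 4.
  apply: (@le_trans _ _ (D * (2 * i.+1%:R^-1))).
    by rewrite ler_wpM2r// mulr_ge0// invr_ge0 ler0n.
  by move: hi; rewrite /= ltr_pdivlMr ?mulr_gt0// => /ltW; rewrite mulrC mulrA.
have [L [apL LK']] := exists_approx i Kc KK' ps pK.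
pose c := (i, L); pose psi : dform R (m + n) := fam c.
have tpsi : test_form Eb psi := (hfam c).1.
have apsi : approximates c psi by apply: (hfam c).2; exists phi.
pose dlt : dform R (m + n) := fun z => (-1) *: psi z + phi z.
have tdl : test_form Eb dlt by exact: test_formZD.
have dsupp : supported_in K' dlt.
  move=> z nz; have nL : ~ cunion L z by move=> /LK'.
  rewrite /dlt (apL.1 z nL) (apsi.1 z nL) addr0.
  exact: scaler0.
have dB A z : cabs (dlt z A) <= 2 * i.+1%:R^-1.
  rewrite /dlt (coefD (-1 *: psi z) (phi z)) (coefZ (-1) (psi z)) mulN1r addrC.
  exact: (approximates_close apL apsi).
have hdl : \forall l \near +oo, cabs (Tl l dlt) <= e / 4.
  apply: filterS hC => l h; apply: le_trans delta.
  by apply: h => //; have [] := tdl.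
have lin : \forall l \near +oo, Tl l dlt = - Tl l psi + Tl l phi.
  have [[Tcur _] _ _] := T_pc.
  apply: filterS (filterI (test_near U_open tpsi) (test_near U_open tp)) =>
    l [[_ h1] [_ h2]].
  by rewrite /dlt pullZD (currentZD Tcur _ h1 h2) mulN1r.
have [[[Tlin _] _] _ _] := Tlim_positive_closed.
have linT : Tlim dlt = - Tlim psi + Tlim phi by rewrite /dlt Tlin// mulN1r.
have hdT : cabs (Tlim dlt) <= e / 4.
  by apply: lim_to_bound (TlimP tdl); exact: G_pinfty.
have e20 : 0 < e / 2 by rewrite divr_gt0.
have f1 := near_along lamj hdl; have f2 := near_along lamj lin.
have f3 : \forall j \near \oo, (pickle c <= j)%N by exists (pickle c).
have f4 := near_infty_natSinv_lt (PosNum e20).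
apply: filterS (filterI (filterI f1 f2) (filterI f3 f4)) =>
  j [[h1 h2] [h3 /= h4]].
have h5 : cabs (Tl (lam j) psi - Tlim psi) < e / 2.
  apply: lt_trans h4; have pj : (pickle c < j.+1)%N by [].
  by apply: ((hlam j).2 (Ordinal pj)); exact: pickleK.
(* The error is split into e / 4 for the dilated current on the difference, e / 2 for the
   convergence on the family member, and e / 4 for the limit on the difference. *)
have -> : Tl (lam j) phi - Tlim phi =
    Tl (lam j) dlt + (Tl (lam j) psi - Tlim psi) + (- Tlim dlt).
  rewrite h2 linT; ring.
apply: le_lt_trans (cabsD _ _) _; rewrite cabsN.
have h6 := le_trans (cabsD (Tl (lam j) dlt) (Tl (lam j) psi - Tlim psi)) (lerD
  h1 (lexx _)).
apply: le_lt_trans (lerD h6 hdT) _.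
exact: quarter_half_quarter.
Qed.

End LimitCurrent.

Local Open Scope complex_scope.

(* N = m + n, where n is the codimension of V = zero_section U. *)
Theorem theorem2p15 (R : realType) (m n p : nat)
    (U : set 'rV[R[i]]_(m + n)) (T : dform R (m + n) -> R[i])
    (n_ge1 : (1 <= n)%N) (p_le : (p <= m + n)%N)
    (U_open : open U) (U_connected : connected U) (U_neq0 : U !=set0)
    (U_sub_E : U `<=` normal_bundle (zero_section U))
    (V_bounded : bounded_set (zero_section U))
    (V_simply_connected : @simply_connected R _ (zero_section U))
    (V_smooth_boundary : smooth_boundary (zero_section U))
    (T_positive_closed : positive_closed p U T)
    (T_mass : forall i : nat,
      (maxn (n - p) 0 <= i <= minn (m + n - p) n)%N ->
      exists r : R, 0 < r /\
        loc_unif_bounded_mass [set lambda : R[i] | r <= cabs lambda] U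
          (fun lambda =>
             cwedge (cwedge T (TT lambda^-1 i))
                    (pullback lsubmx (wedge_pow omegaV (m + n - p - i))))) :
  exists Tinf : dform R (m + n) -> R[i], tangent_current p U T Tinf.
Proof.
have T_bound := main_bound U_open T_positive_closed
  (eprod_bound_near p_le U_open T_positive_closed T_mass).
have [G [GU Goo]] := ultraFilterLemma (@proper_pinfty_nbhs R).
have [lam [lamj lamP]] := Tlim_sequence U_open T_positive_closed T_bound Goo.
have lam0 j : 0 < lam j by apply: lt_le_trans (lamj j); rewrite ltr0n.
exists (Tlim T G); split; first exact: Tlim_positive_closed.
exists (fun j => (lam j)%:C); split.
- by move=> j; rewrite eq_complex /= eqxx andbT gt_eqF.
- apply/cvgryPge => A; near=> j; rewrite cabsR gtr0_norm//.
  apply: le_trans (lamj j); rewrite -natr1 ler_wpDr//.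
  by near: j; exact: nbhs_infty_ger.
- move=> phi tp; split.
    have := near_along lamj (test_near U_open tp).
    by apply: filterS => j [_ h]; rewrite pullbackE.
  have -> : (fun j => Defs.pushforward (dilation (lam j)%:C) T phi) = fun j =>
    T (pull (lam j) phi).
    by apply/funext => j; rewrite /Defs.pushforward pullbackE.
  by apply/cvgCP => e e0; exact: lamP.
Unshelve. all: by end_near. Qed.
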